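(* Let $K$ be a differential field of characteristic $0$ with $m$ commuting derivations. Let $V\subseteq\mathbb A^n$ be a Kolchin-closed set over $K$, irreducible over $K$, with differential transcendence degree $d$. Let $H$ be a generic (with respect to $K$) differential hypersurface of some degree and order $h$, with coefficient tuple $\bar a$. Then $V\cap H$ is irreducible over $K\langle\bar a\rangle$. If $d=0$ then $V\cap H=\emptyset$. If $d>0$, then $$\omega_{V\cap H/K\langle\bar a\rangle}(t)=\omega_{V/K}(t)-\binom{t+m-h}{m}.$$
   Context: A generic differential hypersurface of order $h$ and degree $r$ over $K$ is the zero set of $a_0+\sum_i a_i m_i(\bar y)$, where the $m_i$ range over all differential monomials in $y_1,\dots,y_n$ other than $1$ of order at most $h$ and degree at most $r$, and $\bar a=(a_0,a_1,\dots)$ are independent differential transcendentals over $K$. The Kolchin polynomial $\omega_{W/F}(t)$ of an irreducible variety $W$ over $F$ is the numerical polynomial which, for large $t$, gives the transcendence degree over $F$ of the field generated by all derivatives of order at most $t$ of the coordinates of a generic point of $W$ over $F$. *)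

(* Defs.v *)
From HB Require Import structures.
From mathcomp Require Import all_boot all_order all_algebra.
From mathcomp Require Import finmap.
From mathcomp Require Import boolp classical_sets.
From mathcomp.multinomials Require Import monalg.

Set Implicit Arguments.
Unset Strict Implicit.
Unset Printing Implicit Defensive.

Import GRing.Theory.

Local Open Scope classical_set_scope.
Local Open Scope ring_scope.

Record diffField (m : nat) := DiffField {
  diffField_sort :> fieldType;
  der : 'I_m -> diffField_sort -> diffField_sort;
  derD : forall i x y, der i (x + y) = der i x + der i y;
  derM : forall i x y, der i (x * y) = der i x * y + x * der i y;
  derC : forall i j x, der i (der j x) = der j (der i x);
  diffField_char0 : [pchar diffField_sort] =i pred0
}.

(* [th i] is the exponent of the i-th derivation in the derivative operator. *)
Definition dop (m : nat) := {ffun 'I_m -> nat}.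

Definition dord (m : nat) (th : dop m) : nat := (\sum_i th i)%N.

Definition dapp (m : nat) (U : diffField m) (th : dop m) (x : U) : U :=
  foldr (fun i => iter (th i) (der i)) x (enum 'I_m).

Section Subfields.
Variables (m : nat) (U : diffField m).
Implicit Types F S : set U.

Definition is_subfield F : Prop := GRing.divring_closed (mem F).

Definition is_diff_subfield F : Prop :=
  is_subfield F /\ forall i x, F x -> F (der i x).

Definition adjoin F S : set U := smallest is_subfield (F `|` S).

Definition diff_adjoin F S : set U := smallest is_diff_subfield (F `|` S).

End Subfields.

Definition diff_hom (m : nat) (F E : diffField m) (f : {rmorphism F -> E}) :
  Prop := forall i x, f (der i x) = der i (f x).

(* Kolchin's universal differential extension of K: for every F finitely
   generated over K inside U, every finitely generated differential field
   extension E of F embeds into U over F. *)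
Definition universal_over (m : nat) (U : diffField m) (K : set U) : Prop :=
  forall (F E : diffField m) (f : {rmorphism F -> U}) (g : {rmorphism F -> E}),
    diff_hom f -> diff_hom g ->
    (exists s : seq U, range f = diff_adjoin K [set` s]) ->
    (exists s : seq E, diff_adjoin (range g) [set` s] = setT) ->
    exists2 j : {rmorphism E -> U}, diff_hom j & forall x, j (g x) = f x.

Section Polynomials.
Variables (R : fieldType) (I : choiceType).

(* Polynomial ring in the possibly infinitely many variables indexed by I. *)
Definition ipoly := {malg R[{cmonom I}]}.

Definition ipoly_over (F : set R) (p : ipoly) : Prop := forall mu, F p@_mu.

Definition ieval (x : I -> R) (p : ipoly) : R :=
  mmap idfun (fun mu : {cmonom I} =>
    \prod_(i <- finsupp mu) x i ^+ mu i) p.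

Definition alg_indep (F : set R) (x : I -> R) : Prop :=
  forall p : ipoly, ipoly_over F p -> ieval x p = 0 -> p = 0.

End Polynomials.

Section Transcendence.
Variables (m : nat) (U : diffField m).
Implicit Types F E : set U.

Definition algebraic_over F (x : U) : Prop :=
  exists p : {poly U}, [/\ p != 0, forall i, F p`_i & root p x].

Definition is_trdeg F E (k : nat) : Prop :=
  exists c : 'I_k -> U,
    [/\ forall i, E (c i),
        alg_indep F c
      & forall x, E x -> algebraic_over (adjoin F (range c)) x].

Definition diff_indep (J : choiceType) F (x : J -> U) : Prop :=
  alg_indep F (fun v : J * dop m => dapp v.2 (x v.1)).

Definition diff_algebraic_over F (x : U) : Prop :=
  exists p : ipoly U (dop m),
    [/\ p != 0, ipoly_over F p & ieval (fun th => dapp th x) p = 0].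

Definition is_diff_trdeg F E (d : nat) : Prop :=
  exists c : 'I_d -> U,
    [/\ forall i, E (c i),
        diff_indep F c
      & forall x, E x -> diff_algebraic_over (diff_adjoin F (range c)) x].

End Transcendence.

Section KolchinTopology.
Variables (m : nat) (U : diffField m) (n : nat).
Implicit Types (F : set U) (W : set 'rV[U]_n) (b : 'rV[U]_n).

(* The variable (i, th) stands for the derivative th y_i. *)
Definition dvar := ('I_n * dop m)%type.

Definition dpoly := ipoly U dvar.

Definition deval (p : dpoly) b : U :=
  ieval (fun v : dvar => dapp v.2 (b 0 v.1)) p.

Definition kolchin_closed F W : Prop :=
  exists2 S : set dpoly, (forall p, S p -> ipoly_over F p) &
    W = [set y | forall p, S p -> deval p y = 0].

(* The empty set counts as irreducible. *)
Definition kolchin_irreducible F W : Prop :=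
  kolchin_closed F W /\
  forall W1 W2, kolchin_closed F W1 -> kolchin_closed F W2 ->
    W = W1 `|` W2 -> W = W1 \/ W = W2.

Definition generic_point F W b : Prop :=
  W b /\ forall p : dpoly, ipoly_over F p -> deval p b = 0 ->
    forall y, W y -> deval p y = 0.

Definition coords b : set U := [set b 0 i | i in setT].

Definition jet (t : nat) b : set U :=
  [set dapp v.2 (b 0 v.1) | v in [set v : dvar | (dord v.2 <= t)%N]].

Definition variety_diff_trdeg F W (d : nat) : Prop :=
  exists2 b, generic_point F W b &
    is_diff_trdeg F (diff_adjoin F (coords b)) d.

Definition kolchin_poly F W (w : {poly rat}) : Prop :=
  exists2 b, generic_point F W b &
    exists N : nat, forall t : nat, (N <= t)%N ->
      exists2 k : nat, is_trdeg F (adjoin F (jet t b)) k & w.[t%:R] = k%:R.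

Definition dmonom_le (h r : nat) (mu : {cmonom dvar}) : bool :=
  all (fun v : dvar => (dord v.2 <= h)%N) (finsupp mu) && (mdeg mu <= r)%N.

(* The monomial 1 is included, so that the coefficient a_0 is one of the
   independent coefficients; only finitely many monomials satisfy
   [dmonom_le h r]. *)
Definition generic_dpoly F (h r : nat) (f : dpoly) : Prop :=
  (forall mu, ~~ dmonom_le h r mu -> f@_mu = 0) /\
  diff_indep F (fun mu : {mu : {cmonom dvar} | dmonom_le h r mu} =>
                  f@_(val mu)).

Definition hcoeffs (h r : nat) (f : dpoly) : set U :=
  [set f@_mu | mu in [set mu | dmonom_le h r mu]].

Definition hypersurface (f : dpoly) : set 'rV[U]_n := [set y | deval f y = 0].

End KolchinTopology.

(* The polynomial binom(X + c, m), i.e. (X + c)(X + c - 1)...(X + c - m + 1)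
   divided by m!, as a polynomial in X. *)
Definition binom_poly (m : nat) (c : rat) : {poly rat} :=
  (m`!%:R)^-1 *: \prod_(i < m) ('X + (c - i%:R)%:P).

(* Main.v *)
(** Let [b] be a generic point of [V] over [K], let [a'] be differentially
independent over [K<b>], and put [a0 := - sum a'_mu mu(b)], so that [b] lies on
the hypersurface with coefficients [(a0, a')].  If [d > 0], then for an orderly
ranking some coordinate [b_i] has no leader: [theta b_i], for [theta] of order
[> t], is independent over the jets of order [<= t].  Otherwise the transcendence
degree of the jets of order [<= t] would grow like [t^(m-1)], leaving no room for
a differential transcendental.  Being a generic combination, [a0] inherits this
property: [theta a0], for [theta] of order [> t - h], is independent over [K<a'>]
and the jets of order [<= t] of [b].  In particular [(a0, a')] is differentially
independent over [K], so by universality it may be taken to be the given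
coefficient tuple [a].  A relation over [K<a>] at [b] becomes, after eliminating
[a0], a relation whose coefficients in [a'] vanish at [b], hence on [V]; so [b] is
generic in the intersection, which is therefore irreducible.  Over [K<a'>] the
jets of order [<= t] of [b] still have rank [omega_V(t)]; the [theta a0] of order
[<= t - h], which are [binom(t - h + m, m)] many and independent, lie in the field
they generate, and those of higher order are independent of it, which gives the
formula.  If [d = 0], every point of [V] is differentially algebraic over [K], so
[a0] would be differentially algebraic over [K<a'>]. *)

Require Import Defs.
From HB Require Import structures.
From mathcomp Require Import all_boot all_order all_algebra.
From mathcomp Require Import finmap ring zify fraction generic_quotient.
From mathcomp Require Import boolp classical_sets.
From mathcomp.multinomials Require Import monalg.

Set Implicit Arguments.
Unset Strict Implicit.
Unset Printing Implicit Defensive.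

Import GRing.Theory.

Local Open Scope fset_scope.
Local Open Scope classical_set_scope.
Local Open Scope ring_scope.

(** * Polynomials in arbitrarily many variables *)

(** The coefficients of [f] are given in [U] in advance, and universality only embeds finitely
    generated extensions of finitely generated fields; it does not directly yield a point of V
    matching given coefficients. So the section is built outside [U]: in the fraction field [E0] of
    a differential polynomial ring over [U], K<a> is mapped isomorphically onto the field of the
    constructed tuple, the image of [b] is adjoined, and the resulting extension is embedded back
    into [U] over K<a>. The coefficients thus keep their values and the point moves: [b] becomes
    another generic point [b1] of V. This is why ranks and leaders must be transferred between
    points satisfying the same equations over [K]. Dimension counts take place in the pregeometry of
    [cl], where exchange and the symmetry of independence replace elimination. Explicit polynomials
    return only for what closure cannot express: the independence of a combination that itself
    involves [a'], and the specialization of relations from [b1] to other points. *)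

Section MonomialEvaluation.
Variables (I : choiceType) (S : comNzRingType) (x : I -> S).

Definition moneval (mu : {cmonom I}) : S :=
  \prod_(i <- finsupp mu) x i ^+ mu i.

Lemma moneval_sub (mu : {cmonom I}) (D : {fset I}) :
  (finsupp mu `<=` D)%fset -> moneval mu = \prod_(i <- D) x i ^+ mu i.
Proof.
move=> le; rewrite /moneval (big_fset_incl _ le) //= => i _.
by rewrite -cmE_eq0 => /eqP ->; rewrite expr0.
Qed.

Lemma moneval_mmorphism : mmorphism moneval.
Proof.
split=> [mu nu|]; last by rewrite /moneval mdom1 big_seq_fset0.
rewrite {1}/moneval mdomD.
rewrite (moneval_sub (fsubsetUl (finsupp mu) (finsupp nu))).
rewrite (moneval_sub (fsubsetUr (finsupp mu) (finsupp nu))).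
by rewrite -big_split /=; apply: eq_bigr => i _; rewrite cmM exprD.
Qed.

HB.instance Definition _ :=
  isMultiplicative.Build _ _ moneval moneval_mmorphism.

Lemma monevalU i : moneval (ucm i) = x i.
Proof. by rewrite /moneval mdomU big_seq_fset1 cmUU expr1. Qed.

End MonomialEvaluation.

HB.lock Definition pvar (I : choiceType) (R : comNzRingType) (i : I) :
  {malg R[{cmonom I}]} := << ucm i >>.

HB.lock Definition pconst (I : choiceType) (R : comNzRingType) (c : R) :
  {malg R[{cmonom I}]} := c%:MP.

Arguments pvar {I R} i.
Arguments pconst {I R} c.

Notation "''V_' i" := (pvar i) (at level 8, i at level 2, format "''V_' i").
Notation "c %:K" := (pconst c) (at level 2, left associativity, format "c %:K").

Section Constants.
Variables (I : choiceType) (R : comNzRingType).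
Local Notation P := {malg R[{cmonom I}]}.

Lemma pconst_zmod_morphism : zmod_morphism (@pconst I R).
Proof. by move=> a b; rewrite pconst.unlock; exact: raddfB. Qed.

Lemma pconst_monoid_morphism : monoid_morphism (@pconst I R).
Proof. by rewrite pconst.unlock; split; [exact: rmorph1|exact: rmorphM]. Qed.

HB.instance Definition _ :=
  GRing.isZmodMorphism.Build _ _ (@pconst I R) pconst_zmod_morphism.
HB.instance Definition _ :=
  GRing.isMonoidMorphism.Build _ _ (@pconst I R) pconst_monoid_morphism.

Lemma pconst0 : 0%:K = 0 :> P. Proof. exact: rmorph0. Qed.
Lemma pconst1 : 1%:K = 1 :> P. Proof. exact: rmorph1. Qed.
Lemma pconstM a b : (a * b)%:K = a%:K * b%:K :> P. Proof. exact: rmorphM. Qed.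
Lemma pconst_coef a : (a%:K : P)@_mone = a.
Proof. by rewrite pconst.unlock malgCK. Qed.

Lemma mcoeff_pconst a mu : (a%:K : P)@_mu = if mu == mone then a else 0.
Proof. by rewrite pconst.unlock mcoeffC; case: eqP. Qed.

Lemma mcoeff_pvar i mu : ('V_i : P)@_mu = if ucm i == mu then 1 else 0.
Proof. by rewrite pvar.unlock mcoeffU1; case: eqP. Qed.

End Constants.

HB.lock Definition peval (I : choiceType) (R S : comNzRingType) (phi : {rmorphism R -> S})
  (x : I -> S) : {malg R[{cmonom I}]} -> S := mmap phi (moneval x).

Section EvaluationMorphism.
Variables (I : choiceType) (R S : comNzRingType) (phi : {rmorphism R -> S})
  (x : I -> S).

Lemma peval_zmod_morphism : zmod_morphism (peval phi x).
Proof. by move=> p q; rewrite peval.unlock; exact: raddfB. Qed.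

Lemma peval_monoid_morphism : monoid_morphism (peval phi x).
Proof.
by rewrite peval.unlock; split; [exact: rmorph1|exact: rmorphM].
Qed.

HB.instance Definition _ :=
  GRing.isZmodMorphism.Build _ _ (peval phi x) peval_zmod_morphism.
HB.instance Definition _ :=
  GRing.isMonoidMorphism.Build _ _ (peval phi x) peval_monoid_morphism.

End EvaluationMorphism.

Section Evaluation.
Variables (I : choiceType) (R S : comNzRingType) (phi : {rmorphism R -> S}).
Implicit Types (x : I -> S) (p : {malg R[{cmonom I}]}).

Lemma pevalC x c : peval phi x c%:K = phi c.
Proof. by rewrite peval.unlock pconst.unlock mmapC. Qed.

Lemma pevalX x i : peval phi x 'V_i = x i.
Proof. by rewrite peval.unlock pvar.unlock mmapU /= rmorph1 mul1r monevalU. Qed.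

End Evaluation.

Lemma ievalE (R : fieldType) (I : choiceType) (x : I -> R) (p : ipoly R I) :
  ieval x p = peval idfun x p.
Proof. by rewrite peval.unlock. Qed.

Section PolyInduction.
Variables (I : choiceType) (R : comNzRingType).
Local Notation P := {malg R[{cmonom I}]}.

Definition vars_in (D : set I) (p : P) : Prop :=
  forall mu, mu \in msupp p -> forall i, i \in finsupp mu -> D i.

Definition coefs_in (F : set R) (p : P) : Prop := forall mu, F p@_mu.

Lemma malgUM (a b : R) (mu nu : {cmonom I}) :
  << a *g mu >> * << b *g nu >> = << a * b *g mmul mu nu >> :> P.
Proof. exact: fgmulUU. Qed.

Lemma monom_prod (mu : {cmonom I}) :
  << mu >> = \prod_(i <- finsupp mu) 'V_i ^+ mu i :> P.
Proof.
rewrite pvar.unlock; have UX (i : I) k : (<< ucm i >> : P) ^+ k = << iter k (mmul (ucm i)) mone >>.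
  elim: k => [|k IH]; first by rewrite expr0.
  rewrite exprS IH malgUM mulr1; exact: erefl.
have iterE (i j : I) k : (iter k (mmul (ucm i)) mone : {cmonom I}) j
    = ((i == j) * k)%N.
  elim: k => [|k IH] /=; first by rewrite cm1 muln0.
  by rewrite cmM IH cmU mulnS.
have prodE (s : seq I) (g : I -> {cmonom I}) :
    \prod_(i <- s) (<< g i >> : P) = << \big[mmul/mone]_(i <- s) g i >>.
  elim: s => [|i s IH]; first by rewrite !big_nil.
  rewrite !big_cons IH malgUM mulr1; exact: erefl.
under eq_bigr do rewrite UX.
rewrite prodE; congr (<< _ >>); apply/eqP/cmP => j.
have bigE (s : seq I) (g : I -> {cmonom I}) :
    (\big[mmul/mone]_(i <- s) g i) j = (\sum_(i <- s) g i j)%N.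
  elim: s => [|i s IH]; first by rewrite !big_nil cm1.
  by rewrite !big_cons cmM IH.
rewrite bigE; under eq_bigr do rewrite iterE.
case: (mdomP mu j) => [jm|jm].
  rewrite (big_fsetD1 j) //= eqxx mul1n big1_fset ?addn0 // => i.
  by rewrite in_fsetD1; case: eqP.
rewrite big1_fset // => i im _.
by case: eqP im jm => // -> ->.
Qed.

(** A polynomial is a sum of constants times products of variables, so stability of [Q] under the
    ring operations suffices. [Q 0] and [Q 1] are separate hypotheses because [F] is any set,
    possibly without 0 and 1. *)
Lemma ipoly_ind_over (F : set R) (D : set I) (Q : P -> Prop) :
  Q 0 -> Q 1 -> (forall c, F c -> Q c%:K) -> (forall i, D i -> Q 'V_i) ->
  (forall p q, Q p -> Q q -> Q (p + q)) ->
  (forall p q, Q p -> Q q -> Q (p * q)) ->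
  forall p, coefs_in F p -> vars_in D p -> Q p.
Proof.
move=> Q0 Q1 QC QV QD QM p Fp Dp; rewrite [p]monalgE big_seq.
apply: (big_ind Q); [exact: Q0|exact: QD|move=> mu mup {Q0}].
have -> : << p@_mu *g mu >> = (p@_mu)%:K * << mu >> :> P.
  rewrite pconst.unlock malgUM mulr1 mul1m; exact: erefl.
apply: (QM); first exact: QC.
rewrite monom_prod big_seq; apply: (big_ind Q); [exact: Q1|exact: (QM)|].
move=> i imu; have Qi : Q 'V_i by apply: QV; apply: Dp imu.
elim: (mu i) => [|k IH]; first by rewrite expr0; exact: Q1.
by rewrite exprS; apply: QM; [exact: Qi|exact: IH].
Qed.

Lemma ipoly_ind (Q : P -> Prop) :
  (forall c, Q c%:K) -> (forall i, Q 'V_i) ->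
  (forall p q, Q p -> Q q -> Q (p + q)) ->
  (forall p q, Q p -> Q q -> Q (p * q)) -> forall p, Q p.
Proof.
move=> QC QV QD QM p; apply: (@ipoly_ind_over setT setT); [..|by []|by []].
- by rewrite -pconst0; apply: QC.
- by rewrite -pconst1; apply: QC.
- by move=> c _; apply: QC.
- by move=> i _; apply: QV.
- exact: QD.
- exact: QM.
Qed.

Lemma vars_inC D c : vars_in D c%:K.
Proof.
rewrite pconst.unlock.
move=> mu /(fsubsetP (msuppC_le _)); rewrite in_fset1 => /eqP -> i.
by rewrite mdom1 in_fset0.
Qed.

Lemma vars_inX (D : set I) i : D i -> vars_in D 'V_i.
Proof.
rewrite pvar.unlock.
move=> Di mu /(fsubsetP msuppU_le); rewrite in_fset1 => /eqP -> j.
by rewrite mdomU in_fset1 => /eqP ->.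
Qed.

Lemma vars_inD D p q : vars_in D p -> vars_in D q -> vars_in D (p + q).
Proof.
move=> Dp Dq mu /(fsubsetP (msuppD_le _ _)); rewrite in_fsetU.
by case/orP; [apply: Dp|apply: Dq].
Qed.

Lemma vars_inM D p q : vars_in D p -> vars_in D q -> vars_in D (p * q).
Proof.
move=> Dp Dq mu /msuppM_le [k1 [k2 [k1p k2q ->]]] i.
by rewrite mdomD in_fsetU => /orP[]; [apply: Dp|apply: Dq].
Qed.

Lemma vars_in0 D : vars_in D 0.
Proof. by move=> mu; rewrite msupp0. Qed.

Lemma vars_in_sub (D D' : set I) p : D `<=` D' -> vars_in D p -> vars_in D' p.
Proof. by move=> DD' Dp mu mup i /(Dp _ mup) /DD'. Qed.

Lemma vars_in_all (p : P) :
  exists D : {fset I}, vars_in [set` D] p.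
Proof.
exists (\bigcup_(mu <- msupp p) finsupp mu)%fset => mu mup i imu /=.
by apply/bigfcupP; exists mu => //; rewrite mup.
Qed.

Lemma vars_in_set0 p : vars_in set0 p -> p = (p@_mone)%:K.
Proof.
move=> D0; rewrite pconst.unlock; apply/malgP => mu; rewrite mcoeffC; case: eqVneq => [->|n1] //.
rewrite mulr0n; apply: mcoeff_outdom; apply: contra_neqN n1 => /D0 h.
apply/eqP/cmP => i; rewrite cm1; apply/eqP; rewrite cmE_eq0; apply/negP.
exact: h.
Qed.

Section OverSubring.
Variable F : set R.
Hypotheses (F0 : F 0) (F1 : F 1) (FD : forall a b, F a -> F b -> F (a + b))
  (FM : forall a b, F a -> F b -> F (a * b)).

Lemma coefs_inC c : F c -> coefs_in F c%:K.
Proof. by move=> Fc mu; rewrite pconst.unlock mcoeffC; case: eqP. Qed.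

Lemma coefs_inX i : coefs_in F 'V_i.
Proof. by move=> mu; rewrite pvar.unlock mcoeffU; case: eqP. Qed.

Lemma coefs_inD p q : coefs_in F p -> coefs_in F q -> coefs_in F (p + q).
Proof. by move=> Fp Fq mu; rewrite mcoeffD; apply: FD. Qed.

Lemma coefs_inM p q : coefs_in F p -> coefs_in F q -> coefs_in F (p * q).
Proof.
move=> Fp Fq mu; rewrite mcoeffMl; apply: (big_ind F) => // k1 _.
by apply: (big_ind F) => // k2 _; case: eqP => _ //; rewrite mulr1n; apply: FM.
Qed.

End OverSubring.

(** Both convolutions are expanded over the unions of the supports, so that they run over the same
    pairs of monomials and can be compared term by term. *)
Lemma mcoeffM_rel (rel : R -> R -> Prop) (p p' q q' : P) : rel 0 0 ->
  (forall a a' b b', rel a a' -> rel b b' -> rel (a + b) (a' + b')) ->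
  (forall a a' b b', rel a a' -> rel b b' -> rel (a * b) (a' * b')) ->
  (forall mu, rel p@_mu p'@_mu) -> (forall mu, rel q@_mu q'@_mu) ->
  forall mu, rel (p * q)@_mu (p' * q')@_mu.
Proof.
move=> r0 rD rM hp hq mu.
have e := mcoeffMlw mu (fsubsetUl (msupp p) (msupp p'))
  (fsubsetUl (msupp q) (msupp q')).
have e' := mcoeffMlw mu (fsubsetUr (msupp p) (msupp p'))
  (fsubsetUr (msupp q) (msupp q')).
rewrite [X in rel X _](e : (p * q)@_mu = _) [X in rel _ X](e' : (p' * q')@_mu = _).
apply: (big_ind2 rel); [exact: r0|exact: rD|move=> k1 _].
apply: (big_ind2 rel); [exact: r0|exact: rD|move=> k2 _].
by case: eqP => _; [rewrite !mulr1n; apply: rM|rewrite !mulr0n].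
Qed.

End PolyInduction.

Section UnivariateView.
Variables (I : choiceType) (R : comNzRingType) (i : I).
Local Notation P := {malg R[{cmonom I}]}.

(** The coefficients stay in the same ring [P] rather than a ring in fewer variables; that they do
    not involve [i] is recorded separately by [vars_in]. *)
Definition uview : P -> {poly P} :=
  peval (polyC \o @pconst I R)
    (fun j => if j == i then 'X else ('V_j)%:P).

HB.instance Definition _ := GRing.RMorphism.on uview.

Lemma uviewC c : uview c%:K = (c%:K)%:P.
Proof. by rewrite /uview pevalC. Qed.

Lemma uviewX j : uview 'V_j = if j == i then 'X else ('V_j)%:P.
Proof. by rewrite /uview pevalX. Qed.

Lemma uviewD p q : uview (p + q) = uview p + uview q.
Proof. exact: rmorphD. Qed.

Lemma uviewM p q : uview (p * q) = uview p * uview q.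
Proof. exact: rmorphM. Qed.

Lemma uview0 : uview 0 = 0.
Proof. exact: rmorph0. Qed.

Lemma uview1 : uview 1 = 1.
Proof. exact: rmorph1. Qed.

Lemma uview_horner p : (uview p).['V_i] = p.
Proof.
move: p; apply: ipoly_ind => [c|j|p q hp hq|p q hp hq].
- by rewrite uviewC hornerC.
- by rewrite uviewX; case: eqP => [->|_]; rewrite ?hornerX ?hornerC.
- by rewrite uviewD hornerD {}hp {}hq.
- by rewrite uviewM hornerM {}hp {}hq.
Qed.

Lemma uview_eq0 p : (uview p == 0) = (p == 0).
Proof.
apply/eqP/eqP => [e|->]; last by rewrite uview0.
by rewrite -(uview_horner p) e horner0.
Qed.

Lemma uview_novar p : vars_in [set j | j != i] p -> uview p = p%:P.
Proof.
have: coefs_in setT p by []; move: p; apply: ipoly_ind_over.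
- by rewrite uview0.
- by rewrite uview1.
- by move=> c _; rewrite uviewC.
- by move=> j /=; rewrite uviewX => /negbTE ->.
- by move=> p1 q1 e1 e2; rewrite uviewD {}e1 {}e2 polyCD.
- by move=> p1 q1 e1 e2; rewrite uviewM {}e1 {}e2 polyCM.
Qed.

Lemma uview_horner_novar (p : {poly P}) :
  (forall k, vars_in [set j | j != i] p`_k) -> uview p.['V_i] = p.
Proof.
move=> h; rewrite -[RHS]coefK poly_def horner_coef rmorph_sum /=.
apply: eq_bigr => k _; rewrite rmorphM rmorphXn /= uviewX eqxx.
by rewrite uview_novar // mul_polyC.
Qed.

Lemma uview_coef (F : set R) (D : set I) p :
  F 0 -> F 1 -> (forall a b, F a -> F b -> F (a + b)) ->
  (forall a b, F a -> F b -> F (a * b)) ->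
  coefs_in F p -> vars_in (D `|` [set i]) p ->
  forall k, coefs_in F (uview p)`_k /\ vars_in D (uview p)`_k.
Proof.
move=> F0 F1 FD FM Fp Dp.
have h0 : coefs_in F (0 : P) /\ vars_in D (0 : P).
  by split=> [mu|]; [rewrite mcoeff0|apply: vars_in0].
have hC c : F c -> coefs_in F (c%:K : P) /\ vars_in D (c%:K : P).
  by move=> Fc; split; [apply: coefs_inC|apply: vars_inC].
move: p Fp Dp; apply: ipoly_ind_over.
- by move=> k; rewrite uview0 coef0.
- move=> k; rewrite uview1 coef1; case: eqP => _ //.
  by rewrite -pconst1; apply: hC.
- by move=> c Fc k; rewrite uviewC coefC; case: eqP => // _; apply: hC.
- move=> j Dj k; rewrite uviewX; case: eqVneq Dj => [-> _|ji Dj].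
    by rewrite coefX; case: eqP => _ //; rewrite -pconst1; apply: hC.
  rewrite coefC; case: eqP => // _; split; first exact: coefs_inX.
  by apply: vars_inX; case: Dj => // e; rewrite e eqxx in ji.
- move=> p1 q1 h1 h2 k; rewrite uviewD coefD.
  by case: (h1 k) (h2 k) => [? ?] [? ?]; split; [apply: coefs_inD|apply: vars_inD].
- move=> p1 q1 h1 h2 k; rewrite uviewM coefM.
  apply: (big_ind (fun p => coefs_in F p /\ vars_in D p)); first exact: h0.
    move=> a b [? ?] [? ?]; split; [exact: coefs_inD|exact: vars_inD].
  move=> j _; case: (h1 j) (h2 (k - j)%N) => [? ?] [? ?].
  by split; [apply: coefs_inM|apply: vars_inM].
Qed.

End UnivariateView.

(** * Subfields and algebraic closure *)

Section SubfieldClosure.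
Variables (m : nat) (U : diffField m).
Implicit Types F S T : set U.

Lemma subfieldP F : is_subfield F <-> [/\ F 1,
  forall x y, F x -> F y -> F (x - y) & forall x y, F x -> F y -> F (x / y)].
Proof.
have e x : (x \in mem F) = `[< F x >] by [].
split=> [[h1 hB hM]|[h1 hB hM]]; split.
- by move: h1; rewrite e => /asboolP.
- move=> x y Fx Fy; apply/asboolP; rewrite -e.
  by apply: hB; rewrite e; apply/asboolP.
- move=> x y Fx Fy; apply/asboolP; rewrite -e.
  by apply: hM; rewrite e; apply/asboolP.
- by rewrite e; apply/asboolP.
- by move=> x y; rewrite !e => /asboolP Fx /asboolP Fy; apply/asboolP; apply: hB.
- by move=> x y; rewrite !e => /asboolP Fx /asboolP Fy; apply/asboolP; apply: hM.
Qed.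

Section Closed.
Variable F : set U.
Hypothesis FP : is_subfield F.

Lemma subfield1 : F 1.
Proof. by case/subfieldP: FP. Qed.

Lemma subfieldB x y : F x -> F y -> F (x - y).
Proof. by case/subfieldP: FP => _ h _; apply: h. Qed.

Lemma subfield_div x y : F x -> F y -> F (x / y).
Proof. by case/subfieldP: FP => _ _ h; apply: h. Qed.

Lemma subfield0 : F 0.
Proof. by rewrite -(subrr 1); apply: subfieldB; apply: subfield1. Qed.

Lemma subfieldN x : F x -> F (- x).
Proof. by move=> Fx; rewrite -sub0r; apply: subfieldB => //; apply: subfield0. Qed.

Lemma subfieldD x y : F x -> F y -> F (x + y).
Proof. by move=> Fx Fy; rewrite -(opprK y); apply: subfieldB => //; apply: subfieldN. Qed.

Lemma subfieldV x : F x -> F x^-1.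
Proof. by move=> Fx; rewrite -(mul1r x^-1); apply: subfield_div => //; apply: subfield1. Qed.

Lemma subfieldM x y : F x -> F y -> F (x * y).
Proof. by move=> Fx Fy; rewrite -(invrK y); apply: subfield_div => //; apply: subfieldV. Qed.

Lemma subfieldX x k : F x -> F (x ^+ k).
Proof.
move=> Fx; elim: k => [|k IH]; first exact: subfield1.
by rewrite exprS; apply: subfieldM.
Qed.

Lemma subfield_sum (I : Type) (s : seq I) (P : pred I) (g : I -> U) :
  (forall i, P i -> F (g i)) -> F (\sum_(i <- s | P i) g i).
Proof.
move=> h; apply: (big_ind F) => //; [exact: subfield0|exact: subfieldD].
Qed.

Lemma subfield_nat k : F k%:R.
Proof.
by elim: k => [|k IH]; [exact: subfield0|rewrite -addn1 natrD; apply: subfieldD => //; exact: subfield1].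
Qed.

Lemma subfield_horner (p : {poly U}) x : (forall i, F p`_i) -> F x -> F p.[x].
Proof.
move=> Fp Fx; rewrite horner_coef; apply: subfield_sum => i _.
by apply: subfieldM; [apply: Fp|apply: subfieldX].
Qed.

Lemma subfield_ieval (I : choiceType) (x : I -> U) (p : ipoly U I) :
  ipoly_over F p -> (forall i, F (x i)) -> F (ieval x p).
Proof.
move=> Fp Fx; rewrite ievalE; have: vars_in setT p by [].
move: p Fp; apply: ipoly_ind_over.
- by rewrite rmorph0; apply: subfield0.
- by rewrite rmorph1; apply: subfield1.
- by move=> c Fc; rewrite pevalC.
- by move=> i _; rewrite pevalX.
- by move=> p q hp hq; rewrite rmorphD; apply: subfieldD.
- by move=> p q hp hq; rewrite rmorphM; apply: subfieldM.
Qed.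

End Closed.

(** On the union of [F] and [S] this is [adjoin F S] by conversion. A single generating set lets the
    base field and the adjoined elements be treated alike. *)
Definition fld S := smallest (@is_subfield m U) S.

Lemma fldP S : is_subfield (fld S).
Proof.
apply/subfieldP; split.
- by move=> A [AP _]; apply: subfield1.
- by move=> x y hx hy A AP; case: (AP) => A1 _; apply: subfieldB; [|apply: hx|apply: hy].
- by move=> x y hx hy A AP; case: (AP) => A1 _; apply: subfield_div; [|apply: hx|apply: hy].
Qed.

Lemma sub_fld S : S `<=` fld S.
Proof. exact: sub_gen_smallest. Qed.

Lemma fld_min S F : is_subfield F -> S `<=` F -> fld S `<=` F.
Proof. by move=> FP SF x; apply. Qed.

Lemma fld_sub S T : S `<=` fld T -> fld S `<=` fld T.
Proof. by move=> h; apply: fld_min => //; apply: fldP. Qed.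

Lemma fld_mono S T : S `<=` T -> fld S `<=` fld T.
Proof. by move=> h; apply: fld_sub => x /h; apply: sub_fld. Qed.

End SubfieldClosure.

Section SubfieldType.
Variables (m : nat) (U : diffField m) (F : set U).
Hypothesis FP : is_subfield F.

(** The proof is a phantom argument: it lets the closure properties be attached to the predicate, so
    that [F] becomes a field type and the theory of algebraic and integral elements applies. *)
Definition subfield_pred of is_subfield F : {pred U} := fun x => `[< F x >].

Lemma subfield_pred_closed : divring_closed (subfield_pred FP).
Proof.
split.
- by apply/asboolP; apply: subfield1.
- by move=> x y /asboolP Fx /asboolP Fy; apply/asboolP; apply: subfieldB.
- by move=> x y /asboolP Fx /asboolP Fy; apply/asboolP; apply: subfield_div.
Qed.

HB.instance Definition _ :=
  GRing.isDivringClosed.Build U (subfield_pred FP) subfield_pred_closed.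

Record subfield_type := SubfieldType {
  subfield_val : U;
  subfield_valP : subfield_val \in subfield_pred FP
}.

HB.instance Definition _ := [isSub for subfield_val].
HB.instance Definition _ := [Choice of subfield_type by <:].
HB.instance Definition _ :=
  [SubChoice_isSubIntegralDomain of subfield_type by <:].
HB.instance Definition _ :=
  [SubIntegralDomain_isSubField of subfield_type by <:].

Lemma subfield_valF (x : subfield_type) : F (subfield_val x).
Proof. by apply/asboolP; case: x. Qed.

Definition subfield_in (x : U) (Fx : F x) : subfield_type :=
  SubfieldType (asboolT Fx : x \in subfield_pred FP).

End SubfieldType.

Section Algebraic.
Variables (m : nat) (U : diffField m).
Implicit Types F S T B : set U.

Lemma algebraic_overE F (FP : is_subfield F) x :
  algebraic_over F x <->
  algebraicOver (val : subfield_type FP -> U) x.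
Proof.
split=> [[p [p0 Fp px]]|[q q0 qx]]; last first.
  exists (map_poly val q); split=> //; first by rewrite map_poly_eq0.
  by move=> i; rewrite coef_map; apply: subfield_valF.
pose q := \poly_(i < size p) subfield_in FP (Fp i).
have e : map_poly val q = p.
  apply/polyP => i; rewrite coef_map coef_poly; case: ltnP => //= h.
  by rewrite nth_default.
by exists q; rewrite ?e // -(map_poly_eq0 (val : {rmorphism subfield_type FP -> U})) e.
Qed.

Lemma algebraic_subfield F : is_subfield F -> is_subfield (algebraic_over F).
Proof.
move=> FP; apply/subfieldP; split.
- by apply/(algebraic_overE FP); apply: algebraic1.
- move=> x y /(algebraic_overE FP) hx /(algebraic_overE FP) hy.
  by apply/(algebraic_overE FP); apply: algebraic_sub.
- move=> x y /(algebraic_overE FP) hx /(algebraic_overE FP) hy.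
  by apply/(algebraic_overE FP); apply: algebraic_div.
Qed.

Lemma algebraic_over_trans F x : is_subfield F ->
  algebraic_over (algebraic_over F) x -> algebraic_over F x.
Proof.
move=> FP [p [p0 Fp px]]; apply/(algebraic_overE FP)/integral_algebraic.
apply: (integral_root p0 px) => y /(nthP 0) [i _ <-].
by apply/integral_algebraic/(algebraic_overE FP).
Qed.

Lemma algebraic_over_sub F T x : F `<=` T -> algebraic_over F x ->
  algebraic_over T x.
Proof. by move=> FT [p [p0 Fp px]]; exists p; split=> // i; apply: FT. Qed.

Lemma algebraic_over_id F x : is_subfield F -> F x -> algebraic_over F x.
Proof.
move=> FP Fx; exists ('X - x%:P); split; first by rewrite polyXsubC_eq0.
  move=> i; rewrite coefB coefX coefC; apply: subfieldB => //.
    by case: (_ == _); [apply: subfield1|apply: subfield0].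
  by case: (_ == _) => //; apply: subfield0.
by rewrite root_XsubC.
Qed.

Definition cl S : set U := algebraic_over (fld S).

Lemma cl_subfield S : is_subfield (cl S).
Proof. exact/algebraic_subfield/fldP. Qed.

Lemma fld_cl S : fld S `<=` cl S.
Proof. by move=> x Sx; apply: algebraic_over_id => //; apply: fldP. Qed.

Lemma sub_cl S : S `<=` cl S.
Proof. by move=> x /sub_fld; apply: fld_cl. Qed.

Lemma cl_sub S T : S `<=` cl T -> cl S `<=` cl T.
Proof.
move=> ST x /(algebraic_over_sub (fld_min (cl_subfield T) ST)).
exact/algebraic_over_trans/fldP.
Qed.

Lemma cl_mono S T : S `<=` T -> cl S `<=` cl T.
Proof. by move=> ST; apply: cl_sub => x /ST; apply: sub_cl. Qed.

Lemma fld_cl_sub S T : S `<=` cl T -> fld S `<=` cl T.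
Proof. by move=> ST; apply: fld_min ST; apply: cl_subfield. Qed.

Definition is_subring B : Prop := [/\ B 1,
  forall x y, B x -> B y -> B (x - y) & forall x y, B x -> B y -> B (x * y)].

Definition fractions B : set U :=
  [set z | exists q, [/\ B q, q != 0 & B (q * z)]].

Section Fractions.
Variable B : set U.
Hypothesis BP : is_subring B.

Lemma fractions_subfield : is_subfield (fractions B).
Proof.
case: BP => B1 BB BM; apply/subfieldP; split.
- by exists 1; rewrite mulr1 oner_neq0.
- move=> x y [q [Bq q0 Bqx]] [r [Br r0 Bry]]; exists (q * r); split.
  + exact: BM.
  + by rewrite mulf_neq0.
  + have -> : q * r * (x - y) = r * (q * x) - q * (r * y).
      by rewrite mulrBr; congr (_ - _); rewrite !mulrA // (mulrC q).
    by apply: BB; apply: BM.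
- move=> x y [q [Bq q0 Bqx]] [r [Br r0 Bry]].
  case: (eqVneq y 0) => [->|y0].
    exists 1; rewrite invr0 !mulr0; split=> //; first exact: oner_neq0.
    by rewrite -(subrr 1); apply: BB.
  exists (q * (r * y)); split.
  + exact: BM.
  + by rewrite !mulf_neq0.
  + have -> : q * (r * y) * (x / y) = r * (q * x).
      rewrite -mulrA -(mulrA r) (mulrCA y) mulfV // mulr1.
      by rewrite mulrCA.
    exact: BM.
Qed.

Lemma sub_fractions : B `<=` fractions B.
Proof.
by case: BP => B1 _ _ x Bx; exists 1; rewrite mul1r oner_neq0.
Qed.

Lemma common_denominator (g : nat -> U) k : (forall i, fractions B (g i)) ->
  exists c, [/\ B c, c != 0 & forall i, (i < k)%N -> B (c * g i)].
Proof.
case: BP => B1 BB BM h; elim: k => [|k [c [Bc c0 IH]]].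
  by exists 1; rewrite oner_neq0.
have [q [Bq q0 Bqg]] := h k; exists (q * c); split; first exact: BM.
  by rewrite mulf_neq0.
move=> i; rewrite ltnS leq_eqVlt => /orP[/eqP ->|ik].
  by rewrite (mulrC q) -mulrA; apply: BM.
by rewrite -mulrA; apply: BM => //; apply: IH.
Qed.

Lemma common_denominator_poly (p : {poly U}) :
  (forall i, fractions B p`_i) ->
  exists c, [/\ B c, c != 0 & forall i, B (c * p`_i)].
Proof.
move=> h; have [c [Bc c0 hc]] := common_denominator (size p) h.
exists c; split=> // i; case: (ltnP i (size p)) => [|hi]; first exact: hc.
by rewrite nth_default // mulr0 -(subrr 1); case: BP => B1 BB _; apply: BB.
Qed.

End Fractions.

(** Clearing denominators turns the equation of [y] into a relation polynomial in both [x] and [y].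
    Read as an equation for [x] it is nontrivial: otherwise its coefficients, polynomials over
    [fld S] of which one is nonzero, would all vanish at [y]. *)
Lemma exchange S x y : cl (S `|` [set x]) y -> ~ cl S y ->
  cl (S `|` [set y]) x.
Proof.
move=> [p [p0 Fp py]] ny.
pose B := [set z | exists2 q : {poly U}, (forall i, fld S q`_i) & z = q.[x]].
have SF := fldP S.
have BP : is_subring B.
  split.
  - exists 1; last by rewrite hornerC.
    by move=> i; rewrite coef1; case: (_ == _); [apply: (subfield1 SF)|apply: (subfield0 SF)].
  - move=> _ _ [q Fq ->] [r Fr ->]; exists (q - r); last by rewrite hornerD hornerN.
    by move=> i; rewrite coefB; apply: (subfieldB SF).
  - move=> _ _ [q Fq ->] [r Fr ->]; exists (q * r); last by rewrite hornerM.
    by move=> i; rewrite coefM; apply: (subfield_sum SF) => // j _; apply: (subfieldM SF).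
have sub : fld (S `|` [set x]) `<=` fractions B.
  apply: fld_min; first exact: fractions_subfield.
  move=> z [Sz|->]; apply: sub_fractions => //.
    exists z%:P; last by rewrite hornerC.
    by move=> i; rewrite coefC; case: (_ == _); [apply: sub_fld|apply: (subfield0 SF)].
  exists 'X; last by rewrite hornerX.
  by move=> i; rewrite coefX; case: (_ == _); [apply: (subfield1 SF)|apply: (subfield0 SF)].
have [c [Bc c0 cp]] := common_denominator_poly BP (fun i => sub _ (Fp i)).
have /choice [q qP] : forall i, exists q : {poly U},
    (forall j, fld S q`_j) /\ c * p`_i = q.[x].
  by move=> i; case: (cp i) => q ? ?; exists q.
pose Q : {poly U} := \sum_(k < size p) y ^+ k *: q k.
have Qx : Q.[x] = 0.
  transitivity (c * p.[y]); last by rewrite (rootP py) mulr0.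
  rewrite horner_sum horner_coef mulr_sumr.
  apply: eq_bigr => k _; rewrite hornerZ -(qP k).2.
  by rewrite mulrC mulrA.
have Qc j : Q`_j = (\poly_(k < size p) (q k)`_j).[y].
  rewrite coef_sum horner_poly; apply: eq_bigr => k _.
  by rewrite coefZ mulrC.
exists Q; split; last by apply/rootP.
  apply/negP => /eqP Q0; have [k k_lt pk] : exists2 k, (k < size p)%N & p`_k != 0.
    by exists (size p).-1; rewrite ?prednK ?size_poly_gt0 // -lead_coefE lead_coef_eq0.
  have qk : q k != 0.
    apply: contraNneq pk => qk0; have /eqP := (qP k).2.
    by rewrite qk0 horner0 mulf_eq0 (negbTE c0).
  have [j qkj] : exists j, (q k)`_j != 0.
    by exists (size (q k)).-1; rewrite -lead_coefE lead_coef_eq0.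
  apply: ny; exists (\poly_(k < size p) (q k)`_j); split.
  - apply: contraNneq qkj => /(congr1 (fun r : {poly U} => r`_k)).
    by rewrite coef_poly k_lt coef0 => ->.
  - move=> i; rewrite coef_poly; case: ifP => _; last exact: (subfield0 SF).
    exact: (qP i).1.
  - by apply/rootP; rewrite -Qc Q0 coef0.
move=> j; rewrite Qc; apply: (subfield_horner (fldP _)).
  move=> i; rewrite coef_poly; case: ifP => _; last exact: (subfield0 (fldP _)).
  by apply: fld_mono (@subsetUl _ _ _) _ _; apply: (qP i).1.
by apply: sub_fld; right.
Qed.

(** An algebraic equation has finitely many coefficients, each a rational expression in finitely
    many elements of [S]. *)
Lemma cl_finite S x : cl S x -> exists2 s : seq U,
  [set` s] `<=` S & cl [set` s] x.
Proof.
have fin : fld S `<=` [set z | exists2 s : seq U, [set` s] `<=` S & fld [set` s] z].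
  apply: fld_min; last first.
    move=> z Sz; exists [:: z]; first by move=> w /=; rewrite inE => /eqP ->.
    by apply: sub_fld; rewrite /= inE.
  apply/subfieldP; split.
  - by exists [::] => //; apply: (subfield1 (fldP _)).
  - move=> y z [s sS sy] [t tS tz]; exists (s ++ t).
      by move=> w /=; rewrite mem_cat => /orP[/sS|/tS].
    apply: (subfieldB (fldP _)).
      by apply: fld_mono sy => w /= h; rewrite mem_cat h.
    by apply: fld_mono tz => w /= h; rewrite mem_cat h orbT.
  - move=> y z [s sS sy] [t tS tz]; exists (s ++ t).
      by move=> w /=; rewrite mem_cat => /orP[/sS|/tS].
    apply: (subfield_div (fldP _)).
      by apply: fld_mono sy => w /= h; rewrite mem_cat h.
    by apply: fld_mono tz => w /= h; rewrite mem_cat h orbT.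
move=> [p [p0 Fp px]].
have /choice [g gP] : forall i, exists s : seq U, [set` s] `<=` S /\ fld [set` s] p`_i.
  by move=> i; case: (fin _ (Fp i)) => s; exists s.
exists (flatten [seq g i | i <- iota 0 (size p)]).
  by move=> w /= /flatten_mapP [i _ /(gP i).1].
exists p; split=> // i; case: (ltnP i (size p)) => hi; last first.
  by rewrite nth_default //; apply: (subfield0 (fldP _)).
apply: fld_mono (gP i).2 => w /= wi; apply/flatten_mapP; exists i => //.
by rewrite mem_iota.
Qed.

Lemma der0 i : der i (0 : U) = 0.
Proof. by apply: (addIr (der i 0)); rewrite -derD !add0r. Qed.

Lemma derN i (x : U) : der i (- x) = - der i x.
Proof. by apply: (addIr (der i x)); rewrite -derD !addNr der0. Qed.

Lemma derB i (x y : U) : der i (x - y) = der i x - der i y.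
Proof. by rewrite derD derN. Qed.

Lemma der1 i : der i (1 : U) = 0.
Proof.
by have := derM i (1 : U) 1; rewrite !mulr1 !mul1r => /eqP; rewrite addrC -subr_eq subrr eq_sym => /eqP.
Qed.

Lemma derV i (x : U) : der i x^-1 = - der i x / x ^+ 2.
Proof.
case: (eqVneq x 0) => [->|x0]; first by rewrite invr0 der0 oppr0 mul0r.
apply: (mulfI x0).
have := derM i x x^-1; rewrite mulfV // der1 => /eqP.
rewrite eq_sym addrC addr_eq0 => /eqP ->.
by rewrite expr2 invfM mulrCA !mulrA mulfK // mulNr.
Qed.

(** By the product and quotient rules, the elements of [fld T] whose derivative is again in [fld T]
    form a subfield. Two sets are needed because a derivation raises the order of jets. *)
Lemma fld_der i S T : S `<=` fld T -> der i @` S `<=` fld T ->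
  forall x, fld S x -> fld T (der i x).
Proof.
move=> ST dST; have TF := fldP T.
suff : fld S `<=` [set x | fld T x /\ fld T (der i x)].
  by move=> h x /h [].
apply: fld_min => [|x Sx]; last by split; [apply: ST|apply: dST; exists x].
apply/subfieldP; split.
- by rewrite /= der1; split; [apply: (subfield1 TF)|apply: (subfield0 TF)].
- by move=> x y [? ?] [? ?]; split; rewrite ?derB; apply: (subfieldB TF).
- move=> x y [? ?] [? ?]; split; rewrite ?derM; first exact: (subfield_div TF).
  rewrite derV; apply: (subfieldD TF) => //; first exact: (subfield_div TF).
  apply: (subfieldM TF) => //; apply: (subfield_div TF) => //; first exact: (subfieldN TF).
  exact: (subfieldX TF).
Qed.

Lemma natr_neq0 k : (k.+1%:R : U) != 0.
Proof.
by have /pcharf0P -> := @diffField_char0 _ U.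
Qed.

(** The difference is the value at [x] of [p] with differentiated coefficients. At a simple root of
    [p] this can be solved for [der i x]. *)
Lemma der_horner_closed i G (p : {poly U}) x : is_subfield G -> G x ->
  (forall k, G (der i p`_k)) -> G (der i p.[x] - p^`().[x] * der i x).
Proof.
move=> GF Gx; elim/poly_ind: p => [|q c IH] h.
  by rewrite deriv0 !horner0 der0 mul0r subr0; apply: subfield0.
have Gc : G (der i c) by have := h 0%N; rewrite coefD coefMX coefC add0r.
have /IH Gq : forall k, G (der i q`_k).
  by move=> k; have := h k.+1; rewrite coefD coefMX coefC addr0.
rewrite derivD derivM derivX derivC addr0 mulr1 !hornerE derD derM.
set a := der i q.[x] in Gq *; set b := q^`().[x] in Gq *.
have -> : a * x + q.[x] * der i x + der i c - (b * x + q.[x]) * der i x =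
  (a - b * der i x) * x + der i c by ring.
by apply: subfieldD => //; apply: subfieldM.
Qed.

(* Differentiate a polynomial relation of least degree *)
Lemma cl_der i S T : S `<=` cl T -> der i @` S `<=` cl T ->
  forall x, cl S x -> cl T (der i x).
Proof.
move=> ST dST x Sx.
have [p [[p0 Fp px] pmin]] : exists p : {poly U},
    [/\ p != 0, forall i, fld S p`_i & root p x] /\
    forall q : {poly U}, [/\ q != 0, forall i, fld S q`_i & root q x] ->
      (size p <= size q)%N.
  have [p0 hp0] := Sx.
  pose A k := `[< exists p : {poly U}, [/\ p != 0, forall i, fld S p`_i & root p x]
     /\ size p = k >].
  have exA : exists k, A k by exists (size p0); apply/asboolP; exists p0.
  have [k /asboolP[p [hp pk]] kmin] := ex_minnP exA.
  exists p; split=> // q hq; rewrite pk; apply: kmin; apply/asboolP; by exists q.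
have dT : forall z, fld S z -> cl T (der i z).
  have TF := cl_subfield T.
  have h : fld (cl T) `<=` cl T by apply: fld_min.
  move=> z Sz; apply: h; apply: fld_der Sz => w Sw; apply: sub_fld.
    exact: ST.
  exact: dST.
(* Characteristic 0 enters here: the leading coefficient gets multiplied by a nonzero integer. *)
have p'0 : p^`() != 0.
  apply/negP => /eqP e; have sp1 : (1 < size p)%N.
    rewrite ltnNge; apply/negP => sp; move: p0 px.
    by rewrite (size1_polyC sp) polyC_eq0 /root hornerC => /negbTE ->.
  have /(congr1 (fun q : {poly U} => q`_(size p).-2)) := e.
  rewrite coef_deriv coef0 prednK -?subn1 ?subn_gt0 // subn1.
  move=> /eqP; rewrite -mulr_natr mulf_eq0 -lead_coefE lead_coef_eq0 (negbTE p0) /=.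
  by case: (size p) sp1 => // -[] // k _ /=; rewrite (negbTE (natr_neq0 k)).
(* The derivative has smaller degree, so the minimality of [p] forbids it to vanish at [x]. *)
have p'x : p^`().[x] != 0.
  apply/negP => p'x; have : (size p <= size p^`())%N.
    apply: pmin; split=> // j; rewrite coef_deriv -mulr_natr.
    by apply: (subfieldM (fldP _)); [apply: Fp|apply: (subfield_nat (fldP _))].
  by rewrite leqNgt lt_size_deriv.
have TF := cl_subfield T.
have xT : cl T x by apply: cl_sub ST _ Sx.
have := der_horner_closed TF xT (fun k => dT _ (Fp k)).
rewrite (rootP px) der0 sub0r => /(subfieldN TF); rewrite opprK => h.
rewrite -(mulKf p'x (der i x)); apply: (subfieldM TF) => //; apply: (subfieldV TF) => //.
apply: (subfield_horner TF) => // k; rewrite coef_deriv -mulr_natr.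
apply: (subfieldM TF) => //; last exact: (subfield_nat TF).
by apply: fld_cl_sub ST _ (Fp _).
Qed.

End Algebraic.

(** * The pregeometry of algebraic dependence *)

Section Pregeometry.
Variables (m : nat) (U : diffField m).
Implicit Types (F S T Y : set U) (s t : seq U).

Fixpoint indep F s : Prop :=
  if s is x :: s' then ~ cl (F `|` [set` s']) x /\ indep F s' else True.

Definition findep (I : choiceType) F (x : I -> U) : Prop :=
  forall i, ~ cl (F `|` x @` [set j | j != i]) (x i).

Lemma indep_sub F T s : T `<=` cl F -> indep F s -> indep T s.
Proof.
move=> TF; elim: s => //= x s IH [hx /IH hs]; split=> // h; apply: hx.
apply: cl_sub h => z [/TF|zs]; last by apply: sub_cl; right.
by apply: cl_mono; apply: subsetUl.
Qed.

(** Exchange makes the one-sided condition of [indep], which only looks at later elements,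
    symmetric; invariance under permutation follows. *)
Lemma indepP F s : indep F s <->
  uniq s /\ forall x, x \in s -> ~ cl (F `|` [set y | y \in s /\ y != x]) x.
Proof.
split=> [|[us h]]; last first.
  elim: s us h => //= x s IH /andP[xs us] h; split.
    move=> hx; apply: (h x); first by rewrite mem_head.
    apply: cl_mono hx => y [|ys]; [by left|right; split; rewrite ?inE ?ys ?orbT //].
    by apply: contraNneq xs => <-.
  apply: IH => // y ys hy; apply: (h y); first by rewrite inE ys orbT.
  by apply: cl_mono hy => z [|[zs zy]]; [left|right; split=> //; rewrite inE zs orbT].
elim: s => //= x s IH [hx /IH [us h]]; split.
  rewrite us andbT; apply/negP => xs; apply: hx; apply: sub_cl; by right.
move=> y; rewrite inE => /orP[/eqP -> hy|ys].
  apply: hx; apply: cl_mono hy => z [|[]]; [by left|].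
  by rewrite inE => /orP[/eqP ->|zs _]; [rewrite eqxx|right].
case: (eqVneq y x) => [yx|yx].
  by case: hx; apply: sub_cl; right; rewrite /= -yx.
move=> hy; apply: hx.
have /exchange : cl ((F `|` [set z | z \in s /\ z != y]) `|` [set x]) y.
  apply: cl_mono hy => z [|[]]; [by left; left|].
  rewrite inE => /orP[/eqP -> _|zs zy]; [by right|by left; right].
move=> /(_ (h y ys)); apply: cl_mono => z [[|[]]|->]; [by left|by right|by right].
Qed.

Lemma perm_indep F s t : perm_eq s t -> indep F s -> indep F t.
Proof.
move=> st /indepP [us h]; apply/indepP; split; first by rewrite -(perm_uniq st).
move=> x xt hx; apply: (h x); first by rewrite (perm_mem st).
by apply: cl_mono hx => y [|[yt yx]]; [left|right; rewrite /= (perm_mem st)].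
Qed.

Lemma indep_subset F s t : uniq t -> {subset t <= s} -> indep F s -> indep F t.
Proof.
move=> ut ts /indepP [us h]; apply/indepP; split=> // x xt hx.
apply: (h x); first exact: ts.
by apply: cl_mono hx => y [|[yt yx]]; [left|right; split=> //; apply: ts].
Qed.

Lemma indep_adjoin F s a : indep F s -> ~ cl (F `|` [set` s]) a ->
  indep (F `|` [set a]) s.
Proof.
move=> hs ha; have : indep F (a :: s) by [].
move=> /(@perm_indep _ _ (rcons s a)); rewrite perm_sym perm_rcons perm_refl.
move=> /(_ isT); elim: s {hs ha} => //= x s IH [hx /IH hs]; split=> //.
move=> h; apply: hx; apply: cl_mono h => z [[|->]|zs]; first by left.
  by right; rewrite /= mem_rcons mem_head.
by right; rewrite /= mem_rcons inE zs orbT.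
Qed.

(** The element to drop is the first one whose tail does not span [a]. Those before it are
    unaffected, since [a] already lies in the closure of what follows them. *)
Lemma indep_drop1 F s a : indep F s -> exists s', [/\ indep (F `|` [set a]) s',
  {subset s' <= s} & (size s <= (size s').+1)%N].
Proof.
elim: s => [|x s IH] /=; first by exists [::].
move=> [hx hs]; have [as_|as_] := pselect (cl (F `|` [set` s]) a); last first.
  exists s; split=> //; first exact: indep_adjoin.
  by move=> y ys; rewrite inE ys orbT.
have [s' [hs' sub sz]] := IH hs; exists (x :: s'); split=> //.
  split=> // h; apply: hx; apply: cl_sub h => z [[Fz|->]|zs'] //.
    by apply: sub_cl; left.
  by apply: sub_cl; right; apply: sub.
by move=> y; rewrite !inE => /orP[->//|/sub ->]; rewrite orbT.
Qed.

(** The elements of [t] move one by one into the base, each at the price of at most one element of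
    [s]. *)
Lemma steinitz F s t : indep F s -> [set` s] `<=` cl (F `|` [set` t]) ->
  (size s <= size t)%N.
Proof.
elim: t F s => [|a t IH] F s hs st.
  case: s hs st => //= x s [hx _] st; case: hx.
  have := st x; rewrite /= mem_head => /(_ isT); apply: cl_mono => z [|//].
  by left.
have [s' [hs' sub sz]] := indep_drop1 a hs.
apply: leq_trans sz _; rewrite ltnS; apply: IH hs' _ => x /sub /st.
apply: cl_mono => z [Fz|]; first by left; left.
by rewrite /= inE => /orP[/eqP ->|zt]; [left; right|right].
Qed.

Section Families.
Variables (I : choiceType) (x : I -> U).

Lemma finite_subfamily F (A : set I) y : cl (F `|` x @` A) y ->
  exists t : seq I, [/\ uniq t, forall i, i \in t -> A i &
    cl (F `|` [set` map x t]) y].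
Proof.
move=> /cl_finite [u uS uy].
suff [t [ut tA us]] : exists t : seq I, [/\ uniq t, forall i, i \in t -> A i &
    [set` u] `<=` F `|` [set` map x t]].
  by exists t; split=> //; apply: cl_mono uy.
elim: u uS {uy} => [|z u IH] uS; first by exists [::].
have [|t [ut tA us]] := IH; first by move=> w wu; apply: uS; rewrite /= inE wu orbT.
have : (F `|` x @` A) z by apply: uS; rewrite /= mem_head.
case=> [Fz|[i Ai xi]].
  by exists t; split=> // w /=; rewrite inE => /orP[/eqP ->|/us //]; left.
have [t' ut' mt'] : exists2 t', uniq t' & t' =i i :: t.
  by exists (undup (i :: t)); [exact: undup_uniq|exact: mem_undup].
exists t'; split=> //; first by move=> j; rewrite mt' inE => /orP[/eqP ->|/tA].
move=> w /=; rewrite inE => /orP[/eqP ->|/us [Fw|/= /mapP[j jt ->]]].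
- by right; apply/mapP; exists i => //; rewrite mt' mem_head.
- by left.
- by right; apply/mapP; exists j => //; rewrite mt' inE jt orbT.
Qed.

Lemma findepP F : findep F x <-> forall t : seq I, uniq t -> indep F (map x t).
Proof.
split=> [h|h i /finite_subfamily [t [ut ti]]]; last first.
  have /h[] : uniq (i :: t).
    by rewrite /= ut andbT; apply/negP => /ti /=; rewrite eqxx.
  by [].
elim=> //= i t IH /andP[it ut]; split; last exact: IH.
move=> hi; apply: (h i); apply: cl_mono hi => z [|/= /mapP[j jt ->]]; first by left.
by right; exists j => //=; apply: contraNneq it => <-.
Qed.

(** A finite subfamily can be listed in decreasing order, so that each member is tested only against
    smaller ones; permutation invariance does the rest. *)
Lemma findep_ordered F (lt : rel I) : transitive lt -> irreflexive lt ->
  (forall i j, i != j -> lt i j || lt j i) ->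
  (forall i, ~ cl (F `|` x @` [set j | lt j i]) (x i)) -> findep F x.
Proof.
move=> ltt lti ltT h; apply/findepP => t ut.
pose le i j := (i == j) || lt j i.
have leT : total le.
  move=> i j; rewrite /le; case: (eqVneq i j) => //= ij.
  by rewrite orbC; apply: ltT.
apply: (@perm_indep _ (map x (sort le t))); first by rewrite perm_map // perm_sort.
have : sorted le (sort le t) by apply: sort_sorted.
have : uniq (sort le t) by rewrite sort_uniq.
have let_ : transitive le.
  move=> j i k; rewrite /le => /orP[/eqP -> //|ji] /orP[/eqP <-|kj].
    by rewrite ji orbT.
  by rewrite (ltt _ _ _ kj ji) orbT.
elim: (sort le t) => //= i s IH /andP[is_ us] ps; split; last first.
  by apply: IH => //; apply: path_sorted ps.
move=> hi; apply: (h i); apply: cl_mono hi => z [|/= /mapP[j js ->]]; first by left.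
right; exists j => //=; have /allP /(_ j js) := order_path_min let_ ps.
by rewrite /le => /orP[/eqP e|//]; rewrite e js in is_.
Qed.

Lemma findep_sub F T : T `<=` cl F -> findep F x -> findep T x.
Proof. by move=> TF /findepP h; apply/findepP => t /h; apply: indep_sub. Qed.

(** This is the symmetry of independence. If an element of [s] became dependent through some [x i],
    exchange would make [x i] dependent on [Y] and the other members of the family; the [x i] are
    removed in this way one at a time. *)
Lemma findep_indep_swap F Y s : findep (F `|` Y) x -> [set` s] `<=` Y ->
  indep F s -> indep (F `|` range x) s.
Proof.
move=> hx; elim: s => //= y s IH sY [hy hs]; split; last first.
  by apply: IH => // z zs; apply: sY; rewrite /= inE zs orbT.
move=> h; have : cl ((F `|` [set` s]) `|` range x) y.
  by apply: cl_mono h => z [[|]|]; [left; left|right|left; right].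
move=> /finite_subfamily [t [ut _]].
elim: t ut => [_|i t IHt /andP[it ut] ht].
  by move=> h'; apply: hy; apply: cl_mono h' => z [|//].
have /exchange : cl (((F `|` [set` s]) `|` [set` map x t]) `|` [set x i]) y.
  apply: cl_mono ht => z [|]; first by left; left.
  by rewrite /= inE => /orP[/eqP ->|zt]; [right|left; right].
move=> /(_ (IHt ut)) h'; apply: (hx i); apply: cl_mono h' => z [[[Fz|zs]|]|->].
- by left; left.
- by left; right; apply: sY; rewrite /= inE zs orbT.
- move=> /= /mapP[j jt ->]; right; exists j => //=.
  by apply: contraNneq it => <-.
- by left; right; apply: sY; rewrite /= mem_head.
Qed.

(** The basis is chosen greedily from the right. The last clause says more than independence: a
    chosen element is independent of everything after it in [t], chosen or not. *)
Lemma ordered_basis F (t : seq I) : exists s : seq I, [/\ subseq s t,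
  indep F (map x s), [set` map x t] `<=` cl (F `|` [set` map x s]) &
  forall i, i \in s -> exists t1 t2 : seq I, t = t1 ++ i :: t2 /\
    ~ cl (F `|` [set` map x t2]) (x i)].
Proof.
elim: t => [|i t [s [st hs ts h]]].
  by exists [::]; split.
have [hi|hi] := pselect (cl (F `|` [set` map x s]) (x i)).
  exists s; split=> //.
  - exact: subseq_trans st (subseq_cons _ _).
  - by move=> z /=; rewrite inE => /orP[/eqP ->|/ts].
  - by move=> j /h [t1 [t2 [-> ?]]]; exists (i :: t1), t2.
exists (i :: s); split=> //=.
- by rewrite eqxx.
- move=> z /=; rewrite inE => /orP[/eqP ->|/ts].
    by apply: sub_cl; right; rewrite /= mem_head.
  by apply: cl_mono => w [|/= ws]; [left|right; rewrite /= inE ws orbT].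
- move=> j; rewrite inE => /orP[/eqP ->|/h [t1 [t2 [-> ?]]]]; last by exists (i :: t1), t2.
  exists [::], t; split=> // hi'; apply: hi; apply: cl_sub hi' => z [Fz|/ts //].
  by apply: sub_cl; left.
Qed.

End Families.

Lemma findep_sum (I J : choiceType) F (x : I -> U) (z : J -> U) :
  findep F z -> findep (F `|` range z) x ->
  findep F (fun v : I + J => match v with inl i => x i | inr j => z j end).
Proof.
move=> hz hx [i|j] h.
  apply: (hx i); apply: cl_mono h => w [Fw|[[i'|j'] /= e <-]].
  - by left; left.
  - by right; exists i' => //=; apply: contraNneq e => ->.
  - by left; right; exists j'.
pose G := F `|` z @` [set k | k != j].
have : indep (G `|` range x) [:: z j].
  apply: (@findep_indep_swap _ _ _ (range z)).
  - apply: findep_sub hx => w hw; apply: sub_cl.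
    by case: hw => [[Fw|[k _ <-]]|rw]; [left|right; exists k|right].
  - by move=> w /=; rewrite inE => /eqP ->; exists j.
  - split=> // h'; apply: (hz j); apply: cl_mono h' => w [|//].
    by [].
case=> h' _; apply: h'; apply: cl_mono h => w [Fw|[[i'|j'] /= e <-]].
- by left; left; left.
- by left; right; exists i'.
- by left; left; right; exists j' => //=; apply: contraNneq e => ->.
Qed.

Lemma findep_sumr (I J : choiceType) F (x : I -> U) (z : J -> U) :
  findep F (fun v : I + J => match v with inl i => x i | inr j => z j end) ->
  findep (F `|` range x) z.
Proof.
move=> h j hj; apply: (h (inr j)); apply: cl_mono hj => w [[Fw|[i _ <-]]|[k kj <-]].
- by left.
- by right; exists (inl i).
- by right; exists (inr k) => //=; apply: contraNneq kj => -[->].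
Qed.

End Pregeometry.

Section AlgebraicIndependence.
Variables (m : nat) (U : diffField m) (I : choiceType).
Implicit Types (F : set U) (x : I -> U) (p q : ipoly U I).

Lemma peval_uview x i p :
  peval idfun x p = (map_poly (peval idfun x) (uview i p)).[x i].
Proof. by rewrite -{1}(uview_horner i p) -(pevalX idfun x i) horner_map. Qed.

(** Induction on the variables: as a polynomial in one variable [i], [p] either has all its
    coefficients vanishing at [x], so that the induction applies to them, or yields an algebraic
    equation for [x i] over the other members. *)
Lemma findep_alg_indep F x : is_subfield F -> findep F x -> alg_indep F x.
Proof.
move=> FF h p Fp; rewrite ievalE; have [D Dp] := vars_in_all p.
have {Dp} : vars_in [set` (D : seq I)] p by [].
elim: (D : seq I) p Fp => {D} [|i D IH] p Fp Dp px.
  have e : p = (p@_mone)%:K.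
    by apply: vars_in_set0; apply: vars_in_sub Dp => i.
  move: px; rewrite e pevalC => /= ->.
  exact: pconst0.
have [iD|iD] := boolP (i \in D).
  by apply: IH => //; apply: vars_in_sub Dp => j /=; rewrite inE => /orP[/eqP ->|].
have cP := @uview_coef I U i F [set` D] p (subfield0 FF) (subfield1 FF)
  (subfieldD FF) (subfieldM FF) Fp.
have {}cP : forall k, coefs_in F (uview i p)`_k /\ vars_in [set` D] (uview i p)`_k.
  apply: cP; apply: vars_in_sub Dp => j /=.
  by rewrite inE => /orP[/eqP ->|]; [right|left].
pose P := map_poly (peval idfun x) (uview i p).
have [P0|P0] := eqVneq P 0.
  apply/eqP; rewrite -(uview_eq0 i); apply/eqP/polyP => k; rewrite coef0.
  apply: IH; [exact: (cP k).1|exact: (cP k).2|].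
  by rewrite -(coef_map (peval idfun x)) /= -/P P0 coef0.
case: (h i); exists P; split=> //; last by apply/rootP; rewrite -peval_uview.
move=> k; rewrite coef_map /=; have [Fk Dk] := cP k.
move: Fk Dk; move: ((uview i p)`_k).
have FP := fldP (F `|` x @` [set j | j != i]); apply: ipoly_ind_over.
- by rewrite rmorph0; apply: (subfield0 FP).
- by rewrite rmorph1; apply: (subfield1 FP).
- by move=> c Fc; rewrite pevalC; apply: sub_fld; left.
- move=> j jD; rewrite pevalX; apply: sub_fld; right; exists j => //=.
  by apply: contraNneq iD => <-.
- by move=> p1 q1 h1 h2; rewrite rmorphD; apply: (subfieldD FP).
- by move=> p1 q1 h1 h2; rewrite rmorphM; apply: (subfieldM FP).
Qed.

(** Clearing denominators turns an equation for [x i] into a polynomial relation among all members.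
    This relation is zero, and [uview] recovers the coefficients of the equation from it because
    they do not involve [i]. *)
Lemma alg_indep_findep F x : is_subfield F -> alg_indep F x -> findep F x.
Proof.
move=> FF h i [p [p0 Fp px]].
pose good q := coefs_in F q /\ vars_in [set j | j != i] q.
pose B := [set z | exists2 q, good q & z = peval idfun x q].
have goodC c : F c -> good c%:K.
  move=> Fc; split; last exact: vars_inC.
  exact: (coefs_inC (subfield0 FF)).
have goodX j : j != i -> good 'V_j.
  move=> ji; split; last exact: vars_inX.
  exact: (coefs_inX (subfield0 FF) (subfield1 FF)).
have goodD q r : good q -> good r -> good (q + r).
  case=> q1 q2 [r1 r2]; split; last exact: vars_inD.
  exact: (coefs_inD (subfieldD FF)).
have goodM q r : good q -> good r -> good (q * r).
  case=> q1 q2 [r1 r2]; split; last exact: vars_inM.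
  exact: (coefs_inM (subfield0 FF) (subfieldD FF) (subfieldM FF)).
have BP : is_subring B.
  split.
  - by exists (1%:K); [exact: goodC (subfield1 FF)|rewrite pevalC].
  - move=> _ _ [q gq ->] [r gr ->]; exists (q + (-1)%:K * r); last first.
      by rewrite rmorphD rmorphM /= pevalC /= mulN1r.
    by apply: goodD => //; apply: goodM => //; apply: goodC (subfieldN FF (subfield1 FF)).
  - by move=> _ _ [q gq ->] [r gr ->]; exists (q * r); [apply: goodM|rewrite rmorphM].
have sub : fld (F `|` x @` [set j | j != i]) `<=` fractions B.
  apply: fld_min; first exact: fractions_subfield.
  move=> z [Fz|[j ji <-]]; apply: sub_fractions => //.
    by exists (z%:K); [apply: goodC|rewrite pevalC].
  by exists ('V_j); [apply: goodX|rewrite pevalX].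
have [c [Bc c0 cp]] := common_denominator_poly BP (fun i => sub _ (Fp i)).
have /choice [q qP] : forall k, exists q, good q /\ c * p`_k = peval idfun x q.
  by move=> k; case: (cp k) => q ? ?; exists q.
pose Q : {poly ipoly U I} := \poly_(k < size p) q k.
have QV : Q.['V_i] = \sum_(k < size p) q k * 'V_i ^+ k by rewrite horner_poly.
have FV k : coefs_in F (('V_i : ipoly U I) ^+ k).
  elim: k => [|k IH]; rewrite ?expr0 -?pconst1.
    exact: (coefs_inC (subfield0 FF) (subfield1 FF)).
  rewrite exprS; apply: (coefs_inM (subfield0 FF) (subfieldD FF) (subfieldM FF)) => //.
  exact: (coefs_inX (subfield0 FF) (subfield1 FF)).
have Q0 : Q.['V_i] = 0.
  apply: h.
    rewrite QV; apply: (big_ind (coefs_in F)).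
    - by move=> mu; rewrite mcoeff0; apply: subfield0.
    - exact: (coefs_inD (subfieldD FF)).
    - move=> k _; apply: (coefs_inM (subfield0 FF) (subfieldD FF) (subfieldM FF)) => //.
      by case: (qP k) => -[].
  rewrite ievalE QV rmorph_sum /=.
  transitivity (c * p.[x i]); last by rewrite (rootP px) mulr0.
  rewrite horner_coef mulr_sumr; apply: eq_bigr => k _.
  by rewrite rmorphM rmorphXn /= pevalX -(qP k).2 mulrA.
have {Q0} Q0 : Q = 0.
  rewrite -(@uview_horner_novar I U i Q) ?Q0 ?uview0 // => k.
  rewrite coef_poly; case: ifP => _; last exact: vars_in0.
  by case: (qP k) => -[].
case/negP: p0; apply/eqP/polyP => k; rewrite coef0.
case: (ltnP k (size p)) => hk; last by rewrite nth_default.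
apply: (mulfI c0); rewrite (qP k).2 mulr0.
have : Q`_k = 0 by rewrite Q0 coef0.
by rewrite coef_poly hk => ->; rewrite rmorph0.
Qed.

Lemma alg_indepP F x : is_subfield F -> alg_indep F x <-> findep F x.
Proof. by move=> FF; split; [apply: alg_indep_findep|apply: findep_alg_indep]. Qed.

End AlgebraicIndependence.

Section TranscendenceDegree.
Variables (m : nat) (U : diffField m) (F : set U).
Hypothesis FF : is_subfield F.

(** Lists replace indexed bases so that Steinitz applies. Spanning the generators is enough because
    [cl] of a set is a field. *)
Lemma trdeg_basis (S : set U) k : is_trdeg F (adjoin F S) k <->
  exists s : seq U, [/\ indep F s, [set` s] `<=` fld (F `|` S),
    S `<=` cl (F `|` [set` s]) & size s = k].
Proof.
split=> [[c [cE /(alg_indepP _ FF)/findepP ci h]]|[s [si sS Ss <-]]].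
  exists [seq c i | i <- enum 'I_k]; split.
  - exact/ci/enum_uniq.
  - by move=> z /= /mapP[i _ ->]; apply: cE.
  - move=> z Sz; have /h : adjoin F S z by apply: sub_fld; right.
    apply: cl_mono => w [|[i _ <-]]; first by left.
    by right; apply/mapP; exists i => //; rewrite mem_enum.
  - by rewrite size_map size_enum_ord.
have us : uniq s by case/indepP: si.
have e : [set` s] = range (fun i : 'I_(size s) => s`_i).
  apply/seteqP; split=> z /=.
    by move=> /(nthP 0) [i hi <-]; exists (Ordinal hi).
  by move=> [i _ <-]; apply: mem_nth.
exists (fun i : 'I_(size s) => s`_i); split.
- by move=> i; apply: sS => /=; apply: mem_nth.
- apply/(alg_indepP _ FF)/findepP => t ut; apply: indep_subset si.
    rewrite map_inj_in_uniq // => i j _ _ /eqP; rewrite nth_uniq // => /eqP.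
    exact: val_inj.
  by move=> z /mapP[i _ ->]; apply: mem_nth.
- rewrite -e => z zE; apply: fld_cl_sub zE => w [Fw|/Ss //].
  by apply: sub_cl; left.
Qed.

End TranscendenceDegree.

(** * Differential polynomials and their fraction field *)

Section DerivativeOperators.
Variables (m : nat) (T : Type) (D : 'I_m -> T -> T).
Hypothesis DC : forall i j x, D i (D j x) = D j (D i x).

Definition dop0 : dop m := [ffun => 0%N].
Definition dop_unit (i : 'I_m) : dop m := [ffun j => (j == i) : nat].
Definition dop_add (th et : dop m) : dop m := [ffun i => (th i + et i)%N].

(** Abstract in the carrier: the same composite acts on fields, on differential polynomials, on
    exponent vectors and on counters, and [dapply_morph] compares these actions. *)
Definition dapply (th : dop m) (x : T) : T :=
  foldr (fun i => iter (th i) (D i)) x (enum 'I_m).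

Lemma dapply_add th et x : dapply th (dapply et x) = dapply (dop_add th et) x.
Proof.
have iterC i j k l y : iter k (D i) (iter l (D j) y) = iter l (D j) (iter k (D i) y).
  have C1 l' y' : D i (iter l' (D j) y') = iter l' (D j) (D i y').
    by elim: l' => //= l' IH; rewrite DC IH.
  by elim: k => //= k ->; rewrite C1.
rewrite /dapply; elim: (enum 'I_m) x => //= i s IH x.
rewrite ffunE iterD; congr (iter _ _ _); rewrite -IH.
move: (foldr _ x s) => y; elim: s {IH} => //= j s ->.
by rewrite iterC.
Qed.

Lemma dapply_unit i x : dapply (dop_unit i) x = D i x.
Proof.
have : i \in enum 'I_m by rewrite mem_enum.
rewrite /dapply; have := enum_uniq 'I_m; elim: (enum 'I_m) => //= j s IH /andP[js us].
rewrite inE ffunE; have [ij _|ij /= is_] := eqVneq i j; last exact: IH.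
have {js} : i \notin s by rewrite ij.
move=> h /=; rewrite -ij; congr (D i _).
elim: s {IH us} h => //= k s IH; rewrite inE negb_or => /andP[ik /IH ->].
by rewrite ffunE eq_sym (negbTE ik).
Qed.

Lemma dapply0 x : dapply dop0 x = x.
Proof. by rewrite /dapply; elim: (enum 'I_m) => //= i s ->; rewrite ffunE. Qed.

Lemma dapply_ind (P : T -> Prop) th x : (forall i y, P y -> P (D i y)) ->
  P x -> P (dapply th x).
Proof.
move=> PD Px; rewrite /dapply; elim: (enum 'I_m) => //= i s IH.
by elim: (th i) => //= k; apply: PD.
Qed.

End DerivativeOperators.

Lemma dapply_morph (m : nat) (T T' : Type) (D : 'I_m -> T -> T)
  (D' : 'I_m -> T' -> T') (f : T -> T') :
  (forall i x, f (D i x) = D' i (f x)) ->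
  forall th x, f (dapply D th x) = dapply D' th (f x).
Proof.
move=> fD th x; rewrite /dapply; elim: (enum 'I_m) => //= i s IH.
by rewrite -IH; elim: (th i) => //= k; rewrite fD => ->.
Qed.

Lemma dappE (m : nat) (U : diffField m) (th : dop m) (x : U) :
  dapp th x = dapply (@der m U) th x.
Proof. by []. Qed.

Lemma der_dapp (m : nat) (U : diffField m) i (th : dop m) (x : U) :
  der i (dapp th x) = dapp (dop_add (dop_unit i) th) x.
Proof.
by rewrite !dappE -dapply_add ?dapply_unit //; apply: derC.
Qed.

Lemma dapp_add (m : nat) (U : diffField m) (th et : dop m) (x : U) :
  dapp th (dapp et x) = dapp (dop_add th et) x.
Proof. by rewrite !dappE dapply_add //; apply: derC. Qed.

Lemma dapp_hom (m : nat) (U E : diffField m) (f : {rmorphism U -> E}) :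
  diff_hom f -> forall th x, f (dapp th x) = dapp th (f x).
Proof. by move=> fh th x; rewrite !dappE; apply: dapply_morph. Qed.

Section DualNumbers.
Variable A : comNzRingType.

(** The ring A + A eps with eps^2 = 0. For a ring morphism into it, the eps-part is automatically a
    derivation along the first component. *)
Record dual := Dual { dual_re : A; dual_eps : A }.

Definition dual_pair x := (dual_re x, dual_eps x).
Definition pair_dual p := Dual p.1 p.2.

Lemma dual_pairK : cancel dual_pair pair_dual.
Proof. by case. Qed.

HB.instance Definition _ := Choice.copy dual (can_type dual_pairK).

Definition dual_zero := Dual 0 0.
Definition dual_add x y :=
  Dual (dual_re x + dual_re y) (dual_eps x + dual_eps y).
Definition dual_opp x := Dual (- dual_re x) (- dual_eps x).
Definition dual_one := Dual 1 0.
Definition dual_mul x y := Dual (dual_re x * dual_re y)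
  (dual_eps x * dual_re y + dual_re x * dual_eps y).

Lemma dual_addA : associative dual_add.
Proof. by move=> x y z; rewrite /dual_add /= !addrA. Qed.
Lemma dual_addC : commutative dual_add.
Proof. by move=> x y; rewrite /dual_add (addrC (dual_re x)) (addrC (dual_eps x)). Qed.
Lemma dual_add0 : left_id dual_zero dual_add.
Proof. by case=> a b; rewrite /dual_add /= !add0r. Qed.
Lemma dual_addN : left_inverse dual_zero dual_opp dual_add.
Proof. by case=> a b; rewrite /dual_add /= !addNr. Qed.

HB.instance Definition _ :=
  GRing.isZmodule.Build dual dual_addA dual_addC dual_add0 dual_addN.

Lemma dual_mulA : associative dual_mul.
Proof. by move=> x y z; rewrite /dual_mul /=; congr Dual; ring. Qed.
Lemma dual_mulC : commutative dual_mul.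
Proof. by move=> x y; rewrite /dual_mul /=; congr Dual; ring. Qed.
Lemma dual_mul1 : left_id dual_one dual_mul.
Proof. by case=> a b; rewrite /dual_mul /=; congr Dual; ring. Qed.
Lemma dual_mulDl : left_distributive dual_mul dual_add.
Proof. by move=> x y z; rewrite /dual_mul /dual_add /=; congr Dual; ring. Qed.
Lemma dual_one_neq0 : dual_one != 0.
Proof. by apply/eqP => -[/eqP]; rewrite oner_eq0. Qed.

HB.instance Definition _ := GRing.Zmodule_isComNzRing.Build dual
  dual_mulA dual_mulC dual_mul1 dual_mulDl dual_one_neq0.

Lemma dual_addE x y : x + y = dual_add x y. Proof. by []. Qed.
Lemma dual_mulE x y : x * y = dual_mul x y. Proof. by []. Qed.
Lemma dual_oneE : 1 = Dual 1 0. Proof. by []. Qed.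
Lemma dual_subE x y : x - y = Dual (dual_re x - dual_re y) (dual_eps x - dual_eps y).
Proof. by []. Qed.

End DualNumbers.

(* A sealed copy of the polynomial ring: conversion checks between products
   in [{malg _[_]}] would unfold the convolution product *)
HB.lock Definition pring (I : choiceType) (R : comNzRingType) : comNzRingType :=
  ({malg R[{cmonom I}]} : comNzRingType).

Section SealedRing.
Variables (I : choiceType) (R : comNzRingType).
Local Notation M := {malg R[{cmonom I}]}.
Local Notation P := (pring I R).

Lemma pring_iso : {fg : {rmorphism M -> P} * {rmorphism P -> M} |
  cancel fg.1 fg.2 /\ cancel fg.2 fg.1}.
Proof.
rewrite pring.unlock.
by exists ((idfun : {rmorphism M -> M}), (idfun : {rmorphism M -> M})).
Qed.

Definition pr_of : M -> P := (sval pring_iso).1.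
Definition pr_to : P -> M := (sval pring_iso).2.
HB.instance Definition _ := GRing.RMorphism.on pr_of.
HB.instance Definition _ := GRing.RMorphism.on pr_to.

Lemma pr_ofK : cancel pr_of pr_to.
Proof. exact: (svalP pring_iso).1. Qed.

Lemma pr_toK : cancel pr_to pr_of.
Proof. exact: (svalP pring_iso).2. Qed.

Definition prC : R -> P := pr_of \o pconst.
HB.instance Definition _ := GRing.RMorphism.on prC.
Definition prX (i : I) : P := pr_of 'V_i.

Lemma pring_ind (Q : P -> Prop) :
  (forall c, Q (prC c)) -> (forall i, Q (prX i)) ->
  (forall p q, Q p -> Q q -> Q (p + q)) ->
  (forall p q, Q p -> Q q -> Q (p * q)) -> forall p, Q p.
Proof.
move=> QC QX QD QM p; rewrite -(pr_toK p).
move: (pr_to p) => {p}; apply: ipoly_ind => //.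
- by move=> p q hp hq; rewrite rmorphD; apply: QD.
- by move=> p q hp hq; rewrite rmorphM; apply: QM.
Qed.

Definition pr_coefs (F : set R) (p : P) : Prop := coefs_in F (pr_to p).

Lemma pring_ind_over (F : set R) (Q : P -> Prop) :
  Q 0 -> Q 1 -> (forall c, F c -> Q (prC c)) -> (forall i, Q (prX i)) ->
  (forall p q, Q p -> Q q -> Q (p + q)) ->
  (forall p q, Q p -> Q q -> Q (p * q)) -> forall p, pr_coefs F p -> Q p.
Proof.
move=> Q0 Q1 QC QX QD QM p; rewrite -{2}(pr_toK p) /pr_coefs.
move: (pr_to p) => {}p Fp; have : vars_in setT p by [].
move: p Fp; apply: ipoly_ind_over => //.
- by rewrite rmorph0.
- by rewrite rmorph1.
- by move=> i _; apply: QX.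
- by move=> p q hp hq; rewrite rmorphD; apply: QD.
- by move=> p q hp hq; rewrite rmorphM; apply: QM.
Qed.

Section Evaluation.
Variables (S : comNzRingType) (phi : {rmorphism R -> S}) (x : I -> S).

Definition preval : P -> S := peval phi x \o pr_to.
HB.instance Definition _ := GRing.RMorphism.on preval.

Lemma prevalC c : preval (prC c) = phi c.
Proof. by rewrite /preval /prC /= pr_ofK pevalC. Qed.

Lemma prevalX i : preval (prX i) = x i.
Proof. by rewrite /preval /prX /= pr_ofK pevalX. Qed.

End Evaluation.

Section Coefficients.
Variable F : set R.
Hypotheses (F0 : F 0) (F1 : F 1) (FD : forall a b, F a -> F b -> F (a + b))
  (FM : forall a b, F a -> F b -> F (a * b)).

Lemma pr_coefsC c : F c -> pr_coefs F (prC c).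
Proof. by move=> Fc; rewrite /pr_coefs /prC /= pr_ofK; apply: coefs_inC. Qed.

Lemma pr_coefsX i : pr_coefs F (prX i).
Proof. by rewrite /pr_coefs /prX pr_ofK; apply: coefs_inX. Qed.

Lemma pr_coefsD p q : pr_coefs F p -> pr_coefs F q -> pr_coefs F (p + q).
Proof. by move=> hp hq; rewrite /pr_coefs rmorphD; apply: coefs_inD. Qed.

Lemma pr_coefsM p q : pr_coefs F p -> pr_coefs F q -> pr_coefs F (p * q).
Proof. by move=> hp hq; rewrite /pr_coefs rmorphM; apply: coefs_inM. Qed.

End Coefficients.

End SealedRing.

(* The derivation extending [d] with prescribed values on the variables is the
   epsilon-part of an evaluation morphism into the dual numbers *)
Section PolynomialDerivation.
Variables (I : choiceType) (R : comNzRingType) (d : R -> R).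
Local Notation P := (pring I R).
Variable g : I -> P.
Hypotheses (dB : forall a b, d (a - b) = d a - d b)
  (dM : forall a b, d (a * b) = d a * b + a * d b) (d1 : d 1 = 0).

Definition dual_const (c : R) : dual P := Dual (prC I c) (prC I (d c)).

Lemma dual_const_zmod : zmod_morphism dual_const.
Proof. by move=> a b; rewrite /dual_const dB !rmorphB dual_subE. Qed.

Lemma dual_const_monoid : monoid_morphism dual_const.
Proof.
split=> [|a b]; first by rewrite /dual_const d1 rmorph0 rmorph1 dual_oneE.
by rewrite /dual_const dM rmorphD !rmorphM dual_mulE /dual_mul.
Qed.

HB.instance Definition _ := GRing.isZmodMorphism.Build _ _ dual_const dual_const_zmod.
HB.instance Definition _ := GRing.isMonoidMorphism.Build _ _ dual_const dual_const_monoid.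

Definition polyder (p : P) : P :=
  dual_eps (preval dual_const (fun i => Dual (prX R i) (g i)) p).

Lemma dual_re_peval p : dual_re (preval dual_const (fun i => Dual (prX R i) (g i)) p) = p.
Proof.
move: p; apply: pring_ind => [c|i|p q hp hq|p q hp hq].
- by rewrite prevalC.
- by rewrite prevalX.
- by rewrite rmorphD dual_addE /= hp hq.
- by rewrite rmorphM dual_mulE /= hp hq.
Qed.

Lemma polyderC c : polyder (prC I c) = prC I (d c).
Proof. by rewrite /polyder prevalC. Qed.

Lemma polyderX i : polyder (prX R i) = g i.
Proof. by rewrite /polyder prevalX. Qed.

Lemma polyderD p q : polyder (p + q) = polyder p + polyder q.
Proof. by rewrite /polyder rmorphD dual_addE. Qed.

Lemma polyderM p q : polyder (p * q) = polyder p * q + p * polyder q.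
Proof. by rewrite /polyder rmorphM dual_mulE /= !dual_re_peval. Qed.

End PolynomialDerivation.

Lemma dop_addA (m : nat) (th et ze : dop m) :
  dop_add th (dop_add et ze) = dop_add (dop_add th et) ze.
Proof. by apply/ffunP => i; rewrite !ffunE addnA. Qed.

Lemma dop_addC (m : nat) (th et : dop m) : dop_add th et = dop_add et th.
Proof. by apply/ffunP => i; rewrite !ffunE addnC. Qed.

Section DifferentialPolynomials.
Variables (m : nat) (U : diffField m) (J : choiceType).
Local Notation I := (J * dop m)%type.
Local Notation P := (pring I U).
Implicit Types p q : P.

Definition mder (i : 'I_m) : P -> P :=
  polyder (fun v : I => prX U (v.1, dop_add (dop_unit i) v.2))
    (@derB m U i) (@derM m U i) (@der1 m U i).

Lemma mderC i c : mder i (prC I c) = prC I (der i c).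
Proof. exact: polyderC. Qed.

Lemma mderX i (v : I) :
  mder i (prX U v) = prX U (v.1, dop_add (dop_unit i) v.2).
Proof. exact: polyderX. Qed.

Lemma mderD i p q : mder i (p + q) = mder i p + mder i q.
Proof. exact: polyderD. Qed.

Lemma mder0 i : mder i 0 = 0.
Proof. by apply: (addIr (mder i 0)); rewrite -mderD !add0r. Qed.

Lemma mderM i p q : mder i (p * q) = mder i p * q + p * mder i q.
Proof. exact: polyderM. Qed.

Lemma mder_comm i j p : mder i (mder j p) = mder j (mder i p).
Proof.
move: p; apply: pring_ind => [c|v|p q hp hq|p q hp hq].
- by rewrite !mderC derC.
- by rewrite !mderX /= !dop_addA (dop_addC (dop_unit i)).
- by rewrite !mderD hp hq.
- by rewrite !(mderM, mderD) hp hq; ring.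
Qed.

Definition jets (E : diffField m) (x : J -> E) (v : I) : E := dapp v.2 (x v.1).

Lemma preval_mder (E : diffField m) (phi : {rmorphism U -> E}) (x : J -> E) i p :
  diff_hom phi ->
  preval phi (jets x) (mder i p) = der i (preval phi (jets x) p).
Proof.
move=> hphi; move: p; apply: pring_ind => [c|v|p q hp hq|p q hp hq].
- by rewrite mderC !prevalC hphi.
- by rewrite mderX !prevalX /jets der_dapp.
- by rewrite mderD !rmorphD derD /= hp hq.
- by rewrite mderM rmorphD !rmorphM derM /= hp hq.
Qed.

Lemma mder_coefs (F : set U) i p : is_diff_subfield F ->
  pr_coefs F p -> pr_coefs F (mder i p).
Proof.
move=> [FF FD] Fp.
have cD := pr_coefsD (I := I) (subfieldD FF).
have cM := pr_coefsM (I := I) (subfield0 FF) (subfieldD FF) (subfieldM FF).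
have cC := pr_coefsC (I := I) (subfield0 FF).
suff [] : pr_coefs F p /\ pr_coefs F (mder i p) by [].
move: p Fp; apply: pring_ind_over.
- by rewrite -(rmorph0 (@prC I U)) mderC; split; apply: cC; rewrite ?der0; apply: subfield0.
- rewrite -(rmorph1 (@prC I U)) mderC; split; apply: cC; first exact: subfield1.
  by rewrite der1; apply: subfield0.
- by move=> c Fc; rewrite mderC; split; apply: cC => //; apply: FD.
- by move=> v; rewrite mderX; split; apply: (pr_coefsX (subfield0 FF) (subfield1 FF)).
- by move=> p q [h1 h2] [h3 h4]; rewrite mderD; split; apply: cD.
- by move=> p q [h1 h2] [h3 h4]; rewrite mderM; split; [apply: cM|apply: cD; apply: cM].
Qed.

End DifferentialPolynomials.

(** Induction on the variables: the product of the leading coefficients in one variable vanishes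
    with the product, and it involves fewer variables. *)
Lemma ipoly_domain (R : fieldType) (I : choiceType) (p q : ipoly R I) :
  p * q = 0 -> p = 0 \/ q = 0.
Proof.
have [D [Dp Dq]] : exists D : seq I, vars_in [set` D] p /\ vars_in [set` D] q.
  have [D1 h1] := vars_in_all p; have [D2 h2] := vars_in_all q.
  exists (D1 ++ D2); split.
    by apply: vars_in_sub h1 => i /= h; rewrite mem_cat h.
  by apply: vars_in_sub h2 => i /= h; rewrite mem_cat h orbT.
elim: D p q Dp Dq => [|i D IH] p q Dp Dq pq.
  have c (r : ipoly R I) : vars_in [set` [::]] r -> r = (r@_mone)%:K.
    by move=> h; apply: vars_in_set0; apply: vars_in_sub h => j.
  move: pq; rewrite (c p Dp) (c q Dq) -pconstM => /(congr1 (mcoeff mone)).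
  rewrite pconst_coef mcoeff0 => /eqP; rewrite mulf_eq0 => /orP[/eqP ->|/eqP ->].
    by left; rewrite pconst0.
  by right; rewrite pconst0.
have sub (r : ipoly R I) : vars_in [set` i :: D] r ->
    forall k, vars_in [set` D] (uview i r)`_k.
  move=> Dr k; apply: (@uview_coef I R i setT [set` D] r _ _ _ _ _ _ k).2 => //.
  by apply: vars_in_sub Dr => j /=; rewrite inE => /orP[/eqP ->|]; [right|left].
have PQ : uview i p * uview i q = 0 by rewrite -uviewM pq uview0.
have lead (r : ipoly R I) : lead_coef (uview i r) = 0 -> r = 0.
  by move=> /eqP; rewrite lead_coef_eq0 uview_eq0 => /eqP.
have [l0|l0] := eqVneq (lead_coef (uview i p) * lead_coef (uview i q)) 0.
  have := IH _ _ (sub p Dp _) (sub q Dq _) l0.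
  by case=> h; [left|right]; apply: lead.
by have := lead_coef_proper_mul l0; rewrite PQ lead_coef0 => e; rewrite -e eqxx in l0.
Qed.

(** * Fraction fields and the derivations they inherit *)

Section FractionField.
Variable R : comNzRingType.
Hypothesis R_domain : forall x y : R, x * y = 0 -> x = 0 \/ y = 0.

Definition domain_of & (forall x y : R, x * y = 0 -> x = 0 \/ y = 0) : Type := R.
Local Notation D := (domain_of R_domain).

HB.instance Definition _ := GRing.ComNzRing.copy D R.

Definition domain_unit : {pred D} := fun x => `[< exists y : D, y * x = 1 >].

Definition domain_inv (x : D) : D :=
  if pselect (exists y : D, y * x = 1) is left h then projT1 (cid h) else x.

Lemma domain_mulVx : {in domain_unit, left_inverse 1 domain_inv *%R}.
Proof.
move=> x /asboolP xu; rewrite /domain_inv; case: pselect => // h.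
by case: cid.
Qed.

Lemma domain_unitPl (x y : D) : y * x = 1 -> domain_unit x.
Proof. by move=> h; apply/asboolP; exists y. Qed.

Lemma domain_invr_out : {in [predC domain_unit], domain_inv =1 id}.
Proof.
move=> x /negP h; rewrite /domain_inv; case: pselect => // h'.
by case: h; apply/asboolP.
Qed.

HB.instance Definition _ := GRing.ComNzRing_hasMulInverse.Build D
  domain_mulVx domain_unitPl domain_invr_out.

Lemma domain_axiom : GRing.integral_domain_axiom D.
Proof. by move=> x y /R_domain[] ->; rewrite eqxx ?orbT. Qed.

HB.instance Definition _ := GRing.ComUnitRing_isIntegral.Build D domain_axiom.

Lemma fraction_field : exists (L : fieldType) (phi : {rmorphism R -> L}),
  injective phi /\ forall x, exists n d : R, d != 0 /\ x = phi n / phi d.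
Proof.
exists {fraction D}, (@FracField.tofrac D : {rmorphism D -> {fraction D}}).
split=> [x y /eqP|x]; first by rewrite tofrac_eq => /eqP.
elim/quotW: x => y; exists (frac y).1, (frac y).2.
have y0 : (frac y).2 != 0 :> D by exact: denom_ratioP.
split=> //; apply/(canRL (mulfK _)); first by rewrite tofrac_eq0.
rewrite /=; unlock FracField.tofrac.
rewrite -[LHS]FracField.pi_mul; apply/eqmodP; rewrite /= /FracField.equivf /FracField.mulf.
by rewrite !numden_Ratio ?mulr1 ?oner_neq0 //= mulrC.
Qed.

End FractionField.

Section DerivationOfFractions.
Variables (m : nat) (R : comNzRingType) (L : fieldType) (phi : {rmorphism R -> L}).
Hypotheses (phi_inj : injective phi)
  (fracP : forall x, exists n d : R, d != 0 /\ x = phi n / phi d).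
Variable D : 'I_m -> R -> R.
Hypotheses (DD : forall i x y, D i (x + y) = D i x + D i y)
  (DM : forall i x y, D i (x * y) = D i x * y + x * D i y)
  (DC : forall i j x, D i (D j x) = D j (D i x))
  (char0 : [pchar R] =i pred0).

Lemma phi_neq0 x : x != 0 -> phi x != 0.
Proof. by apply: contra_neq => /eqP; rewrite -(rmorph0 phi) => /eqP /phi_inj. Qed.

Let num x : R := projT1 (cid (fracP x)).
Let den x : R := projT1 (cid (projT2 (cid (fracP x)))).
Let denP x : den x != 0 /\ x = phi (num x) / phi (den x).
Proof. exact: projT2 (cid (projT2 (cid (fracP x)))). Qed.

Let fder i x : L := (phi (D i (num x)) * phi (den x) - phi (num x) * phi (D i (den x)))
  / phi (den x) ^+ 2.

Let fderE i n d : d != 0 ->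
  fder i (phi n / phi d) =
  (phi (D i n) * phi d - phi n * phi (D i d)) / phi d ^+ 2.
Proof.
move=> d0; rewrite /fder; set x := phi n / phi d; have [e0 ex] := denP x.
set n' := num x in ex *; set d' := den x in e0 ex *.
have pd := phi_neq0 d0; have pe := phi_neq0 e0.
have e : n' * d = n * d'.
  apply: phi_inj; rewrite !rmorphM; apply/eqP.
  by rewrite -eqr_div // -ex.
have De : D i n' * d + n' * D i d = D i n * d' + n * D i d' by rewrite -!DM e.
apply/eqP; rewrite eqr_div ?expf_neq0 //; apply/eqP.
rewrite -!rmorphM -!rmorphXn -!rmorphB -!rmorphM; congr (phi _).
(* A ring identity: the two cross products differ by a combination of [n' * d - n * d'] and its
   derivative, both zero. *)
transitivity ((D i n * d - n * D i d) * d' ^+ 2 +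
  d * d' * (D i n' * d + n' * D i d - (D i n * d' + n * D i d')) -
  (d * D i d' + d' * D i d) * (n' * d - n * d')); first by ring.
by rewrite De e !subrr !mulr0 subr0 addr0.
Qed.

Lemma fraction_diffField : exists (E : diffField m) (iota : {rmorphism R -> E}),
  injective iota /\ forall i x, iota (D i x) = der i (iota x).
Proof.
have D1 i : D i 1 = 0.
  by have /eqP := DM i 1 1; rewrite !mulr1 mul1r addrC -subr_eq subrr eq_sym => /eqP.
have fE i x : phi (D i x) = fder i (phi x).
  transitivity (fder i (phi x / phi 1)); last by rewrite rmorph1 divr1.
  by rewrite fderE ?oner_neq0 // D1 rmorph0 rmorph1 mulr1 mulr0 subr0 expr1n divr1.
have fD i x y : fder i (x + y) = fder i x + fder i y.
  have [n [d [d0 ->]]] := fracP x; have [n' [d' [d0' ->]]] := fracP y.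
  have pd := phi_neq0 d0; have pd' := phi_neq0 d0'.
  have pdd : d * d' != 0.
    by apply: contraTneq (mulf_neq0 pd pd') => h; rewrite -rmorphM h rmorph0 eqxx.
  have -> : phi n / phi d + phi n' / phi d' = phi (n * d' + n' * d) / phi (d * d').
    by rewrite !(rmorphM, rmorphD); field; rewrite pd pd'.
  rewrite !fderE // !(DD, DM) !(rmorphM, rmorphD); field.
  by rewrite pd pd'.
have fM i x y : fder i (x * y) = fder i x * y + x * fder i y.
  have [n [d [d0 ->]]] := fracP x; have [n' [d' [d0' ->]]] := fracP y.
  have pd := phi_neq0 d0; have pd' := phi_neq0 d0'.
  have pdd : d * d' != 0.
    by apply: contraTneq (mulf_neq0 pd pd') => h; rewrite -rmorphM h rmorph0 eqxx.
  have -> : phi n / phi d * (phi n' / phi d') = phi (n * n') / phi (d * d').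
    by rewrite !rmorphM; field; rewrite pd pd'.
  rewrite !fderE // !(DD, DM) !(rmorphM, rmorphD); field.
  by rewrite pd pd'.
have DN i x : D i (- x) = - D i x.
  apply: (addIr (D i x)); rewrite -DD !addNr.
  by apply: (addIr (D i 0)); rewrite -DD !add0r.
have fC i j x : fder i (fder j x) = fder j (fder i x).
  have [n [d [d0 ->]]] := fracP x; have pd := phi_neq0 d0.
  have pdd : d * d != 0.
    by apply: contraTneq (mulf_neq0 pd pd) => h; rewrite -rmorphM h rmorph0 eqxx.
  have e k : fder k (phi n / phi d) = phi (D k n * d - n * D k d) / phi (d * d).
    by rewrite fderE // rmorphB !rmorphM expr2.
  rewrite !e !fderE // !(DD, DN, DM) !(rmorphM, rmorphD, rmorphN) (DC i j n) (DC i j d).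
  by field.
have ch : [pchar L] =i pred0.
  move=> p; rewrite -(char0 p) !inE -(rmorph_nat phi) -(rmorph0 phi).
  by rewrite (inj_eq phi_inj).
exists (@DiffField m L fder fD fM fC ch), phi; split=> // i x.
Qed.

End DerivationOfFractions.

Lemma lift_coefs (I : choiceType) (R S : comNzRingType) (phi : {rmorphism R -> S})
  (p : {malg S[{cmonom I}]}) : (forall mu, exists c, phi c = p@_mu) ->
  exists q : {malg R[{cmonom I}]}, (forall mu, phi q@_mu = p@_mu) /\
    forall (T : comNzRingType) (psi : {rmorphism S -> T}) (x : I -> T),
      peval (psi \o phi) x q = peval psi x p.
Proof.
move=> /choice [c cP].
pose q : {malg R[{cmonom I}]} := [malg mu in msupp p => c mu].
have qc mu : phi q@_mu = p@_mu.
  rewrite mcoeffE; case: ifP => [|/negbT/mcoeff_outdom ->]; first by [].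
  exact: rmorph0.
exists q; split=> // T psi x; rewrite peval.unlock.
rewrite (mmapEw (fsubsetUl (msupp q) (msupp p))).
rewrite (mmapEw (fsubsetUr (msupp q) (msupp p))).
by apply: eq_bigr => mu _; rewrite /= qc.
Qed.

Lemma dapply_shift (m : nat) (th et : dop m) :
  dapply (fun i => dop_add (dop_unit i)) th et = dop_add th et.
Proof.
have it (i : 'I_m) k ze (j : 'I_m) :
    iter k (dop_add (dop_unit i)) ze j = ((j == i) * k + ze j)%N.
  by elim: k => [|k IH] /=; rewrite ?muln0 // ffunE IH ffunE mulnS addnA.
apply/ffunP => j; rewrite ffunE /dapply.
suff -> : foldr (fun i => iter (th i) (dop_add (dop_unit i))) et (enum 'I_m) j =
    ((j \in enum 'I_m) * th j + et j)%N by rewrite mem_enum mul1n.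
have := enum_uniq 'I_m; elim: (enum 'I_m) => //= i s IH /andP[is_ us].
rewrite it IH // inE; case: eqVneq => [->|_] //=.
by rewrite (negbTE is_) !mul1n.
Qed.

(** [E] is the fraction field of the differential polynomial ring over [U] and [A j] the underived
    variable [j]. The jets of [A] are then exactly the variables. *)
Lemma generic_extension (m : nat) (U : diffField m) (J : choiceType) :
  exists (E : diffField m) (iota : {rmorphism U -> E}) (A : J -> E),
    diff_hom iota /\ alg_indep (range iota) (jets A).
Proof.
set I := (J * dop m)%type; pose P := pring I U.
have Pdom (x y : P) : x * y = 0 -> x = 0 \/ y = 0.
  move=> xy; have : pr_to x * pr_to y = 0 by rewrite -rmorphM xy rmorph0.
  case/ipoly_domain => e; [left|right].
    by rewrite -(pr_toK x) e rmorph0.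
  by rewrite -(pr_toK y) e rmorph0.
have Pchar : [pchar P] =i pred0.
  move=> p; rewrite -(@diffField_char0 _ U p) !inE -(rmorph_nat (@prC I U)).
  congr (_ && _); apply/eqP/eqP => [h|->]; last by rewrite rmorph0.
  have := congr1 (fun z => (pr_to z)@_mone) h; rewrite /prC /= pr_ofK pconst_coef.
  by rewrite rmorph0 mcoeff0.
have [L [phi0 [phi0_inj fracP]]] := fraction_field Pdom.
have [E [phi [phi_inj phiD]]] := fraction_diffField phi0_inj fracP
  (@mderD _ U J) (@mderM _ U J) (@mder_comm _ U J) Pchar.
pose iota : {rmorphism U -> E} := phi \o @prC I U.
pose A j := phi (prX U (j, dop0 m)).
have iotaD : diff_hom iota by move=> i c; rewrite /= -mderC phiD.
have AE v : jets A v = phi (prX U v).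
  case: v => j th; rewrite /jets /= dappE -(dapply_morph phiD); congr (phi _).
  rewrite -(@dapply_morph _ _ _ (fun i => dop_add (dop_unit i)) _
    (fun et => prX U (j, et))); last by move=> i et; rewrite mderX.
  rewrite dapply_shift; congr (prX U (j, _)).
  by apply/ffunP => i; rewrite !ffunE addn0.
exists E, iota, A; split=> // p pr; rewrite ievalE.
have [|q [qp qE]] := @lift_coefs _ _ _ iota p.
  by move=> mu; case: (pr mu) => c _; exists c.
rewrite -(qE _ idfun) => e.
have ev : forall z : P, preval (idfun \o iota) (jets A) z = phi z.
  apply: pring_ind => [c|v|p1 q1 h1 h2|p1 q1 h1 h2].
  - by rewrite prevalC.
  - by rewrite prevalX AE.
  - by rewrite !rmorphD /= h1 h2.
  - by rewrite !rmorphM /= h1 h2.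
have q0 : q = 0.
  have := ev (pr_of q); rewrite /preval /= pr_ofK.
  rewrite e => /esym /eqP; rewrite -(rmorph0 phi) => /eqP /phi_inj h.
  by rewrite -(pr_ofK q) h rmorph0.
by apply/malgP => mu; rewrite -qp q0 !mcoeff0 rmorph0.
Qed.

Section SubDifferentialField.
Variables (m : nat) (U : diffField m) (F : set U) (FP : is_diff_subfield F).

Let T := subfield_type FP.1.

Definition sub_der (i : 'I_m) (x : T) : T :=
  subfield_in FP.1 (FP.2 i _ (subfield_valF x)).

Lemma sub_derD i x y : sub_der i (x + y) = sub_der i x + sub_der i y.
Proof. by apply: val_inj; rewrite /= derD. Qed.
Lemma sub_derM i x y : sub_der i (x * y) = sub_der i x * y + x * sub_der i y.
Proof. by apply: val_inj; rewrite /= derM. Qed.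
Lemma sub_derC i j x : sub_der i (sub_der j x) = sub_der j (sub_der i x).
Proof. by apply: val_inj; rewrite /= derC. Qed.
Lemma sub_char0 : [pchar T] =i pred0.
Proof.
move=> p; rewrite -(@diffField_char0 _ U p) !inE.
by rewrite -(rmorph_nat (val : {rmorphism T -> U})) fmorph_eq0.
Qed.

(** [universal_over] quantifies over abstract differential fields, so a differential subfield has to
    be made into one, with [sub_val] as its inclusion. *)
Definition sub_diffField : diffField m :=
  DiffField sub_derD sub_derM sub_derC sub_char0.

Definition sub_val : sub_diffField -> U := (val : T -> U).
HB.instance Definition _ := GRing.RMorphism.copy sub_val (val : T -> U).

Lemma sub_val_hom : diff_hom sub_val.
Proof. by []. Qed.

Lemma sub_valP x : F (sub_val x).
Proof. exact: subfield_valF. Qed.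

Lemma sub_val_inj : injective sub_val.
Proof. exact: val_inj. Qed.

Lemma sub_valK x : F x -> exists y, sub_val y = x.
Proof. by move=> Fx; exists (subfield_in FP.1 Fx). Qed.

End SubDifferentialField.

(** * Orderly rankings *)

Section LexicographicOrder.

Fixpoint ltlex (s t : seq nat) : bool :=
  match s, t with
  | x :: s', y :: t' => (x < y)%N || ((x == y) && ltlex s' t')
  | _, _ => false
  end.

Lemma ltlex_irr : irreflexive ltlex.
Proof. by elim=> //= x s ->; rewrite ltnn eqxx. Qed.

Lemma ltlex_trans : transitive ltlex.
Proof.
move=> t s u; elim: t s u => [|y t IH] [|x s] [|z u] //=.
move=> /orP[xy|/andP[/eqP -> st]] /orP[yz|/andP[/eqP <- tu]].
- by rewrite (ltn_trans xy yz).
- by rewrite xy.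
- by rewrite yz.
- by rewrite eqxx (IH _ _ st tu) orbT.
Qed.

Lemma ltlex_total s t : size s = size t -> s != t -> ltlex s t || ltlex t s.
Proof.
elim: s t => [|x s IH] [|y t] //= [st]; rewrite eqseq_cons.
by case: (ltngtP x y) => //= _; exact: IH.
Qed.

Lemma ltlex_add s t e : size s = size e -> size t = size e ->
  ltlex [seq (p.1 + p.2)%N | p <- zip e s] [seq (p.1 + p.2)%N | p <- zip e t] =
  ltlex s t.
Proof.
elim: e s t => [|z e IH] [|x s] [|y t] //= [se] [te].
by rewrite ltn_add2l eqn_add2l IH.
Qed.

End LexicographicOrder.

Section Ranking.
Variables (m : nat) (J : choiceType) (rk : J -> nat).
Hypothesis rk_inj : injective rk.
Local Notation I := (J * dop m)%type.

(** Comparing the order first makes the ranking orderly. All keys have equal length and a derivation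
    adds a fixed vector to them, so the ranking is compatible with derivations. *)
Definition rank_key (v : I) : seq nat :=
  dord v.2 :: rcons [seq v.2 i | i <- enum 'I_m] (rk v.1).

Definition rank_lt (v w : I) : bool := ltlex (rank_key v) (rank_key w).

Definition shift (i : 'I_m) (v : I) : I := (v.1, dop_add (dop_unit i) v.2).

Lemma dord_add (th et : dop m) : dord (dop_add th et) = (dord th + dord et)%N.
Proof. by rewrite /dord -big_split /=; apply: eq_bigr => i _; rewrite ffunE. Qed.

Lemma dord_unit i : dord (dop_unit i : dop m) = 1%N.
Proof.
rewrite /dord (bigD1 i) //= ffunE eqxx big1 // => j ji.
by rewrite ffunE (negbTE ji).
Qed.

Lemma rank_lt_irr : irreflexive rank_lt.
Proof. by move=> v; apply: ltlex_irr. Qed.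

Lemma rank_lt_trans : transitive rank_lt.
Proof. by move=> v u w; apply: ltlex_trans. Qed.

Lemma rank_lt_total v w : v != w -> rank_lt v w || rank_lt w v.
Proof.
move=> vw; apply: ltlex_total; first by rewrite /= !size_rcons !size_map.
apply: contraNneq vw; case: v w => [i th] [j et] [_] /= /rcons_inj [e /rk_inj ->].
apply/eqP; congr (_, _); apply/ffunP => k.
by move/eq_in_map: e; apply; rewrite mem_enum.
Qed.

Lemma rank_lt_dord v w : (dord v.2 < dord w.2)%N -> rank_lt v w.
Proof. by move=> h; rewrite /rank_lt /= h. Qed.

Lemma dord_rank_lt v w : rank_lt v w -> (dord v.2 <= dord w.2)%N.
Proof. by rewrite /rank_lt /= => /orP[/ltnW|/andP[/eqP ->]]. Qed.

Lemma rank_key_shift i v : rank_key (shift i v) =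
  [seq (p.1 + p.2)%N | p <-
    zip (1%N :: rcons [seq (dop_unit i : dop m) j | j <- enum 'I_m] 0%N) (rank_key v)].
Proof.
rewrite /rank_key /= dord_add dord_unit zip_rcons ?size_map // map_rcons /=.
congr (_ :: rcons _ _); elim: (enum 'I_m) => //= j s ->.
by rewrite ffunE.
Qed.

Lemma rank_lt_shift i v w : rank_lt v w -> rank_lt (shift i v) (shift i w).
Proof.
by rewrite /rank_lt !rank_key_shift ltlex_add // /= !size_rcons !size_map.
Qed.

Lemma rank_lt_shiftr i v : rank_lt v (shift i v).
Proof. by apply: rank_lt_dord; rewrite /= dord_add dord_unit. Qed.

Variables (U : diffField m) (G : set U) (b : J -> U).
Hypothesis GP : is_diff_subfield G.

(** Stands in for the leading derivatives of a characteristic set: some relation over [G] at [b]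
    determines this jet algebraically from lower ones. *)
Definition leader (v : I) : Prop :=
  cl (G `|` jets b @` [set w | rank_lt w v]) (jets b v).

(** Differentiating a relation shifts all its jets, and the shifted lower jets stay below the
    shifted leader. *)
Lemma leader_shift i v : leader v -> leader (shift i v).
Proof.
rewrite /leader => h.
have e : jets b (shift i v) = der i (jets b v) by rewrite /jets der_dapp.
rewrite e; apply: cl_der h => z.
  move=> hz; apply: sub_cl; case: hz => [|[w wv <-]]; first by left.
  by right; exists w => //; apply: rank_lt_trans wv (rank_lt_shiftr i v).
case=> y hy <-; apply: sub_cl; case: hy => [Gy|[w wv <-]].
  by left; apply: GP.2.
right; exists (shift i w); first exact: rank_lt_shift.
by rewrite /jets der_dapp.
Qed.

Lemma leader_add j th et : leader (j, th) -> leader (j, dop_add et th).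
Proof.
move=> h; rewrite -dapply_shift; apply: (dapply_ind (P := fun ze => leader (j, ze))) => //.
by move=> i ze /(leader_shift i).
Qed.

(** A member depending on [Y] and on lower members would be a leader, since everything involved lies
    in [G] or is ranked below it. *)
Lemma leaderless_findep j (L : choiceType) (g : L -> dop m) (Y : set U) :
  (forall th, ~ leader (j, th)) -> injective g ->
  (forall z, Y z -> G z \/ exists w, z = jets b w /\ forall l, rank_lt w (j, g l)) ->
  findep Y (fun l => dapp (g l) (b j)).
Proof.
move=> nl ginj hY; pose lt k l := rank_lt (j, g k) (j, g l).
apply: (@findep_ordered _ _ _ _ Y lt).
- by move=> k l k'; apply: rank_lt_trans.
- by move=> k; apply: rank_lt_irr.
- move=> k l kl; apply: rank_lt_total; apply: contraNneq kl => -[/ginj ->] //.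
- move=> l h; apply: (nl (g l)); apply: cl_mono h => z [/hY[|[w [-> hw]]]|[k kl <-]].
  + by left.
  + by right; exists w => //; apply: hw.
  + by right; exists (j, g k).
Qed.

End Ranking.

(** Degree [m] beats degree [m - 1]. Since [s + m * q + 1] is at most [(s + m + 1) * (q + 1)], the
    constant left over, [n * m * e * (s + m + 1) ^ (m - 1)], can serve as [q]. For [m = 0] the left
    side is zero. *)
Lemma numeric_bound (n m e s : nat) : exists q,
  (n * (m * (e * ((s + m * q).+1 ^ m.-1))) < q.+1 ^ m)%N.
Proof.
case: m => [|m]; first by exists 0%N; rewrite mul0n muln0.
pose Q := (n * (m.+1 * (e * (s + m.+1).+1 ^ m)))%N; exists Q => /=.
have h : ((s + m.+1 * Q).+1 <= (s + m.+1).+1 * Q.+1)%N by nia.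
rewrite expnS; apply: (@leq_ltn_trans (Q * Q.+1 ^ m)%N); last first.
  by rewrite ltn_pmul2r ?expn_gt0.
have {}h : ((s + m.+1 * Q).+1 ^ m <= (s + m.+1).+1 ^ m * Q.+1 ^ m)%N.
  rewrite -expnMn; case: (posnP m) => [->|m0]; first by rewrite !expn0.
  by rewrite leq_exp2r.
rewrite {2}/Q -!mulnA; do 3![apply: leq_mul => //].
Qed.

(** * Growth of the jets when every coordinate has a leader *)

Section Counting.
Variables (m n : nat) (U : diffField m) (G : set U) (b : 'I_n -> U).
Hypothesis GP : is_diff_subfield G.
Local Notation I := ('I_n * dop m)%type.
Local Notation rk := (@nat_of_ord n).

Definition jet_le (t : nat) : set U :=
  jets b @` [set v | (dord v.2 <= t)%N].

(** Derivatives of leaders are leaders, so a basis element in coordinate [j] has some exponent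
    smaller than that of a fixed leader, hence below [e]. The bound counts the coordinate, the
    position of the small exponent, its value, and the other [m - 1] exponents, each at most [T]. *)
Lemma jets_bound : (forall j, exists th, leader rk G b (j, th)) ->
  exists e, forall T, exists2 s : seq U,
    jet_le T `<=` cl (G `|` [set` s]) &
    (size s <= n * (m * (e * (T.+1 ^ m.-1))))%N.
Proof.
move=> /choice [th hth]; pose e := (\max_j \max_i (th j i).+1)%N.
have the j i : (th j i < e)%N.
  apply: leq_trans (leq_bigmax j).
  exact: (leq_bigmax (F := fun i => (th j i).+1) i).
exists e => T; pose X : finType := ('I_n * {ffun 'I_m -> 'I_T.+1})%type.
pose emb (x : X) : I := (x.1, [ffun i => x.2 i : nat]).
have emb_inj : injective emb.
  move=> [j f] [k g] [-> /ffunP h]; congr (_, _); apply/ffunP => i.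
  by apply: val_inj; have := h i; rewrite !ffunE.
have embP v : (dord v.2 <= T)%N -> exists x, emb x = v.
  case: v => j et /= het; have hi i : (et i < T.+1)%N.
    by rewrite ltnS; apply: leq_trans het; rewrite /dord (bigD1 i) //= leq_addr.
  exists (j, [ffun i => Ordinal (hi i)]); congr (_, _).
  by apply/ffunP => i; rewrite !ffunE.
pose ge (x y : X) := (x == y) || rank_lt rk (emb y) (emb x).
have rk_inj : injective rk by apply: val_inj.
have geT : total ge.
  move=> x y; rewrite /ge; case: (eqVneq x y) => //= xy.
  by rewrite orbC; apply: rank_lt_total => //; rewrite (inj_eq emb_inj).
have ge_trans : transitive ge.
  move=> y x z; rewrite /ge => /orP[/eqP -> //|yx] /orP[/eqP <-|zy].
    by rewrite yx orbT.
  by rewrite (rank_lt_trans zy yx) orbT.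
(* Decreasing rank: an element chosen from the right is then independent of all lower ranked jets,
   so it is not a leader. *)
pose t : seq X := sort ge [seq x <- enum {: X} | (dord (emb x).2 <= T)%N].
have tP x : (x \in t) = (dord (emb x).2 <= T)%N.
  by rewrite mem_sort mem_filter mem_enum andbT.
have [s [st si ts sP]] := @ordered_basis _ _ X (fun x => jets b (emb x)) G t.
exists (map (fun x => jets b (emb x)) s).
  move=> z [v vT <-]; have [x xv] := embP v vT; apply: ts.
  by apply/mapP; exists x; rewrite ?tP xv.
have us : uniq s by apply: subseq_uniq st _; rewrite sort_uniq filter_uniq // enum_uniq.
pose N j i : {set X} := [set x : X | (x.1 == j) && (x.2 i < e)%N]%SET.
have sN : {subset s <= (\bigcup_(j : 'I_n) \bigcup_(i : 'I_m) N j i)%SET}.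
  move=> x xs; have [t1 [t2 [te hx]]] := sP x xs.
  have nl : ~ leader rk G b (emb x).
    move=> h; apply: hx; apply: cl_mono h => z [|[w wx <-]]; first by left.
    have xt : x \in t by apply: (mem_subseq st).
    have [|y yw] := embP w.
      by apply: leq_trans (dord_rank_lt wx) _; rewrite -tP.
    have yt : y \in t.
      by rewrite tP yw; apply: leq_trans (dord_rank_lt wx) _; rewrite -tP.
    right; apply/mapP; exists y; last by rewrite yw.
    have : sorted ge t by apply: sort_sorted.
    rewrite te; move: yt; rewrite te mem_cat inE => /orP[yt1|/orP[/eqP yx|//]].
      move=> srt; have : ge y x.
        have : pairwise ge (t1 ++ x :: t2) by rewrite -sorted_pairwise.
        rewrite pairwise_cat => /andP[/allrelP h _].
        by apply: h; rewrite ?mem_head.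
      rewrite /ge yw => /orP[/eqP yx|xw]; first by move: wx; rewrite /= -yw yx rank_lt_irr.
      by have := rank_lt_trans wx xw; rewrite rank_lt_irr.
    by move: wx; rewrite /= -yw yx rank_lt_irr.
  have [i hi] : exists i, (x.2 i < th x.1 i)%N.
    apply: contrapT => /forallNP h; apply: nl.
    have -> : emb x = (x.1, dop_add [ffun i => (x.2 i - th x.1 i)%N] (th x.1)).
      congr (_, _); apply/ffunP => i; rewrite !ffunE subnK //.
      by have /negP := h i; rewrite -leqNgt.
    exact: leader_add.
  apply/finset.bigcupP; exists x.1 => //; apply/finset.bigcupP; exists i => //.
  by rewrite inE eqxx /=; apply: ltn_trans hi _.
rewrite size_map; apply: leq_trans (_ : _ <= #|(\bigcup_(j : 'I_n) \bigcup_(i : 'I_m) N j i)%SET|)%N _.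
  by rewrite -(card_uniqP us); apply/subset_leq_card/fintype.subsetP.
have cN j i : (#|N j i| <= e * (T.+1 ^ m.-1))%N.
  pose F k : pred 'I_T.+1 := if k == i then fun z => (z < e)%N else predT.
  have /subset_leq_card : N j i \subset [set x : X | (x.1 == j) && (x.2 \in family F)]%SET.
    apply/fintype.subsetP => x; rewrite !finset.in_set => /andP[-> h] /=.
    apply/familyP => k.
    by rewrite /F; case: eqVneq => [->|].
  move/leq_trans; apply.
  have -> : [set x : X | (x.1 == j) && (x.2 \in family F)]%SET =
      finset.setX [set j]%SET [set f in family F]%SET.
    by apply/setP => -[j' f]; rewrite !inE.
  rewrite cardsX cards1 mul1n cardsE card_family foldrE big_map big_enum /=.
  rewrite (bigD1 i) //= /F eqxx; apply: leq_mul.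
    rewrite cardE -(size_map val) -[leqRHS](size_iota 0); apply: uniq_leq_size.
      by rewrite map_inj_uniq ?enum_uniq //; apply: val_inj.
    by move=> z /mapP[y]; rewrite mem_enum mem_iota => h ->.
  rewrite (eq_bigr (fun=> T.+1)) => [|k /negbTE ->]; last by rewrite card_ord.
  by rewrite prod_nat_const cardC1 card_ord.
have cU k (F : 'I_k -> {set X}) c : (forall i, #|F i| <= c)%N ->
    (#|(\bigcup_i F i)%SET| <= k * c)%N.
  move=> h; apply: (@leq_trans (\sum_(i < k) #|F i|)%N).
    elim/big_rec2: _ => [|i u v _ uv]; first by rewrite cards0.
    by apply: leq_trans (leq_card_setU _ _) _; rewrite leq_add2l.
  rewrite -[k in (k * c)%N]card_ord -sum_nat_const.
  by apply: leq_sum => i _; apply: h.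
by apply: (cU n) => j; apply: (cU m) => i; apply: cN.
Qed.

(** Operators with all exponents at most [q] give [(q + 1) ^ m] derivatives of [c], too many for the
    jets of order [s + m * q]. The lemma serves twice: for a differential transcendental in K<b>,
    and for the constant coefficient of [f] when d = 0. *)
Lemma leaders_diff_algebraic (c : U) (s : nat) :
  (forall j, exists th, leader rk G b (j, th)) ->
  (forall th, cl (G `|` jet_le (s + dord th)) (dapp th c)) ->
  ~ findep G (fun th : dop m => dapp th c).
Proof.
move=> hl hc /findepP ind; have [e he] := jets_bound hl.
have [q hq] := numeric_bound n m e s.
have [u hu su] := he (s + m * q)%N.
pose emb (f : {ffun 'I_m -> 'I_q.+1}) : dop m := [ffun i => f i : nat].
have emb_inj : injective emb.
  move=> f g /ffunP h; apply/ffunP => i.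
  by apply: val_inj; have := h i; rewrite !ffunE.
have dord_emb f : (dord (emb f) <= m * q)%N.
  rewrite /dord -[m in (m * q)%N]card_ord -sum_nat_const; apply: leq_sum => i _.
  by rewrite ffunE -ltnS.
pose l := [seq emb f | f <- enum {: {ffun 'I_m -> 'I_q.+1}}].
have ul : uniq l by rewrite map_inj_uniq // enum_uniq.
have := steinitz (ind l ul) (t := u).
rewrite size_map /l size_map -cardE card_ffun !card_ord => h.
have : (q.+1 ^ m <= size u)%N.
  apply: h => z /= /mapP[th /mapP[f _ ->] ->].
  have : cl (G `|` jet_le (s + m * q)) (dapp (emb f) c).
    apply: cl_mono (hc _) => w [|[v hv <-]]; first by left.
    right; exists v => //=; apply: leq_trans hv _; rewrite leq_add2l.
    exact: dord_emb.
  by apply: cl_sub => w [Gw|/hu //]; apply: sub_cl; left.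
by rewrite leqNgt (leq_ltn_trans su hq).
Qed.

End Counting.

(** * Generic combinations *)

Section SealedIndependence.
Variables (m : nat) (U : diffField m) (I : choiceType).
Implicit Types (F : set U) (x : I -> U).

Lemma alg_indep_pr F x (q : pring I U) : alg_indep F x -> pr_coefs F q ->
  preval idfun x q = 0 -> q = 0.
Proof.
move=> h Fq e; have e0 : pr_to q = 0 by apply: h => //; rewrite ievalE.
by rewrite -(pr_toK q) e0 rmorph0.
Qed.

Lemma pr_alg_indep F x :
  (forall q : pring I U, pr_coefs F q -> preval idfun x q = 0 -> q = 0) ->
  alg_indep F x.
Proof.
move=> h p Fp; rewrite ievalE => e; have e0 : pr_of p = 0.
  by apply: h; rewrite /pr_coefs /preval /= pr_ofK.
by rewrite -(pr_ofK p) e0 rmorph0.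
Qed.

Lemma coefs_preval F x (q : pring I U) : is_subfield F -> pr_coefs F q ->
  (forall i, F (x i)) -> F (preval idfun x q).
Proof. by move=> FF Fq Fx; rewrite /preval /= -ievalE; apply: subfield_ieval. Qed.

Definition linear_form (q : pring I U) : Prop :=
  exists l : seq (U * I), q = \sum_(p <- l) prC I p.1 * prX U p.2.

End SealedIndependence.

Section AffineIndependence.
Variables (m : nat) (U : diffField m) (I S : choiceType) (M L : set U).
Variables (x : I -> U) (c : S -> U) (Lam : S -> pring I U).
Hypotheses (MF : is_subfield M) (LF : is_subfield L) (ML : M `<=` L)
  (x_indep : alg_indep L x) (Lc : forall s, L (c s)) (c_indep : alg_indep M c)
  (Lam_coefs : forall s, pr_coefs L (Lam s))
  (Lam_lin : forall s, linear_form (Lam s)).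

Let la s := preval idfun x (Lam s).
Let y (v : I + S) := match v with inl i => x i | inr s => c s end.
Let z (v : I + S) := match v with inl i => x i | inr s => c s + la s end.

Let y_indep : alg_indep M y.
Proof.
apply/(alg_indepP _ MF)/findep_sum; first exact/(alg_indepP _ MF).
apply: findep_sub ((alg_indepP _ LF).1 x_indep) => w hw; apply: sub_cl.
by case: hw => [/ML //|[s _ <-]]; apply: Lc.
Qed.

(* Scaling the variables [x] by 'X makes the relation homogeneous in them; its
   lowest coefficient is a relation for the constant terms [c] *)
Lemma affine_alg_indep : alg_indep M z.
Proof.
apply: pr_alg_indep => p Mp pz.
pose P := pring (I + S)%type U.
pose R0 : {rmorphism P -> pring I U} := preval (@prC I U)
  (fun v => match v with inl i => prX U i | inr s => prC I (c s) + Lam s end).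
have R0E : forall q : P, preval idfun x (R0 q) = preval idfun z q.
  apply: pring_ind => [a|[i|s]|q1 q2 h1 h2|q1 q2 h1 h2].
  - by rewrite /R0 /= !prevalC.
  - by rewrite /R0 /= !prevalX.
  - by rewrite /R0 /= prevalX rmorphD prevalX /= prevalC.
  - by rewrite !rmorphD /= h1 h2.
  - by rewrite !rmorphM /= h1 h2.
have R0L : pr_coefs L (R0 p).
  have cD := pr_coefsD (I := I) (subfieldD LF).
  have cM := pr_coefsM (I := I) (subfield0 LF) (subfieldD LF) (subfieldM LF).
  have cC := pr_coefsC (I := I) (subfield0 LF).
  have cX := pr_coefsX (I := I) (subfield0 LF) (subfield1 LF).
  move: p Mp {pz}; apply: pring_ind_over.
  - by rewrite rmorph0 -(rmorph0 (@prC I U)); exact: cC (subfield0 LF).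
  - by rewrite rmorph1 -(rmorph1 (@prC I U)); exact: cC (subfield1 LF).
  - by move=> a Ma; rewrite /R0 /= prevalC; exact: cC (ML Ma).
  - by case=> [i|s]; rewrite /R0 /= prevalX //; apply: cD => //; apply: cC.
  - by move=> q1 q2 h1 h2; rewrite rmorphD; apply: cD.
  - by move=> q1 q2 h1 h2; rewrite rmorphM; apply: cM.
(* Since [x] is independent over [L], the relation holds identically in [x] and so survives the
   scaling by 'X. *)
have R0p : R0 p = 0 by apply: alg_indep_pr x_indep R0L _; rewrite R0E.
pose tau : {rmorphism pring I U -> {poly U}} :=
  preval (@polyC U) (fun i => (x i)%:P * 'X).
have tau_lin s : tau (Lam s) = (preval idfun x (Lam s))%:P * 'X.
  have [l ->] := Lam_lin s.
  elim: l => [|[a i] l IH]; first by rewrite big_nil !rmorph0 mul0r.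
  rewrite big_cons !rmorphD mulrDl /= IH; congr (_ + _).
  by rewrite /tau /= !rmorphM /= !prevalC !prevalX /= mulrA.
(* [chi] records the degree in the variables for [x] as a power of 'X. Together with [E] below it
   computes the scaled relation in a second way. *)
pose chi : {rmorphism P -> {poly P}} := preval (@polyC P \o @prC (I + S)%type U)
  (fun v => match v with inl i => (prX U v)%:P * 'X | inr s => (prX U v)%:P end).
have chi1 : forall q, (chi q).[1] = q.
  apply: pring_ind => [a|[i|s]|q1 q2 h1 h2|q1 q2 h1 h2].
  - by rewrite /chi /= prevalC /= hornerC.
  - by rewrite /chi /= prevalX hornerM hornerC hornerX mulr1.
  - by rewrite /chi /= prevalX hornerC.
  - by rewrite rmorphD hornerD /= h1 h2.
  - by rewrite rmorphM hornerM /= h1 h2.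
have chiM : forall k, pr_coefs M (chi p)`_k.
  pose J := (I + S)%type.
  have cD := pr_coefsD (I := J) (subfieldD MF).
  have cM := pr_coefsM (I := J) (subfield0 MF) (subfieldD MF) (subfieldM MF).
  have cC := pr_coefsC (I := J) (subfield0 MF).
  have cX := pr_coefsX (I := J) (subfield0 MF) (subfield1 MF).
  have c0 : pr_coefs M (0 : P).
    by rewrite -(rmorph0 (@prC J U)); exact: cC (subfield0 MF).
  have c1 : pr_coefs M (1 : P).
    by rewrite -(rmorph1 (@prC J U)); exact: cC (subfield1 MF).
  move: p Mp {pz R0L R0p}; apply: pring_ind_over.
  - by move=> k; rewrite rmorph0 coef0.
  - by move=> k; rewrite rmorph1 coef1; case: eqP.
  - by move=> a Ma k; rewrite /chi /= prevalC /= coefC; case: eqP => // _; apply: cC.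
  - case=> [i|s] k; rewrite /chi /= prevalX ?coefMX ?coefC; first by do 2!case: eqP => //.
    by case: eqP.
  - by move=> q1 q2 h1 h2 k; rewrite rmorphD coefD; apply: cD.
  - move=> q1 q2 h1 h2 k; rewrite rmorphM coefM.
    by apply: (big_ind (pr_coefs M)) => // j _; apply: cM.
pose E : {rmorphism P -> {poly U}} := preval (@polyC U)
  (fun v => match v with inl i => (x i)%:P | inr s => (c s)%:P + (la s)%:P * 'X end).
have E0 : forall q, (E q)`_0 = preval idfun y q.
  move=> q; rewrite -horner_coef0; move: q.
  apply: pring_ind => [a|[i|s]|q1 q2 h1 h2|q1 q2 h1 h2].
  - by rewrite /E /= !prevalC hornerC.
  - by rewrite /E /= !prevalX hornerC.
  - by rewrite /E /= !prevalX hornerD hornerM !hornerC hornerX mulr0 addr0.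
  - by rewrite !rmorphD hornerD /= h1 h2.
  - by rewrite !rmorphM hornerM /= h1 h2.
have ER : forall q, (map_poly E (chi q)).['X] = tau (R0 q).
  apply: pring_ind => [a|[i|s]|q1 q2 h1 h2|q1 q2 h1 h2].
  - by rewrite /chi /R0 /= !prevalC /= map_polyC hornerC /= /E /tau /= !prevalC.
  - rewrite /chi /R0 /= !prevalX rmorphM /= map_polyC map_polyX hornerM hornerC hornerX /=.
    by rewrite /E /tau /= !prevalX.
  - rewrite /chi /R0 /= !prevalX /= map_polyC hornerC /= rmorphD /= tau_lin.
    by rewrite /E /tau /= prevalX prevalC.
  - by rewrite !rmorphD hornerD /= h1 h2.
  - by rewrite !rmorphM hornerM /= h1 h2.
apply: contrapT => /eqP p0.
have exk : exists k, (chi p)`_k != 0.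
  apply: contrapT => /forallNP h; case/eqP: p0; rewrite -(chi1 p).
  suff -> : chi p = 0 by rewrite horner0.
  by apply/polyP => k; rewrite coef0; apply: contrapT => /eqP; apply: h.
(* At the lowest power of 'X only the constant terms of [E] contribute, and these are values at [y],
   that is, at [x] and the bare [c]. *)
have [k kn kmin] := ex_minnP exk.
case/negP: kn; apply/eqP; apply: alg_indep_pr y_indep (chiM k) _.
have := congr1 (fun r : {poly U} => r`_k) (ER p); rewrite R0p rmorph0 coef0.
rewrite horner_coef coef_sum => e; rewrite -E0 -[RHS]e {e}.
set r := map_poly E (chi p).
have rE i : r`_i = E (chi p)`_i by rewrite coef_map.
have r0 i : (i < k)%N -> r`_i = 0.
  move=> ik; rewrite rE; suff -> : (chi p)`_i = 0 by rewrite rmorph0.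
  by apply: contrapT => /eqP /kmin; rewrite leqNgt ik.
rewrite -rE; have [kr|kr] := ltnP k (size r); last first.
  have -> : r`_k = 0 by rewrite nth_default.
  rewrite coef0 big1 // => i _.
  by rewrite r0 ?mul0r ?coef0 // (leq_trans _ kr).
rewrite (bigD1 (Ordinal kr)) //= coefMXn ltnn subnn big1 ?addr0 // => i ik.
have [lt|le] := ltnP i k; first by rewrite r0 // mul0r coef0.
rewrite coefMXn ltn_neqAle le andbT; suff -> : (k != i)%N by [].
by apply: contra_neq ik => e; apply: val_inj.
Qed.

End AffineIndependence.

Section DifferentialClosure.
Variables (m : nat) (U : diffField m).
Implicit Types K S F : set U.

Lemma sub_diff_adjoin K S : K `|` S `<=` diff_adjoin K S.
Proof. exact: sub_gen_smallest. Qed.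

Lemma diff_adjoin_min K S F : is_diff_subfield F -> K `|` S `<=` F ->
  diff_adjoin K S `<=` F.
Proof. by move=> FP h x; apply. Qed.

Lemma diff_adjoinP K S : is_diff_subfield (diff_adjoin K S).
Proof.
split; last by move=> i x hx A [AP hA]; apply: AP.2; apply: hx.
apply/subfieldP; split.
- by move=> A [[AF _] _]; apply: subfield1.
- move=> x y hx hy A AP; have [[AF _] _] := AP.
  by apply: (subfieldB AF); [apply: hx|apply: hy].
- move=> x y hx hy A AP; have [[AF _] _] := AP.
  by apply: (subfield_div AF); [apply: hx|apply: hy].
Qed.

Lemma diff_subfield_dapp (F : set U) th (x : U) : is_diff_subfield F -> F x -> F (dapp th x).
Proof. by move=> FP Fx; rewrite dappE; apply: dapply_ind Fx => i y; apply: FP.2. Qed.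

Lemma diff_adjoin_fld K (J : choiceType) (x : J -> U) : is_diff_subfield K ->
  diff_adjoin K (range x) = fld (K `|` range (jets x)).
Proof.
move=> KP; apply/seteqP; split; last first.
  apply: fld_min; first exact: (diff_adjoinP _ _).1.
  move=> z [Kz|[v _ <-]]; first by apply: sub_diff_adjoin; left.
  apply: (diff_subfield_dapp _ (diff_adjoinP _ _)).
  by apply: sub_diff_adjoin; right; exists v.1.
apply: diff_adjoin_min.
  split=> [|i y hy]; first exact: fldP.
  apply: fld_der hy => z; first by apply: sub_fld.
  case=> w hw <-; apply: sub_fld; case: hw => [Kw|[v _ <-]].
    by left; apply: KP.2.
  by right; exists (shift i v) => //; rewrite /jets der_dapp.
move=> z [Kz|[j _ <-]]; first by apply: sub_fld; left.
apply: sub_fld; right; exists (j, dop0 m) => //.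
by rewrite /jets dappE dapply0.
Qed.

Lemma dappD th (x y : U) : dapp th (x + y) = dapp th x + dapp th y.
Proof.
rewrite /dapp; elim: (enum 'I_m) => //= i s ->.
by elim: (th i) => //= k ->; rewrite derD.
Qed.

Lemma dappN th (x : U) : dapp th (- x) = - dapp th x.
Proof.
rewrite /dapp; elim: (enum 'I_m) => //= i s ->.
by elim: (th i) => //= k ->; rewrite derN.
Qed.

(** Puts all derivatives of a shift by 0 or 1 in every subfield, which matters because the base
    field of the generic combination need not be closed under derivations. *)
Lemma dapp01 th (z : U) : z = 0 \/ z = 1 -> dapp th z = 0 \/ dapp th z = 1.
Proof.
apply: (@dapply_ind _ _ _ (fun z : U => z = 0 \/ z = 1)) => i y [] ->; left.
  exact: der0.
exact: der1.
Qed.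

End DifferentialClosure.

Section FamilyTransformations.
Variables (m : nat) (U : diffField m) (I : choiceType) (F : set U).

(** Over the base, each member and its replacement are algebraic over one another, so they have the
    same closure. *)
Lemma findep_transform (x x' : I -> U) :
  (forall i, cl (F `|` [set x i]) (x' i)) ->
  (forall i, cl (F `|` [set x' i]) (x i)) -> findep F x -> findep F x'.
Proof.
move=> h1 h2 hx i hi; apply: (hx i).
have h3 : F `|` x' @` [set j | j != i] `<=` cl (F `|` x @` [set j | j != i]).
  move=> z [Fz|[j ji <-]]; first by apply: sub_cl; left.
  by apply: cl_mono (h1 j) => w [|->]; [left|right; exists j].
apply: cl_sub (h2 i) => z [Fz|->]; first by apply: sub_cl; left.
exact: cl_sub h3 _ hi.
Qed.

Lemma findep_translate (x x' : I -> U) : is_subfield F ->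
  (forall i, F (x i - x' i)) -> findep F x -> findep F x'.
Proof.
move=> FF h; apply: findep_transform => i.
  have -> : x' i = x i - (x i - x' i) by ring.
  apply: (subfieldB (cl_subfield _)); apply: sub_cl; first by right.
  by left; apply: h.
have -> : x i = x' i + (x i - x' i) by ring.
apply: (subfieldD (cl_subfield _)); apply: sub_cl; first by right.
by left; apply: h.
Qed.

Lemma findep_opp (x : I -> U) : findep F x -> findep F (fun i => - x i).
Proof.
apply: findep_transform => i.
  by apply: (subfieldN (cl_subfield _)); apply: sub_cl; right.
rewrite -[X in cl _ X]opprK; apply: (subfieldN (cl_subfield _)).
by apply: sub_cl; right.
Qed.

Lemma findep_reindex (J : choiceType) (x : I -> U) (g : J -> I) :
  injective g -> findep F x -> findep F (x \o g).
Proof.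
move=> ginj hx j hj; apply: (hx (g j)); apply: cl_mono hj => z [|[k kj <-]].
  by left.
by right; exists (g k) => //=; apply: contraNneq kj => /ginj ->.
Qed.

End FamilyTransformations.

Lemma linear_form_mder (m : nat) (U : diffField m) (J : choiceType) i
    (q : pring (J * dop m)%type U) : linear_form q -> linear_form (mder i q).
Proof.
case=> l ->; elim: l => [|[a v] l [l' IH]].
  by exists [::]; rewrite !big_nil mder0.
exists ((der i a, v) :: (a, shift i v) :: l').
by rewrite !big_cons mderD IH mderM mderC mderX /= addrA.
Qed.

Lemma preval_dapply (m : nat) (U E : diffField m) (phi : {rmorphism U -> E})
    (J : choiceType) (x : J -> E) th (q : pring (J * dop m)%type U) :
  diff_hom phi ->
  preval phi (jets x) (dapply (@mder m U J) th q) = dapp th (preval phi (jets x) q).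
Proof.
by move=> hphi; rewrite dappE; apply: dapply_morph => i p; apply: preval_mder.
Qed.

Section GenericCombination.
Variables (m : nat) (U : diffField m) (M L : set U) (J : choiceType).
Variables (A : J -> U) (D : seq J) (e : J -> U) (j0 : J).
Variables (S : choiceType) (g : S -> dop m).
Hypotheses (MF : is_subfield M) (LP : is_diff_subfield L) (ML : M `<=` L)
  (A_indep : alg_indep L (jets A)) (Le : forall j, L (e j))
  (uD : uniq D) (j0D : j0 \in D)
  (e_indep : alg_indep M (fun s => dapp (g s) (e j0))).

(* Shifting the coefficient of [e j0] by 1 exhibits the combination as
   [- e j0] plus a linear form in independent elements *)
Lemma generic_combination_indep :
  alg_indep M (fun v : (J * dop m) + S => match v with
    | inl w => jets A w
    | inr s => dapp (g s) (- \sum_(j <- D) A j * e j) end).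
Proof.
pose A' j := A j - (j == j0)%:R.
have LF := LP.1.
have d01 v : jets A v - jets A' v = 0 \/ jets A v - jets A' v = 1.
  rewrite /jets -dappN -dappD /A' opprB addrC subrK.
  by apply: dapp01; case: eqP; [right|left].
have F01 (F : set U) : is_subfield F -> forall v, F (jets A v - jets A' v).
  by move=> FF v; case: (d01 v) => ->; [apply: (subfield0 FF)|apply: (subfield1 FF)].
have A'_indep : alg_indep L (jets A').
  apply/(alg_indepP _ LF); apply: (findep_translate LF (F01 _ LF)).
  exact/(alg_indepP _ LF).
pose I := (J * dop m)%type.
(* The linear part in the shifted coefficients. [mder] preserves linear forms, so every derivative
   of the combination is again a constant plus a linear form. *)
pose q0 : pring I U := \sum_(j <- D) prC I (- e j) * prX U (j, dop0 m).
pose Lam s := dapply (@mder m U J) (g s) q0.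
pose c s := - dapp (g s) (e j0).
have q0L : pr_coefs L q0.
  rewrite /q0; apply: (big_ind (pr_coefs L)).
  - rewrite -(rmorph0 (@prC I U)).
    exact: (pr_coefsC (I := I) (subfield0 LF) (subfield0 LF)).
  - exact: (pr_coefsD (subfieldD LF)).
  - move=> j _; apply: (pr_coefsM (subfield0 LF) (subfieldD LF) (subfieldM LF)).
      exact: (pr_coefsC (I := I) (subfield0 LF) (subfieldN LF (Le j))).
    exact: (pr_coefsX (subfield0 LF) (subfield1 LF)).
have q0lin : linear_form q0.
  by exists [seq (- e j, (j, dop0 m)) | j <- D]; rewrite /q0 big_map.
have c_indep : alg_indep M c.
  by apply/(alg_indepP _ MF)/findep_opp/(alg_indepP _ MF).
have Lc s : L (c s) by apply: (subfieldN LF); apply: diff_subfield_dapp.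
have h := @affine_alg_indep _ U I S M L (jets A') c Lam MF LF ML A'_indep Lc c_indep.
have {}h : alg_indep M (fun v : I + S => match v with
    | inl i => jets A' i
    | inr s => c s + preval idfun (jets A') (Lam s) end).
  apply: h => s; rewrite /Lam.
    by apply: dapply_ind q0L => i y; apply: mder_coefs.
  by apply: dapply_ind q0lin => i y; apply: linear_form_mder.
apply/(alg_indepP _ MF).
have {}h := (alg_indepP _ MF).1 h; apply: (findep_translate MF _ h) => -[v|s].
  by rewrite -opprB; apply: (subfieldN MF); apply: F01.
suff -> : c s + preval idfun (jets A') (Lam s) = dapp (g s) (- \sum_(j <- D) A j * e j).
  by rewrite subrr; apply: subfield0.
rewrite /Lam preval_dapply // /c -dappN -dappD; congr (dapp _ _).
have -> : preval idfun (jets A') q0 = \sum_(j <- D) - (A' j * e j).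
  rewrite /q0 rmorph_sum /=; apply: eq_bigr => j _.
  by rewrite rmorphM /= prevalC prevalX /= /jets /= dappE dapply0 mulNr mulrC.
rewrite sumrN -opprD; congr (- _).
rewrite (bigD1_seq j0) //= [RHS](bigD1_seq j0) //= addrA; congr (_ + _).
  by rewrite /A' eqxx /=; ring.
by apply: eq_bigr => j /negbTE jj; rewrite /A' jj subr0.
Qed.

End GenericCombination.

(** * Transport along morphisms of differential fields *)

Lemma push_coefs (I : choiceType) (R S : comNzRingType) (phi : {rmorphism R -> S})
    (q : {malg R[{cmonom I}]}) : exists p : {malg S[{cmonom I}]},
  (forall mu, p@_mu = phi q@_mu) /\
  forall x : I -> S, peval idfun x p = peval phi x q.
Proof.
pose p : {malg S[{cmonom I}]} := [malg mu in msupp q => phi q@_mu].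
have pc mu : p@_mu = phi q@_mu.
  rewrite mcoeffE; case: ifP => [//|/negbT/mcoeff_outdom ->].
  by rewrite rmorph0.
exists p; split=> // x; rewrite peval.unlock.
rewrite (mmapEw (fsubsetUl (msupp p) (msupp q))).
rewrite (mmapEw (fsubsetUr (msupp p) (msupp q))).
by apply: eq_bigr => mu _; rewrite /= pc.
Qed.

Lemma morph_peval (I : choiceType) (R S T : comNzRingType) (phi : {rmorphism R -> S})
    (psi : {rmorphism S -> T}) (x : I -> S) (q : {malg R[{cmonom I}]}) :
  psi (peval phi x q) = peval (psi \o phi) (psi \o x) q.
Proof.
move: q; apply: ipoly_ind => [c|i|p q hp hq|p q hp hq].
- by rewrite !pevalC.
- by rewrite !pevalX.
- by rewrite !rmorphD /= hp hq.
- by rewrite !rmorphM /= hp hq.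
Qed.

Lemma eq_peval (I : choiceType) (R S : comNzRingType) (phi psi : {rmorphism R -> S})
    (x y : I -> S) : phi =1 psi -> x =1 y -> peval phi x =1 peval psi y.
Proof.
move=> e1 e2; apply: ipoly_ind => [c|i|p q hp hq|p q hp hq].
- by rewrite !pevalC.
- by rewrite !pevalX.
- by rewrite !rmorphD /= hp hq.
- by rewrite !rmorphM /= hp hq.
Qed.

Lemma alg_indep_morph (m : nat) (U E : diffField m) (iota : {rmorphism U -> E})
    (I : choiceType) (K : set U) (x : I -> U) :
  alg_indep K x -> alg_indep (iota @` K) (iota \o x).
Proof.
move=> h p Kp; rewrite ievalE => e.
have [|q [qp qE]] := @lift_coefs _ _ _ iota p.
  by move=> mu; case: (Kp mu) => c _ <-; exists c.
have q0 : q = 0.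
  apply: h => [mu|].
    by case: (Kp mu) => c Kc; rewrite -qp => /fmorph_inj <-.
  rewrite ievalE; apply: (fmorph_inj iota); rewrite rmorph0 morph_peval.
  by rewrite -[RHS]e -(qE _ idfun); apply: eq_peval.
by apply/malgP => mu; rewrite -qp q0 !mcoeff0 rmorph0.
Qed.

Lemma alg_indep_push (m : nat) (U E : diffField m) (iota : {rmorphism U -> E})
    (I : choiceType) (K : set U) (x : I -> E) (q : pring I U) :
  alg_indep (iota @` K) x -> pr_coefs K q -> preval iota x q = 0 -> q = 0.
Proof.
move=> h Kq; rewrite /preval /= => e.
have [p [pq pE]] := push_coefs iota (pr_to q).
have p0 : p = 0.
  apply: h => [mu|]; last by rewrite ievalE pE.
  by exists (pr_to q)@_mu => //; apply: Kq.
rewrite -(pr_toK q); suff -> : pr_to q = 0 by rewrite rmorph0.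
apply/malgP => mu; apply: (fmorph_inj iota).
by rewrite -pq p0 !mcoeff0 rmorph0.
Qed.

(* Two differentially independent tuples generate isomorphic extensions: the
   graph of the isomorphism consists of the values of quotients of polynomials *)
Section HomExtension.
Variables (m : nat) (U E : diffField m) (iota : {rmorphism U -> E}) (K : set U).
Variables (J : choiceType) (a : J -> U) (a' : J -> E).
Local Notation I := (J * dop m)%type.
Local Notation P := (pring I U).
Hypotheses (KP : is_diff_subfield K) (iotaD : diff_hom iota).
Hypotheses (a_indep : forall q : P, pr_coefs K q ->
    preval idfun (jets a) q = 0 -> q = 0)
  (a'_indep : forall q : P, pr_coefs K q -> preval iota (jets a') q = 0 -> q = 0).

Local Notation ev := (preval idfun (jets a)).
Local Notation ev' := (preval iota (jets a')).

Let graph (x : U) (y : E) : Prop := exists p q : P,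
  [/\ pr_coefs K p, pr_coefs K q, q != 0, x * ev q = ev p & y * ev' q = ev' p].

Let KF := KP.1.
Let cC := pr_coefsC (I := I) (subfield0 KF).
Let cD := pr_coefsD (I := I) (subfieldD KF).
Let cM := pr_coefsM (I := I) (subfield0 KF) (subfieldD KF) (subfieldM KF).
Let cX := pr_coefsX (I := I) (subfield0 KF) (subfield1 KF).

Let cB p q : pr_coefs K p -> pr_coefs K q -> pr_coefs K (p - q : P).
Proof.
move=> hp hq; rewrite -mulN1r -(rmorph1 (@prC I U)) -rmorphN.
by apply: cD => //; apply: cM => //; apply: cC; apply: (subfieldN KF (subfield1 KF)).
Qed.

Let ev_neq0 q : pr_coefs K q -> q != 0 -> ev q != 0.
Proof. by move=> Kq; apply: contra_neq => /(a_indep Kq). Qed.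

Let ev'_neq0 q : pr_coefs K q -> q != 0 -> ev' q != 0.
Proof. by move=> Kq; apply: contra_neq => /(a'_indep Kq). Qed.

Let mul_neq0 q r : pr_coefs K q -> pr_coefs K r -> q != 0 -> r != 0 -> q * r != 0 :> P.
Proof.
move=> Kq Kr q0 r0; have := mulf_neq0 (ev_neq0 Kq q0) (ev_neq0 Kr r0).
by apply: contra_neq => h; rewrite -rmorphM h rmorph0.
Qed.

Let graph_poly p : pr_coefs K p -> graph (ev p) (ev' p).
Proof.
move=> Kp; exists p, 1; rewrite !rmorph1 !mulr1 oner_neq0; split=> //.
by rewrite -(rmorph1 (@prC I U)); apply: cC; apply: subfield1.
Qed.

Let graphB x y x' y' : graph x y -> graph x' y' -> graph (x - x') (y - y').
Proof.
move=> [p [q [Kp Kq q0 e f]]] [p' [q' [Kp' Kq' q0' e' f']]].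
exists (p * q' - p' * q), (q * q'); split.
- by apply: cB; apply: cM.
- exact: cM.
- exact: mul_neq0.
- by rewrite rmorphB !rmorphM /= -e -e'; ring.
- by rewrite rmorphB !rmorphM /= -f -f'; ring.
Qed.

Let graphM x y x' y' : graph x y -> graph x' y' -> graph (x * x') (y * y').
Proof.
move=> [p [q [Kp Kq q0 e f]]] [p' [q' [Kp' Kq' q0' e' f']]].
exists (p * p'), (q * q'); split.
- exact: cM.
- exact: cM.
- exact: mul_neq0.
- by rewrite !rmorphM /= -e -e'; ring.
- by rewrite !rmorphM /= -f -f'; ring.
Qed.

Let graph0 y : graph 0 y -> y = 0.
Proof.
move=> [p [q [Kp Kq q0 e f]]]; have p0 : p = 0.
  by apply: a_indep => //; rewrite -e mul0r.
move: f => /eqP; rewrite p0 rmorph0 mulf_eq0 (negbTE (ev'_neq0 Kq q0)) orbF.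
by move/eqP.
Qed.

Let graph_uniq x y y' : graph x y -> graph x y' -> y = y'.
Proof.
move=> h h'; apply/eqP; rewrite -subr_eq0; apply/eqP/graph0.
by rewrite -(subrr x); apply: graphB.
Qed.

Let graphV x y : graph x y -> graph x^-1 y^-1.
Proof.
have [->|x0] := eqVneq x 0.
  by move=> /graph0 ->; rewrite !invr0 -(rmorph0 ev) -(rmorph0 ev'); apply: graph_poly;
    rewrite -(rmorph0 (@prC I U)); apply: cC; apply: subfield0.
move=> [p [q [Kp Kq q0 e f]]]; have p0 : p != 0.
  apply: contraNneq (mulf_neq0 x0 (ev_neq0 Kq q0)) => p0.
  by rewrite e p0 rmorph0.
have y0 : y != 0.
  apply: contraNneq (ev'_neq0 Kp p0) => y0.
  by rewrite -f y0 mul0r.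
exists q, p; split=> //; [rewrite -e|rewrite -f]; by rewrite mulKf.
Qed.

Let graph_der i x y : graph x y -> graph (der i x) (der i y).
Proof.
move=> [p [q [Kp Kq q0 e f]]].
have hid : diff_hom (idfun : {rmorphism U -> U}) by [].
exists (mder i p * q - p * mder i q), (q * q); split.
- by apply: cB; apply: cM => //; apply: mder_coefs.
- exact: cM.
- exact: mul_neq0.
- rewrite rmorphB !rmorphM /= !(preval_mder _ _ _ hid) -e derM; ring.
- rewrite rmorphB !rmorphM /= !(preval_mder _ _ _ iotaD) -f derM; ring.
Qed.

Let graph_total x : diff_adjoin K (range a) x -> exists y, graph x y.
Proof.
move: x; apply: diff_adjoin_min.
  split=> [|i x [y h]]; last by exists (der i y); apply: graph_der.
  apply/subfieldP; split.
  - by exists 1; rewrite -(rmorph1 ev) -(rmorph1 ev'); apply: graph_poly;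
      rewrite -(rmorph1 (@prC I U)); apply: cC; apply: subfield1.
  - by move=> x x' [y h] [y' h']; exists (y - y'); apply: graphB.
  - by move=> x x' [y h] [y' h']; exists (y / y'); apply: graphM => //; apply: graphV.
move=> x [Kx|[j _ <-]].
  by exists (iota x); have := graph_poly (cC Kx); rewrite !prevalC.
exists (a' j); have := graph_poly (cX (j, dop0 m)).
by rewrite !prevalX /jets /= !dappE !dapply0.
Qed.

Lemma hom_extension (FP : is_diff_subfield (diff_adjoin K (range a))) :
  exists g : {rmorphism sub_diffField FP -> E}, [/\ diff_hom g,
    forall x, K (sub_val x) -> g x = iota (sub_val x) &
    forall x j, sub_val x = a j -> g x = a' j].
Proof.
have /choice [g gP] : forall x : sub_diffField FP, exists y, graph (sub_val x) y.
  by move=> x; apply: graph_total; apply: sub_valP.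
have gB : zmod_morphism g.
  move=> x y; apply: graph_uniq (gP _) _; rewrite rmorphB; exact: (graphB (gP _) (gP _)).
have g1 : monoid_morphism g.
  split=> [|x y]; last by apply: graph_uniq (gP _) _; rewrite rmorphM; exact: (graphM (gP _) (gP _)).
  apply: graph_uniq (gP _) _; rewrite rmorph1 -(rmorph1 ev) -(rmorph1 ev').
  by apply: graph_poly; rewrite -(rmorph1 (@prC I U)); apply: cC; apply: subfield1.
pose g' : {rmorphism sub_diffField FP -> E} := HB.pack g
  (GRing.isZmodMorphism.Build _ _ g gB) (GRing.isMonoidMorphism.Build _ _ g g1).
exists g'; split=> [i x|x Kx|x j xj] /=; apply: graph_uniq (gP _) _.
- by rewrite sub_val_hom; exact: (graph_der _ (gP _)).
- by have := graph_poly (cC Kx); rewrite !prevalC.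
- rewrite xj; have := graph_poly (cX (j, dop0 m)).
  by rewrite !prevalX /jets /= !dappE !dapply0.
Qed.

End HomExtension.

Section SubfieldMaps.
Variables (m : nat) (E : diffField m) (S : set E) (SP : is_diff_subfield S).

Lemma corestriction (F : diffField m) (g : {rmorphism F -> E}) : diff_hom g ->
  (forall x, S (g x)) -> exists g' : {rmorphism F -> sub_diffField SP},
    diff_hom g' /\ forall x, sub_val (g' x) = g x.
Proof.
move=> gD gS; have /choice [g' gP] : forall x, exists y : sub_diffField SP, sub_val y = g x.
  by move=> x; apply: sub_valK.
have gB : zmod_morphism g'.
  move=> x y; apply: sub_val_inj.
  by rewrite gP (rmorphB g) (rmorphB (@sub_val _ _ _ SP)) /= !gP.
have g1 : monoid_morphism g'.
  split=> [|x y]; apply: sub_val_inj; first by rewrite gP !rmorph1.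
  by rewrite gP (rmorphM g) (rmorphM (@sub_val _ _ _ SP)) /= !gP.
pose h : {rmorphism F -> sub_diffField SP} := HB.pack g'
  (GRing.isZmodMorphism.Build _ _ g' gB) (GRing.isMonoidMorphism.Build _ _ g' g1).
exists h; split=> // i x; apply: sub_val_inj.
by rewrite sub_val_hom /= !gP gD.
Qed.

Lemma sub_generated (A : set E) (s : seq E) (A' : set (sub_diffField SP))
    (s' : seq (sub_diffField SP)) : S = diff_adjoin A [set` s] ->
  (forall x, A x -> exists2 y, A' y & sub_val y = x) ->
  (forall x, x \in s -> exists2 y, y \in s' & sub_val y = x) ->
  diff_adjoin A' [set` s'] = setT.
Proof.
move=> SE hA hs; apply/seteqP; split=> // x _.
have TP := diff_adjoinP A' [set` s'].
suff h : S `<=` @sub_val _ _ _ SP @` diff_adjoin A' [set` s'].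
  by have [y hy /sub_val_inj <-] := h _ (sub_valP x).
rewrite [X in X `<=` _]SE; apply: diff_adjoin_min.
  split; last first.
    by move=> i _ [y hy <-]; exists (der i y); [apply: TP.2|rewrite sub_val_hom].
  apply/subfieldP; split.
  - by exists 1; [apply: (subfield1 TP.1)|rewrite rmorph1].
  - move=> _ _ [y hy <-] [z hz <-]; exists (y - z); last by rewrite rmorphB.
    exact: (subfieldB TP.1).
  - move=> _ _ [y hy <-] [z hz <-]; exists (y / z); last by rewrite fmorph_div.
    exact: (subfield_div TP.1).
move=> z [/hA|/hs] [y hy <-]; exists y => //; apply: sub_diff_adjoin.
  by left.
by right.
Qed.

End SubfieldMaps.

(** * The generic point of a hypersurface section *)

Section DiffFieldMorphisms.
Variables (m : nat) (U E : diffField m) (f : {rmorphism U -> E}).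

Lemma image_subfield (K : set U) : is_subfield K -> is_subfield (f @` K).
Proof.
move=> KF; apply/subfieldP; split.
- by exists 1; [apply: subfield1|rewrite rmorph1].
- move=> _ _ [x Kx <-] [y Ky <-]; exists (x - y); last by rewrite rmorphB.
  exact: (subfieldB KF).
- move=> _ _ [x Kx <-] [y Ky <-]; exists (x / y); last by rewrite fmorph_div.
  exact: (subfield_div KF).
Qed.

Lemma range_diff_subfield : diff_hom f -> is_diff_subfield (range f).
Proof.
move=> fD; split; last by move=> i _ [x _ <-]; exists (der i x) => //; rewrite fD.
by apply: image_subfield; apply/subfieldP; split.
Qed.

End DiffFieldMorphisms.

Section Hypersurface.
Variables (m n h r : nat) (U : diffField m) (K : set U) (f : dpoly U n).
Hypotheses (KP : is_diff_subfield K) (r_gt0 : (0 < r)%N)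
  (f_generic : generic_dpoly K h r f).
Local Notation mon := {cmonom (dvar m n)}.

Definition coordinate (b : 'rV[U]_n) (i : 'I_n) : U := b 0 i.

Lemma devalE (p : dpoly U n) b : deval p b = peval idfun (jets (coordinate b)) p.
Proof. by rewrite -ievalE. Qed.

Definition monval b (mu : mon) : U := moneval (jets (coordinate b)) mu.

Lemma deval_monom b mu : deval << mu >> b = monval b mu.
Proof. by rewrite devalE peval.unlock mmapU /= mul1r. Qed.

Lemma deval_msupp (p : dpoly U n) b :
  deval p b = \sum_(mu <- msupp p) p@_mu * monval b mu.
Proof. by rewrite devalE peval.unlock mmapE. Qed.

Definition hmon := {mu : mon | dmonom_le h r mu}.
Definition hcoef (mu : hmon) : U := f@_(val mu).

Lemma hcoef_indep : alg_indep K (jets hcoef).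
Proof. exact: f_generic.2. Qed.

Lemma pvar_neq0 (R : comNzRingType) (I : choiceType) (i : I) :
  ('V_i : {malg R[{cmonom I}]}) != 0.
Proof.
apply/eqP => /(congr1 (peval idfun (fun=> 1))); rewrite pevalX rmorph0.
by move/eqP; rewrite oner_eq0.
Qed.

(** A zero coefficient would be a relation among independent elements. Hence the support of [f] is a
    finite enumeration of all monomials allowed by [h] and [r]. *)
Lemma msupp_generic mu : (mu \in msupp f) = dmonom_le h r mu.
Proof.
apply/idP/idP => [|hmu].
  by apply: contraTT => /f_generic.1; rewrite -mcoeff_eq0 => ->; rewrite eqxx.
rewrite -mcoeff_neq0; apply/eqP => f0.
have /eqP := pvar_neq0 U ((exist _ mu hmu : hmon), dop0 m); apply.
apply: hcoef_indep.
  exact: (coefs_inX (subfield0 KP.1) (subfield1 KP.1)).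
by rewrite ievalE pevalX /jets /= dappE dapply0.
Qed.

Lemma hcoeffs_range : hcoeffs h r f = range hcoef.
Proof.
apply/seteqP; split=> z; first by case=> mu hmu <-; exists (exist _ mu hmu).
by case=> -[mu hmu] _ <-; exists mu.
Qed.

(** The indices of [a']: the constant coefficient is left out because the equation is solved for
    it. *)
Definition pmons : seq mon := [seq mu <- msupp f | mu != mone].

Lemma mone_msupp : mone \in msupp f.
Proof. by rewrite msupp_generic /dmonom_le mdom1 mdeg1 andbT; apply/allP. Qed.

Lemma pmons_uniq : uniq pmons.
Proof. by rewrite filter_uniq // fset_uniq. Qed.

Lemma mem_pmons mu : (mu \in pmons) = (mu \in msupp f) && (mu != mone).
Proof. by rewrite mem_filter andbC. Qed.

Lemma pmons_le mu : mu \in pmons -> dmonom_le h r mu.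
Proof. by rewrite mem_pmons => /andP[]; rewrite msupp_generic. Qed.

Lemma deval_generic b :
  deval f b = f@_mone + \sum_(mu <- pmons) f@_mu * monval b mu.
Proof.
rewrite deval_msupp (bigD1_seq mone) ?fset_uniq ?mone_msupp //= big_filter.
by congr (_ + _); rewrite /monval /moneval mdom1 big_seq_fset0 mulr1.
Qed.

Definition pmon := {mu : mon | (mu \in msupp f) && (mu != mone)}.
Definition pcoef (mu : pmon) : U := f@_(val mu).

Lemma linear_pmons i th : (dord th <= h)%N -> ucm (i, th) \in pmons.
Proof.
move=> hth; rewrite mem_pmons msupp_generic cm1_eq1 andbT /dmonom_le mdegU r_gt0 andbT.
by apply/allP => v; rewrite mdomU in_fset1 => /eqP ->.
Qed.

Lemma monval_ucm b i th : monval b (ucm (i, th)) = dapp th (b 0 i).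
Proof. by rewrite /monval monevalU. Qed.

Hypothesis U_universal : universal_over K.

(** Besides the vanishing of [f], the conclusion keeps what is needed later: equivalence with [b]
    over [K], and the independence of [a'] over K<b1>, on which both the specialization and the rank
    count rest. *)
Lemma generic_intersection_point b i0 :
  (forall th, ~ leader (@nat_of_ord n) K (coordinate b) (i0, th)) ->
  exists b1, [/\ forall p, ipoly_over K p -> (deval p b1 = 0 <-> deval p b = 0),
    deval f b1 = 0 & alg_indep (diff_adjoin K (coords b1)) (jets pcoef)].
Proof.
move=> nl; have KF := KP.1.
have [E0 [iota [A [iotaD A_indep]]]] := generic_extension U mon.
have LP := range_diff_subfield iotaD.
pose M := iota @` K; have MF : is_subfield M by apply: image_subfield.
have ML : M `<=` range iota by move=> _ [x _ <-]; exists x.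
pose e mu := iota (monval b mu).
pose j0 : mon := ucm (i0, dop0 m).
have d0 : (dord (dop0 m) <= h)%N by rewrite /dord big1 // => i _; rewrite ffunE.
have e_indep : alg_indep M (fun th : dop m => dapp th (e j0)).
  have /(alg_indepP _ KF) h1 : findep K (fun th : dop m => dapp th (b 0 i0)).
    by apply: (leaderless_findep (g := id) (@ord_inj n) nl) => // z; left.
  have := alg_indep_morph (iota := iota) h1; congr (alg_indep M _); apply: funext => th /=.
  by rewrite /e monval_ucm [dapp (dop0 m) _]dappE dapply0 dapp_hom.
pose a0 := - \sum_(mu <- pmons) A mu * e mu.
have ind := generic_combination_indep (D := pmons) (e := e) (j0 := j0) (g := id)
  MF LP ML A_indep (fun mu => ex_intro2 _ _ (monval b mu) I erefl)
  pmons_uniq (linear_pmons i0 d0) e_indep.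
pose astar (mu : hmon) := if val mu == mone then a0 else A (val mu).
have astar_indep : alg_indep M (jets astar).
  apply/(alg_indepP _ MF).
  (* The constant coefficient takes its jets from the combination, every other one from [A]. *)
  pose rho (v : hmon * dop m) : (mon * dop m) + dop m :=
    if val v.1 == mone then inr v.2 else inl (val v.1, v.2).
  have rho_inj : injective rho.
    move=> [mu th] [nu et]; rewrite /rho /=.
    case: eqP => [e1|_]; case: eqP => [e2|_] // => -[].
      by move=> ->; congr (_, _); apply: val_inj; exact: etrans e1 (esym e2).
    by move=> e1 ->; congr (_, _); apply: val_inj.
  have := findep_reindex rho_inj ((alg_indepP _ MF).1 ind).
  congr (findep M _); apply: funext => -[mu th] /=.
  by rewrite /rho /jets /astar /=; case: eqP.
have FP := diff_adjoinP K (range hcoef).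
(* Both tuples are differentially independent over [K], so K<a> maps into [E0] with the given
   coefficients going to [astar]. *)
have [g [gD gK ga]] := hom_extension (iota := iota) (a := hcoef) (a' := astar) KP iotaD
  (fun q => alg_indep_pr (q := q) hcoef_indep)
  (fun q => alg_indep_push (q := q) astar_indep) FP.
pose F := sub_diffField FP.
pose s0 := [seq iota (b 0 i) | i <- enum 'I_n] ++ [seq A mu | mu <- pmons].
have SP := diff_adjoinP (range g) [set` s0].
have [|g' [g'D g'E]] := corestriction SP gD.
  by move=> x; apply: sub_diff_adjoin; left; exists x.
pose E := sub_diffField SP.
(* Outside the field the value 0 is a mere default; only values on [s0] matter. *)
have /choice [lift liftP] : forall x : E0, exists y : E,
    diff_adjoin (range g) [set` s0] x -> sub_val y = x.
  move=> x; have [/(sub_valK SP) [y yx]|nx] := pselect (diff_adjoin (range g) [set` s0] x).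
    by exists y.
  by exists 0.
have lift_s0 x : x \in s0 -> sub_val (lift x) = x.
  by move=> xs; apply: liftP; apply: sub_diff_adjoin; right.
(* The embedding back into [U] is over K<a>: the coefficients of [f] return to their given values,
   while the image of [b] becomes [b1]. *)
have [||||j jD jg] := U_universal (f := @sub_val _ _ _ FP) (g := g').
- exact: sub_val_hom.
- exact: g'D.
- exists [seq f@_mu | mu <- msupp f].
  transitivity (diff_adjoin K (range hcoef)).
    apply/seteqP; split=> [_ [x _ <-]|x]; first exact: sub_valP.
    by move=> /(sub_valK FP) [y <-]; exists y.
  congr (diff_adjoin K _); apply/seteqP; split=> z.
    by case=> mu _ <-; apply/mapP; exists (val mu) => //; rewrite msupp_generic; apply: (svalP mu).
  by move=> /mapP[mu]; rewrite msupp_generic => hmu ->; exists (exist _ mu hmu).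
- exists [seq lift x | x <- s0].
  apply: (@sub_generated _ _ _ SP (range g) s0) => // x.
    by case=> y _ <-; exists (g' y) => //; exists y.
  by move=> xs; exists (lift x); [apply: map_f|apply: lift_s0].
have jK k (y : E) : K k -> sub_val y = iota k -> j y = k.
  move=> Kk yk; have [|x xk] := sub_valK FP (x := k).
    by apply: sub_diff_adjoin; left.
  have -> : y = g' x by apply: sub_val_inj; rewrite g'E gK xk.
  by rewrite jg.
have ja mu (y : E) : sub_val y = astar mu -> j y = hcoef mu.
  move=> ymu; have [|x xk] := sub_valK FP (x := hcoef mu).
    by apply: sub_diff_adjoin; right; exists mu.
  have -> : y = g' x by apply: sub_val_inj; rewrite g'E (ga _ _ xk).
  by rewrite jg.
pose beta i := lift (iota (b 0 i)).
have betaE i : sub_val (beta i) = iota (b 0 i).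
  apply: lift_s0; rewrite mem_cat; apply/orP; left.
  by apply/mapP; exists i => //; rewrite mem_enum.
pose alpha mu := lift (A mu).
have alphaE mu : mu \in pmons -> sub_val (alpha mu) = A mu.
  move=> hmu; apply: lift_s0; rewrite mem_cat; apply/orP; right.
  by apply/mapP; exists mu.
have alphaj mu : mu \in pmons -> j (alpha mu) = f@_mu.
  move=> hmu; apply: (ja (exist _ mu (pmons_le hmu))).
  rewrite alphaE // /astar /=; case: eqP => // e1.
  by move: hmu; rewrite mem_pmons e1 eqxx andbF.
pose b1 : 'rV[U]_n := \row_i j (beta i).
(* The values of [p] at [b] and at [b1] come from one element of [E] under injective maps, so they
   vanish together. *)
have rel p : ipoly_over K p -> exists2 y : E,
    sub_val y = iota (deval p b) & j y = deval p b1.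
  move=> Kp; rewrite !devalE; have : vars_in setT p by [].
  move: p Kp; apply: ipoly_ind_over.
  - by exists 0; rewrite !rmorph0.
  - by exists 1; rewrite !rmorph1.
  - move=> c Kc; rewrite !pevalC; have [|x xc] := sub_valK FP (x := c).
      by apply: sub_diff_adjoin; left.
    by exists (g' x); rewrite ?jg // g'E gK xc.
  - move=> [i th] _; rewrite !pevalX /jets /coordinate /=; exists (dapp th (beta i)).
      by rewrite (dapp_hom (@sub_val_hom _ _ _ SP)) /= betaE dapp_hom.
    by rewrite (dapp_hom jD) mxE.
  - move=> p q [y y1 y2] [z z1 z2]; exists (y + z); rewrite !rmorphD /=.
      by rewrite y1 z1.
    by rewrite y2 z2.
  - move=> p q [y y1 y2] [z z1 z2]; exists (y * z); rewrite !rmorphM /=.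
      by rewrite y1 z1.
    by rewrite y2 z2.
exists b1; split.
- move=> p Kp; have [y y1 y2] := rel p Kp; split=> e0.
    apply: (fmorph_inj iota); rewrite rmorph0 -y1.
    suff -> : y = 0 by rewrite rmorph0.
    by apply: (fmorph_inj j); rewrite rmorph0 y2.
  rewrite -y2; suff -> : y = 0 by rewrite rmorph0.
  by apply: sub_val_inj; rewrite y1 e0 !rmorph0.
- have /choice [em emP] : forall mu, exists y : E,
      sub_val y = e mu /\ j y = monval b1 mu.
    move=> mu; have [|y y1 y2] := rel << mu >>; last first.
      by exists y; rewrite y1 y2 !deval_monom.
    by move=> nu; rewrite mcoeffU1; apply: (subfield_nat KF).
  pose y0 := - \sum_(mu <- pmons) alpha mu * em mu.
  have y0E : sub_val y0 = a0.
    rewrite rmorphN rmorph_sum /= /a0; congr (- _); apply: eq_big_seq => mu hmu.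
    by rewrite rmorphM /= alphaE // (emP mu).1.
  have h1 : dmonom_le h r (mone : mon) by rewrite -msupp_generic mone_msupp.
  have jy0 : j y0 = f@_mone.
    by apply: (ja (exist _ (mone : mon) h1)); rewrite y0E /astar eqxx.
  rewrite deval_generic -jy0 rmorphN rmorph_sum /=.
  rewrite [X in _ + X = _](_ : _ = \sum_(mu <- pmons) j (alpha mu * em mu)) ?addNr //.
  by apply: eq_big_seq => mu hmu; rewrite rmorphM /= alphaj // (emP mu).2.
(* [T] is the image under [j] of the part of [E] inside the copy of [U]. It contains K<b1>, and [A]
   is independent over that copy. *)
- pose T := [set z | exists2 y : E, j y = z & range iota (sub_val y)].
  have RF := LP.1.
  have TP : is_diff_subfield T.
    split; last first.
      move=> i _ [y <- yr]; exists (der i y); first by rewrite jD.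
      by rewrite sub_val_hom; apply: LP.2.
    apply/subfieldP; split.
    + by exists 1; rewrite ?rmorph1 //; apply: (subfield1 RF).
    + move=> _ _ [y <- yr] [z <- zr]; exists (y - z); rewrite ?rmorphB //.
      exact: (subfieldB RF).
    + move=> _ _ [y <- yr] [z <- zr]; exists (y / z); rewrite ?fmorph_div //.
      exact: (subfield_div RF).
  have KT : diff_adjoin K (coords b1) `<=` T.
    apply: diff_adjoin_min => // z [Kz|[i _ <-]].
      have [|x xk] := sub_valK FP (x := z); first by apply: sub_diff_adjoin; left.
      by exists (g' x); [rewrite jg|rewrite g'E gK xk //; exists z].
    exists (beta i); first by rewrite mxE.
    by rewrite betaE; exists (b 0 i).
  move=> p Tp; rewrite ievalE => pe.
  have [|q [qp qE]] := @lift_coefs _ _ _ j p.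
    by move=> mu; case: (KT _ (Tp mu)) => y <- _; exists y.
  pose al (mu : pmon) := alpha (val mu).
  have q0 : peval idfun (jets al) q = 0.
    apply: (fmorph_inj j); rewrite rmorph0 morph_peval -[RHS]pe -(qE _ idfun).
    apply: eq_peval => // -[mu th]; rewrite /jets /= (dapp_hom jD) alphaj //.
    by rewrite mem_pmons; apply: (svalP mu).
  have [q' [qq' qE']] := push_coefs (@sub_val _ _ _ SP) q.
  have q'0 : q' = 0.
    have fi : alg_indep (range iota) (jets (fun mu : pmon => A (val mu))).
      apply/(alg_indepP _ RF).
      have := findep_reindex (g := fun v : pmon * dop m => (val v.1, v.2)) _
        ((alg_indepP _ RF).1 A_indep).
      by apply=> -[mu th] [nu et] [/val_inj -> ->].
    apply: fi => [mu|].
      rewrite qq'; case: (KT _ (Tp mu)) => y yp yr.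
      suff <- : y = q@_mu by [].
      by apply: (fmorph_inj j); rewrite yp qp.
    rewrite ievalE qE'; have := congr1 (@sub_val _ _ _ SP) q0.
    rewrite rmorph0 morph_peval => <-; apply: eq_peval => // -[mu th].
    rewrite /jets /= (dapp_hom (@sub_val_hom _ _ _ SP)) /= alphaE //.
    by rewrite mem_pmons; apply: (svalP mu).
  apply/malgP => mu; rewrite mcoeff0 -qp; suff -> : q@_mu = 0 by rewrite rmorph0.
  by apply: sub_val_inj; rewrite -qq' q'0 mcoeff0 rmorph0.
Qed.

End Hypersurface.

(** * Points satisfying the same equations over the base field *)

Section Transfer.
Variables (m n : nat) (U : diffField m) (K : set U).
Hypothesis KF : is_subfield K.
Implicit Types b : 'rV[U]_n.

(** Turns a relation between chosen jets into a differential polynomial, to which hypotheses about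
    vanishing at points apply. *)
Definition relabel (I : choiceType) (rho : I -> dvar m n) (p : ipoly U I) : dpoly U n :=
  peval pconst (fun i => 'V_(rho i)) p.

Lemma relabel_over (I : choiceType) (rho : I -> dvar m n) p :
  ipoly_over K p -> ipoly_over K (relabel rho p).
Proof.
move=> Kp; have : vars_in setT p by [].
move: p Kp; apply: ipoly_ind_over.
- by rewrite /relabel rmorph0 => mu; rewrite mcoeff0; apply: subfield0.
- rewrite /relabel rmorph1 -pconst1.
  exact: (coefs_inC (subfield0 KF) (subfield1 KF)).
- by move=> c Kc; rewrite /relabel pevalC; apply: (coefs_inC (subfield0 KF)).
- move=> i _; rewrite /relabel pevalX.
  exact: (coefs_inX (subfield0 KF) (subfield1 KF)).
- by move=> p q hp hq; rewrite /relabel rmorphD; apply: (coefs_inD (subfieldD KF)).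
- move=> p q hp hq; rewrite /relabel rmorphM.
  exact: (coefs_inM (subfield0 KF) (subfieldD KF) (subfieldM KF)).
Qed.

Lemma deval_relabel (I : choiceType) (rho : I -> dvar m n) p b :
  deval (relabel rho p) b = peval idfun (jets (coordinate b) \o rho) p.
Proof.
rewrite devalE /relabel; move: p; apply: ipoly_ind => [c|i|p q hp hq|p q hp hq].
- by rewrite !pevalC.
- by rewrite !pevalX.
- by rewrite !rmorphD /= hp hq.
- by rewrite !rmorphM /= hp hq.
Qed.

Variables b b' : 'rV[U]_n.
Hypothesis bb' : forall p, ipoly_over K p -> (deval p b = 0 <-> deval p b' = 0).

Lemma alg_indep_transfer (I : choiceType) (rho : I -> dvar m n) :
  alg_indep K (jets (coordinate b) \o rho) -> alg_indep K (jets (coordinate b') \o rho).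
Proof.
move=> h p Kp; rewrite ievalE -deval_relabel => /(bb' (relabel_over rho Kp)).2.
by rewrite deval_relabel -ievalE; apply: h.
Qed.

Lemma indep_transfer (s : seq (dvar m n)) : uniq s ->
  indep K [seq jets (coordinate b) v | v <- s] ->
  indep K [seq jets (coordinate b') v | v <- s].
Proof.
move=> us hs; pose I := {v : dvar m n | v \in s}.
have us' : {in s &, injective (jets (coordinate b))}.
  have um : uniq [seq jets (coordinate b) v | v <- s] by case/indepP: hs.
  move=> v w vs ws e; have [vi wi] : (index v s < size s)%N /\ (index w s < size s)%N.
    by rewrite !index_mem.
  have /eqP : nth 0 [seq jets (coordinate b) v | v <- s] (index v s) =
      nth 0 [seq jets (coordinate b) v | v <- s] (index w s).
    by rewrite !(nth_map v) // !nth_index.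
  by rewrite nth_uniq ?size_map // => /eqP /index_inj ->.
have /(alg_indepP _ KF) h : findep K (jets (coordinate b) \o (val : I -> dvar m n)).
  apply/findepP => t ut; apply: indep_subset hs; last first.
    by move=> z /mapP[v _ ->]; apply: map_f; apply: (svalP v).
  rewrite map_inj_in_uniq // => v w _ _ /= /us' e; apply: val_inj.
  by apply: e; [apply: (svalP v)|apply: (svalP w)].
have /(alg_indepP _ KF)/findepP h' := alg_indep_transfer h.
have [t tE] : exists t : seq I, map val t = s.
  exists (pmap insub s); rewrite pmap_filter; last exact: insubK.
  by apply/all_filterP/allP => v vs; rewrite insubT.
have ut : uniq t by rewrite -(map_inj_uniq val_inj) tE.
by have := h' t ut; rewrite map_comp tE.
Qed.

End Transfer.

Section ClosureTransfer.
Variables (m n : nat) (U : diffField m) (K : set U).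
Hypothesis KF : is_subfield K.
Variables b b' : 'rV[U]_n.
Hypothesis bb' : forall p, ipoly_over K p -> (deval p b = 0 <-> deval p b' = 0).

(** Dependence on [A] reduces to an independent finite list [s] of jets such that [v :: s] is
    dependent. Independence of finite lists passes between the two points in both directions. *)
Lemma cl_transfer (A : set (dvar m n)) v :
  cl (K `|` jets (coordinate b) @` A) (jets (coordinate b) v) ->
  cl (K `|` jets (coordinate b') @` A) (jets (coordinate b') v).
Proof.
move=> /finite_subfamily [t [ut tA ht]].
have [vt|vt] := boolP (v \in t).
  by apply: sub_cl; right; exists v => //; apply: tA.
have [s [st si ts _]] := ordered_basis (jets (coordinate b)) K t.
have us : uniq (v :: s).
  rewrite /= (subseq_uniq st ut) andbT.
  by apply: contraNN vt => /(mem_subseq st).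
have sb' := indep_transfer KF bb' (subseq_uniq st ut) si.
have : ~ indep K [seq jets (coordinate b') w | w <- v :: s].
  have b'b p : ipoly_over K p -> (deval p b' = 0 <-> deval p b = 0).
    by move=> Kp; split=> /(bb' Kp).
  move=> /(indep_transfer KF b'b us) /= [nv _]; apply: nv.
  apply: cl_sub ht => z [Kz|/ts //]; by apply: sub_cl; left.
move=> nind; apply: contrapT => h; apply: nind; split=> // h'; apply: h.
apply: cl_mono h' => z [|/= /mapP[w ws ->]]; first by left.
by right; exists w => //; apply: tA; apply: (mem_subseq st).
Qed.

End ClosureTransfer.

Lemma dvars_le (m n t : nat) : exists T : seq (dvar m n),
  forall v, (v \in T) = (dord v.2 <= t)%N.
Proof.
pose emb (x : 'I_n * {ffun 'I_m -> 'I_t.+1}) : dvar m n := (x.1, [ffun i => x.2 i : nat]).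
exists [seq v <- [seq emb x | x <- enum {: 'I_n * {ffun 'I_m -> 'I_t.+1}}] | (dord v.2 <= t)%N].
case=> j th; rewrite mem_filter /=; case: leqP => //= hth.
have hi i : (th i < t.+1)%N.
  by rewrite ltnS; apply: leq_trans hth; rewrite /dord (bigD1 i) //= leq_addr.
apply/mapP; exists (j, [ffun i => Ordinal (hi i)]); first by rewrite mem_enum.
by congr (_, _); apply/ffunP => i; rewrite !ffunE.
Qed.

(** A transcendence basis need not consist of jets. It is replaced by a basis of jets, of equal
    length by Steinitz, whose list of indices makes sense at [b']. *)
Lemma trdeg_transfer (m n t k : nat) (U : diffField m) (K : set U) (b b' : 'rV[U]_n) :
  is_subfield K ->
  (forall p, ipoly_over K p -> (deval p b = 0 <-> deval p b' = 0)) ->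
  is_trdeg K (adjoin K (jet t b)) k -> is_trdeg K (adjoin K (jet t b')) k.
Proof.
move=> KF bb' /(trdeg_basis KF) [s [si sS Ss sk]]; apply/(trdeg_basis KF).
have [T0 T0P] := dvars_le m n t; pose T := undup T0.
have TP v : (v \in T) = (dord v.2 <= t)%N by rewrite mem_undup.
have jetE (c : 'rV[U]_n) : jet t c = [set` [seq jets (coordinate c) v | v <- T]].
  apply/seteqP; split=> z /=; first by case=> v hv <-; apply: map_f; rewrite TP.
  by move=> /mapP[v]; rewrite TP => hv ->; exists v.
have [u [uT ui Tu _]] := ordered_basis (jets (coordinate b)) K T.
have uu : uniq u := subseq_uniq uT (undup_uniq _).
exists [seq jets (coordinate b') v | v <- u]; split.
- exact: indep_transfer ui.
- move=> z /= /mapP[v vu ->]; apply: sub_fld; right.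
  by exists v => //=; rewrite -TP (mem_subseq uT).
- move=> z [v hv <-].
  have : cl (K `|` jets (coordinate b) @` [set` u]) (jets (coordinate b) v).
    have : [set` [seq jets (coordinate b) v | v <- T]] (jets (coordinate b) v).
      by apply: map_f; rewrite TP.
    move=> /Tu; apply: cl_mono => w [|/= /mapP[x xu ->]]; first by left.
    by right; exists x.
  move=> /(cl_transfer KF bb'); apply: cl_mono => w [|[x xu <-]]; first by left.
  by right; apply: map_f.
- rewrite size_map -sk; apply/eqP; rewrite eqn_leq; apply/andP; split.
    rewrite -(size_map (jets (coordinate b))); apply: steinitz ui _.
    move=> z /= /mapP[v vu ->]; apply: Ss; exists v => //=.
    by rewrite -TP (mem_subseq uT).
  rewrite -(size_map (jets (coordinate b))); apply: steinitz si _.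
  move=> z /sS; apply: fld_cl_sub => w [Kw|]; first by apply: sub_cl; left.
  by rewrite jetE => /Tu.
Qed.

(* A relation among the coefficients of [f], the point [b1] and its derivatives
   persists at every other point [y] of the hypersurface section: eliminate the
   constant coefficient, then compare coefficients of the remaining generic ones *)
Section Specialization.
Variables (m n h r : nat) (U : diffField m) (K : set U) (f : dpoly U n).
Hypotheses (KP : is_diff_subfield K) (f_generic : generic_dpoly K h r f).
Variables b1 y : 'rV[U]_n.
Hypotheses (spec : forall p, ipoly_over K p -> deval p b1 = 0 -> deval p y = 0)
  (fb1 : deval f b1 = 0) (fy : deval f y = 0)
  (indep_b1 : alg_indep (diff_adjoin K (coords b1)) (jets (@pcoef m n U f))).

Let I := (pmon f * dop m)%type.
Let N := ('I_n * dop m)%type.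
Let P := pring I U.
Let KF := KP.1.
Let hid : diff_hom (idfun : {rmorphism U -> U}). Proof. by []. Qed.

(** The graph of the specialization from [b1] to [y]: values of one polynomial over [K] at both
    points. A relation avoids constructing a map on the ring of values. *)
Let srel (z z' : U) : Prop := exists2 p : pring N U, pr_coefs K p &
  preval idfun (jets (coordinate b1)) p = z /\ preval idfun (jets (coordinate y)) p = z'.

Let srelC c : K c -> srel c c.
Proof.
move=> Kc; exists (prC N c); first exact: (pr_coefsC (subfield0 KF)).
by rewrite !prevalC.
Qed.

Let srelX v : srel (jets (coordinate b1) v) (jets (coordinate y) v).
Proof.
exists (prX U v); last by rewrite !prevalX.
exact: (pr_coefsX (subfield0 KF) (subfield1 KF)).
Qed.

Let srelD z z' w w' : srel z z' -> srel w w' -> srel (z + w) (z' + w').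
Proof.
move=> [p Kp [<- <-]] [q Kq [<- <-]]; exists (p + q); last by rewrite !rmorphD.
exact: (pr_coefsD (subfieldD KF)).
Qed.

Let srelM z z' w w' : srel z z' -> srel w w' -> srel (z * w) (z' * w').
Proof.
move=> [p Kp [<- <-]] [q Kq [<- <-]]; exists (p * q); last by rewrite !rmorphM.
exact: (pr_coefsM (subfield0 KF) (subfieldD KF) (subfieldM KF)).
Qed.

Let srel_der i z z' : srel z z' -> srel (der i z) (der i z').
Proof.
move=> [p Kp [<- <-]]; exists (mder i p); first exact: mder_coefs.
by rewrite !(preval_mder _ _ _ hid).
Qed.

Let srel0 z' : srel 0 z' -> z' = 0.
Proof.
move=> [p Kp [e <-]]; have := spec Kp; rewrite !devalE; apply; exact: e.
Qed.

Let srel_mon mu : srel (monval b1 mu) (monval y mu).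
Proof.
exists (pr_of << mu >>).
  by rewrite /pr_coefs pr_ofK => nu; rewrite mcoeffU1; apply: (subfield_nat KF).
by rewrite /preval /= pr_ofK -!devalE !deval_monom.
Qed.

Let srel_b1 z z' : srel z z' -> diff_adjoin K (coords b1) z.
Proof.
have LP := diff_adjoinP K (coords b1).
move=> [p Kp [<- _]]; apply: (coefs_preval LP.1) => [mu|[i th]].
  by apply: sub_diff_adjoin; left.
by apply: (diff_subfield_dapp _ LP); apply: sub_diff_adjoin; right; exists i.
Qed.

(** Pairs of polynomials in the jets of [a'] whose coefficients correspond under the specialization.
    The inductive form makes stability under derivations immediate; [coef_relP] recovers the
    comparison of coefficients. *)
Inductive coef_rel : P -> P -> Prop :=
| coef_relC z z' of srel z z' : coef_rel (prC I z) (prC I z')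
| coef_relX v : coef_rel (prX U v) (prX U v)
| coef_relD p p' q q' of coef_rel p p' & coef_rel q q' : coef_rel (p + q) (p' + q')
| coef_relM p p' q q' of coef_rel p p' & coef_rel q q' : coef_rel (p * q) (p' * q').

Let coef_rel_der i p p' : coef_rel p p' -> coef_rel (mder i p) (mder i p').
Proof.
elim=> [z z' h'|v|q q' s s' hq1 hq hs1 hs|q q' s s' hq1 hq hs1 hs].
- by rewrite !mderC; apply: coef_relC; apply: srel_der.
- by rewrite mderX; apply: coef_relX.
- by rewrite !mderD; apply: coef_relD.
- by rewrite !mderM; apply: coef_relD; apply: coef_relM.
Qed.

Let coef_relP p p' : coef_rel p p' ->
  forall mu, srel (pr_to p)@_mu (pr_to p')@_mu.
Proof.
have s0 : srel 0 0 by apply: srelC; apply: subfield0.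
have s1 : srel 1 1 by apply: srelC; apply: subfield1.
have toD (u v : P) : pr_to (u + v) = pr_to u + pr_to v by apply: rmorphD.
have toM (u v : P) : pr_to (u * v) = pr_to u * pr_to v by apply: rmorphM.
elim=> [z z' h' mu|v mu|q q' s s' _ hq _ hs mu|q q' s s' _ hq _ hs mu].
- by rewrite /prC /= !pr_ofK !mcoeff_pconst; case: ifP.
- by rewrite /prX pr_ofK mcoeff_pvar; case: ifP.
- by rewrite !toD !mcoeffD; apply: srelD; [apply: hq|apply: hs].
- rewrite !toM; exact: mcoeffM_rel s0 srelD srelM hq hs mu.
Qed.

Let ev : P -> U := preval idfun (jets (@pcoef m n U f)).

(** The specialization extended to elements that also involve [a'], which stays fixed. *)
Let grel (x x' : U) : Prop := exists q q', [/\ coef_rel q q', x = ev q & x' = ev q'].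

Let grel_srel z z' : srel z z' -> grel z z'.
Proof.
by move=> hz; exists (prC I z), (prC I z'); rewrite /ev !prevalC; split=> //; apply: coef_relC.
Qed.

Let grelD x x' z z' : grel x x' -> grel z z' -> grel (x + z) (x' + z').
Proof.
move=> [p [p' [hp -> ->]]] [q [q' [hq -> ->]]].
by exists (p + q), (p' + q'); rewrite /ev !rmorphD; split=> //; apply: coef_relD.
Qed.

Let grelM x x' z z' : grel x x' -> grel z z' -> grel (x * z) (x' * z').
Proof.
move=> [p [p' [hp -> ->]]] [q [q' [hq -> ->]]].
by exists (p * q), (p' * q'); rewrite /ev !rmorphM; split=> //; apply: coef_relM.
Qed.

Let grel_der i x x' : grel x x' -> grel (der i x) (der i x').
Proof.
move=> [p [p' [hp -> ->]]]; exists (mder i p), (mder i p').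
by rewrite /ev !(preval_mder _ _ _ hid); split=> //; apply: coef_rel_der.
Qed.

Let grel_nat1 c : K c -> grel c c.
Proof. by move=> Kc; apply/grel_srel/srelC. Qed.

Let grelB x x' z z' : grel x x' -> grel z z' -> grel (x - z) (x' - z').
Proof.
move=> hx hz; rewrite -(mulN1r z) -(mulN1r z'); apply: grelD => //.
by apply: grelM => //; apply: grel_nat1; apply: (subfieldN KF (subfield1 KF)).
Qed.

(** Independence of [a'] over K<b1> forces every coefficient at [b1] to vanish; [spec] then kills
    each corresponding coefficient at [y]. *)
Let grel0 x' : grel 0 x' -> x' = 0.
Proof.
move=> [q [q' [hq e ->]]]; have q0 : q = 0.
  apply: alg_indep_pr indep_b1 _ _; last by rewrite -/(ev q) -e.
  by move=> mu; apply: srel_b1 (coef_relP hq mu).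
suff -> : q' = 0 by rewrite /ev rmorph0.
rewrite -(pr_toK q'); suff -> : pr_to q' = 0 by rewrite rmorph0.
apply/malgP => mu; rewrite mcoeff0; apply: srel0.
by have := coef_relP hq mu; rewrite q0 rmorph0 mcoeff0.
Qed.

Let grel_pcoef mu : grel (@pcoef m n U f mu) (@pcoef m n U f mu).
Proof.
exists (prX U (mu, dop0 m)), (prX U (mu, dop0 m)).
by rewrite /ev prevalX /jets /= dappE dapply0; split=> //; apply: coef_relX.
Qed.

Let grel_sum (s : seq {cmonom (dvar m n)}) : {subset s <= pmons f} ->
  grel (\sum_(mu <- s) f@_mu * monval b1 mu) (\sum_(mu <- s) f@_mu * monval y mu).
Proof.
elim: s => [|mu s IH] hs.
  by rewrite !big_nil; apply: grel_nat1; apply: subfield0.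
rewrite !big_cons; apply: grelD; last first.
  by apply: IH => nu hnu; apply: hs; rewrite inE hnu orbT.
apply: grelM; last by apply: grel_srel.
have hmu : (mu \in msupp f) && (mu != mone) by rewrite -mem_pmons hs ?mem_head.
exact: (grel_pcoef (exist _ mu hmu)).
Qed.

(** Both points lie on the hypersurface, so the constant coefficient is minus the same combination
    at [b1] and at [y]: it too is fixed by the specialization. *)
Let grel_f1 : grel f@_mone f@_mone.
Proof.
have e b : deval f b = 0 -> f@_mone = 0 - \sum_(mu <- pmons f) f@_mu * monval b mu.
  rewrite (deval_generic KP f_generic) => /eqP; rewrite addr_eq0 => /eqP ->.
  by rewrite sub0r.
rewrite {1}(e _ fb1) (e _ fy); apply: grelB; last exact: grel_sum.
by apply: grel_nat1; apply: subfield0.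
Qed.

Let grel_hcoef (mu : hmon m n h r) : grel (hcoef f mu) (hcoef f mu).
Proof.
case: mu => mu hmu; rewrite /hcoef /=; have [->|n1] := eqVneq mu mone.
  exact: grel_f1.
have hmu' : (mu \in msupp f) && (mu != mone).
  by rewrite n1 andbT (msupp_generic KP f_generic).
exact: (grel_pcoef (exist _ mu hmu')).
Qed.

(** Elements of K<a> are quotients. The denominator [q] is the same nonzero element on both sides,
    so it can be cancelled at [y]. *)
Let frel (x x' : U) : Prop := exists q, [/\ q != 0, grel q q & grel (q * x) (q * x')].

Let frel_grel x x' : grel x x' -> frel x x'.
Proof.
move=> hx; exists 1; rewrite oner_neq0 !mul1r; split=> //.
by apply: grel_nat1; apply: subfield1.
Qed.

Let frelD x x' z z' : frel x x' -> frel z z' -> frel (x + z) (x' + z').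
Proof.
move=> [q [q0 hq hx]] [s [s0 hs hz]]; exists (q * s); split.
- by rewrite mulf_neq0.
- exact: grelM.
- have -> : q * s * (x + z) = s * (q * x) + q * (s * z) by ring.
  have -> : q * s * (x' + z') = s * (q * x') + q * (s * z') by ring.
  by apply: grelD; apply: grelM.
Qed.

Let frelM x x' z z' : frel x x' -> frel z z' -> frel (x * z) (x' * z').
Proof.
move=> [q [q0 hq hx]] [s [s0 hs hz]]; exists (q * s); split.
- by rewrite mulf_neq0.
- exact: grelM.
- have -> : q * s * (x * z) = (q * x) * (s * z) by ring.
  have -> : q * s * (x' * z') = (q * x') * (s * z') by ring.
  exact: grelM.
Qed.

Let frel_adjoin c : diff_adjoin K (range (@hcoef m n h r U f)) c -> frel c c.
Proof.
move: c; apply: diff_adjoin_min; last first.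
  move=> c [Kc|[mu _ <-]]; apply: frel_grel; first exact: grel_nat1.
  exact: grel_hcoef.
split; last first.
  move=> i x [q [q0 hq hx]]; exists (q * q); split.
  - by rewrite mulf_neq0.
  - exact: grelM.
  - have -> : q * q * der i x = q * der i (q * x) - der i q * (q * x).
      by rewrite derM; ring.
    by apply: grelB; apply: grelM => //; apply: grel_der.
apply/subfieldP; split.
- by apply: frel_grel; apply: grel_nat1; apply: subfield1.
- move=> x z hx hz; apply: frelD => //; rewrite -mulN1r; apply: frelM => //.
  by apply: frel_grel; apply: grel_nat1; apply: (subfieldN KF (subfield1 KF)).
- move=> x z hx [q [q0 hq hz]]; apply: frelM => //.
  have [->|z0] := eqVneq z 0.
    by rewrite invr0; apply: frel_grel; apply: grel_nat1; apply: subfield0.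
  by exists (q * z); rewrite mulf_neq0 // mulfK.
Qed.

Lemma specialize_over (p : dpoly U n) :
  ipoly_over (diff_adjoin K (range (@hcoef m n h r U f))) p ->
  deval p b1 = 0 -> deval p y = 0.
Proof.
move=> Kp; suff : frel (deval p b1) (deval p y).
  move=> [q [q0 _ hq]] e; move: hq; rewrite e mulr0 => /grel0 /eqP.
  by rewrite mulf_eq0 (negbTE q0) => /eqP.
rewrite !devalE; have : vars_in setT p by [].
move: p Kp; apply: ipoly_ind_over.
- by rewrite !rmorph0; apply: frel_grel; apply: grel_nat1; apply: subfield0.
- by rewrite !rmorph1; apply: frel_grel; apply: grel_nat1; apply: subfield1.
- by move=> c hc; rewrite !pevalC; apply: frel_adjoin.
- by move=> v _; rewrite !pevalX; apply: frel_grel; apply: grel_srel.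
- by move=> p q hp hq; rewrite !rmorphD; apply: frelD.
- by move=> p q hp hq; rewrite !rmorphM; apply: frelM.
Qed.

End Specialization.

(** * The transcendence degree of a hypersurface section *)

Section JetGrowth.
Variables (m n : nat) (U : diffField m) (b : 'I_n -> U) (G : set U).
Hypothesis GD : forall i z, G z -> G (der i z).

(** Reads off the order of an operator by letting each derivation act as the successor; the next
    induction uses it to carry the order along. *)
Lemma dapply_succ (th : dop m) : dapply (fun _ => S) th 0%N = dord th.
Proof.
rewrite /dapply /dord -big_enum /=; elim: (enum 'I_m) => [|i s IH] /=.
  by rewrite big_nil.
by rewrite big_cons IH; elim: (th i) => //= k ->.
Qed.

Lemma fld_jet_dapp th z s : fld (G `|` jet_le b s) z ->
  fld (G `|` jet_le b (s + dord th)) (dapp th z).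
Proof.
move=> hz; pose D (i : 'I_m) (p : U * nat) := (der i p.1, p.2.+1).
pose P (p : U * nat) := fld (G `|` jet_le b (s + p.2)) p.1.
have : P (dapply D th (z, 0%N)).
  apply: (dapply_ind (P := P)) => [i [w k] hw|]; last by rewrite /P /= addn0.
  rewrite /P /= addnS; apply: fld_der hw => u.
    move=> hu; apply: sub_fld; case: hu => [|[v hv <-]]; first by left.
    by right; exists v => //=; apply: leq_trans hv _.
  case=> u' hu' <-; apply: sub_fld; case: hu' => [Gu|[v hv <-]].
    by left; apply: GD.
  right; exists (shift i v); last by rewrite /jets der_dapp.
  by rewrite /= dord_add dord_unit add1n ltnS.
rewrite /P (@dapply_morph _ _ _ D (@der m U) fst) //.
by rewrite (@dapply_morph _ _ _ D (fun _ => S) snd) //= dapply_succ.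
Qed.

End JetGrowth.

Lemma dops_le (m T : nat) : exists s : seq (dop m), [/\ uniq s,
  size s = 'C(m + T, m) & forall th, (th \in s) = (dord th <= T)%N].
Proof.
pose X := [set x : m.-tuple 'I_T.+1 | (\sum_(i <- x) i <= T)%N]%SET.
pose emb (x : m.-tuple 'I_T.+1) : dop m := [ffun i => tnth x i : nat].
have emb_inj : injective emb.
  move=> x y /ffunP e; apply: eq_from_tnth => i; apply: val_inj.
  by have := e i; rewrite !ffunE.
have dord_emb x : dord (emb x) = (\sum_(i <- x) i)%N.
  by rewrite /dord big_tuple; apply: eq_bigr => i _; rewrite ffunE.
exists [seq emb x | x <- enum X]; split.
- by rewrite map_inj_uniq // enum_uniq.
- by rewrite size_map -cardE card_partial_ord_partitions.
- move=> th; apply/mapP/idP => [[x]|hth].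
    by rewrite mem_enum finset.in_set => hx ->; rewrite dord_emb.
  have hi i : (th i < T.+1)%N.
    by rewrite ltnS; apply: leq_trans hth; rewrite /dord (bigD1 i) //= leq_addr.
  have e : th = emb [tuple Ordinal (hi i) | i < m].
    by apply/ffunP => i; rewrite ffunE tnth_mktuple.
  exists [tuple Ordinal (hi i) | i < m] => //.
  by rewrite mem_enum finset.in_set -dord_emb -e.
Qed.

Lemma indep_cat (m : nat) (U : diffField m) (F : set U) s t :
  indep (F `|` [set` t]) s -> indep F t -> indep F (s ++ t).
Proof.
move=> + ht; elim: s => //= x s IH [hx /IH hs]; split=> // h'; apply: hx.
apply: cl_mono h' => z [|/=]; first by left; left.
by rewrite mem_cat => /orP[zs|zt]; [right|left; right].
Qed.

(** At [t] the product in [binom_poly] is the falling factorial of [m + (t - h)]; [h <= t] keeps the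
    natural subtraction exact. *)
Lemma binom_poly_eval (m h t : nat) : (h <= t)%N ->
  (binom_poly m (m%:R - h%:R)).[t%:R] = ('C(m + (t - h), m))%:R.
Proof.
move=> ht; rewrite /binom_poly hornerZ horner_prod.
have m0 : (m`!%:R : rat) != 0 by rewrite Num.Theory.pnatr_eq0 -lt0n fact_gt0.
apply: (mulfI m0); rewrite mulrA mulfV // mul1r -natrM mulnC bin_ffact ffact_prod natr_prod.
apply: eq_bigr => i _; rewrite hornerD hornerX hornerC natrB; last first.
  by apply: leq_trans (ltnW (ltn_ord i)) (leq_addr _ _).
by rewrite natrD natrB //; ring.
Qed.

Section HypersurfaceSection.
Variables (m n h r : nat) (U : diffField m) (K : set U) (f : dpoly U n).
Hypotheses (KP : is_diff_subfield K) (r_gt0 : (0 < r)%N)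
  (f_generic : generic_dpoly K h r f).

Let KF := KP.1.
Let pc := @pcoef m n U f.
(** Only a generating set of K<a'>, stable under derivations; it has the same closure as the
    field. *)
Let G := K `|` range (jets pc).

Let GD i z : G z -> G (der i z).
Proof.
case=> [Kz|[v _ <-]]; first by left; apply: KP.2.
by right; exists (shift i v) => //; rewrite /jets der_dapp.
Qed.

(** The equation expresses the constant coefficient through [a'] and jets of order at most [h], and
    each derivation raises that order by one. *)
Lemma const_coef_jet y th : deval f y = 0 ->
  fld (G `|` jet_le (coordinate y) (h + dord th)) (dapp th f@_mone).
Proof.
move=> fy; apply: (fld_jet_dapp GD).
have FF := fldP (G `|` jet_le (coordinate y) h).
have -> : f@_mone = - \sum_(mu <- pmons f) f@_mu * monval y mu.
  by move: fy; rewrite (deval_generic KP f_generic) => /eqP; rewrite addr_eq0 => /eqP.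
apply: (subfieldN FF); rewrite big_seq; apply: (subfield_sum FF) => mu hmu.
apply: (subfieldM FF).
  have hmu' : (mu \in msupp f) && (mu != mone) by rewrite -mem_pmons.
  apply: sub_fld; left; right; exists (exist _ mu hmu' : pmon f, dop0 m) => //.
  by rewrite /jets /= dappE dapply0.
have /andP[/allP hord _] := pmons_le KP f_generic hmu.
rewrite /monval /moneval big_seq; apply: (big_ind (fld (G `|` jet_le (coordinate y) h))).
- exact: (subfield1 FF).
- exact: (subfieldM FF).
- move=> v vmu; apply: (subfieldX FF); apply: sub_fld; right.
  by exists v => //; apply: hord.
Qed.

Lemma const_coef_findep : findep G (fun th : dop m => dapp th f@_mone).
Proof.
have h1 : dmonom_le h r (mone : {cmonom (dvar m n)}).
  by rewrite -(msupp_generic KP f_generic) (mone_msupp KP f_generic).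
have hp (mu : pmon f) : dmonom_le h r (val mu).
  by rewrite -(msupp_generic KP f_generic); case/andP: (svalP mu).
apply: findep_sumr.
pose rho (v : (pmon f * dop m) + dop m) : hmon m n h r * dop m :=
  match v with inl w => (exist _ (val w.1) (hp w.1), w.2)
             | inr th => (exist _ mone h1, th) end.
have rho_inj : injective rho.
  move=> [[mu th]|th] [[nu et]|et] //= [].
  - by move=> e ->; congr (inl (_, _)); apply: val_inj.
  - by move=> e; have /andP[_] := svalP mu; rewrite /= e eqxx.
  - by move=> e; have /andP[_] := svalP nu; rewrite /= -e eqxx.
  - by move=> ->.
have := findep_reindex rho_inj ((alg_indepP _ KF).1 (hcoef_indep f_generic)).
by congr (findep K _); apply: funext => -[[mu th]|th].
Qed.

Lemma hcoeffs_cover (s : seq (dop m)) T : (forall th, (th \in s) = (dord th <= T)%N) ->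
  diff_adjoin K (range (@hcoef m n h r U f)) `<=`
  fld ((G `|` [set` [seq dapp th f@_mone | th <- s]]) `|`
    range (fun th : {th : dop m | (T < dord th)%N} => dapp (val th) f@_mone)).
Proof.
move=> sP; rewrite diff_adjoin_fld //; apply: fld_mono => z [Kz|[[[mu hmu] th] _ <-]].
  by left; left; left.
rewrite /jets /hcoef /=; have [->|n1] := eqVneq mu mone.
  have [hth|hth] := leqP (dord th) T; last by right; exists (exist _ th hth).
  by left; right; apply: map_f; rewrite sP.
left; left; right; have hmu' : (mu \in msupp f) && (mu != mone).
  by rewrite n1 andbT (msupp_generic KP f_generic).
by exists ((exist _ mu hmu' : pmon f), th).
Qed.

(** A leader over [K] is also one over K<a'>. On the hypersurface the constant coefficient is a
    function of jets, so it would inherit their slow growth, against its independence. *)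
Lemma diff_algebraic_section_empty (y : 'rV[U]_n) :
  (forall i, ~ findep K (fun th : dop m => dapp th (y 0 i))) -> deval f y <> 0.
Proof.
move=> hy fy; have GP := diff_adjoinP K (range pc).
have GE := diff_adjoin_fld pc KP.
have lead i : exists th, leader (@nat_of_ord n) (diff_adjoin K (range pc))
    (coordinate y) (i, th).
  apply: contrapT => /forallNP nl; apply: (hy i).
  apply: (leaderless_findep (rk := @nat_of_ord n) (G := K) (b := coordinate y)
    (g := id) (@ord_inj n)) => //; last by move=> z; left.
  move=> th hth; apply: (nl th); apply: cl_mono hth => z [Kz|]; last by right.
  by left; apply: sub_diff_adjoin; left.
apply: (leaders_diff_algebraic (c := f@_mone) (s := h) GP lead).
  move=> th; apply: fld_cl; have := const_coef_jet (th := th) fy; apply: fld_mono.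
  by move=> z [Gz|]; [left; rewrite GE; apply: sub_fld|right].
apply: findep_sub const_coef_findep => z; rewrite GE.
exact: fld_cl.
Qed.

Variable b1 : 'rV[U]_n.
Hypotheses (fb1 : deval f b1 = 0)
  (indep_b1 : alg_indep (diff_adjoin K (coords b1)) (jets pc)).

Let L := diff_adjoin K (coords b1).
Let LP : is_diff_subfield L := diff_adjoinP K (coords b1).

Let jet_L t : K `|` jet_le (coordinate b1) t `<=` L.
Proof.
move=> z [Kz|[v _ <-]]; first by apply: sub_diff_adjoin; left.
by apply: (diff_subfield_dapp _ LP); apply: sub_diff_adjoin; right; exists v.1.
Qed.

Let fld_jet_L t : fld (K `|` jet_le (coordinate b1) t) `<=` L.
Proof. exact: fld_min LP.1 (@jet_L t). Qed.

(** An operator of order exactly [h] lifts orders above [t - h] to orders above [t]. Without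
    derivations every operator has order 0 and the second clause is vacuous. *)
Let top_order_operator (t : nat) : (h <= t)%N -> exists2 tau : dop m,
  (dord tau <= h)%N & forall th, (t - h < dord th)%N -> (t < dord (dop_add th tau))%N.
Proof.
move=> ht; have [[i _]|no] := pselect (exists i : 'I_m, True).
  pose tau : dop m := [ffun j => if j == i then h else 0%N].
  have tauE : dord tau = h.
    rewrite /dord (bigD1 i) //= ffunE eqxx big1 ?addn0 // => j /negbTE ji.
    by rewrite ffunE ji.
  by exists tau; [rewrite tauE|move=> th; rewrite dord_add tauE; lia].
have d0 (th : dop m) : dord th = 0%N.
  by rewrite /dord big1 // => i _; case: no; exists i.
by exists (dop0 m) => [|th]; rewrite d0 ?ltn0.
Qed.

Variable i0 : 'I_n.
Hypothesis nl : forall th, ~ leader (@nat_of_ord n) K (coordinate b1) (i0, th).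

Let high_findep t : (h <= t)%N ->
  findep (fld (K `|` jet_le (coordinate b1) t) `|` range (jets pc))
    (fun th : {th : dop m | (t - h < dord th)%N} => dapp (val th) f@_mone).
Proof.
move=> ht; have [tau tauh tauP] := top_order_operator ht.
have MF := fldP (K `|` jet_le (coordinate b1) t).
apply: findep_sumr; apply/(alg_indepP _ MF).
have [D DE] : exists D : seq (pmon f), map val D = pmons f.
  exists (pmap insub (pmons f)); rewrite pmap_filter; last exact: insubK.
  by apply/all_filterP/allP => mu; rewrite mem_pmons => hmu; rewrite insubT.
(* The pivot of the combination is the linear monomial tau y_i0. Its derivatives of order above
   [t - h] are jets of the leaderless coordinate of order above [t]. *)
have hj0 : (ucm (i0, tau) \in msupp f) && (ucm (i0, tau) != mone).
  by rewrite -mem_pmons (linear_pmons KP r_gt0 f_generic).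
pose j0 : pmon f := exist _ (ucm (i0, tau)) hj0.
have uD : uniq D by rewrite -(map_inj_uniq val_inj) DE pmons_uniq.
have j0D : j0 \in D by rewrite -(mem_map val_inj) DE mem_pmons.
pose e (mu : pmon f) := monval b1 (val mu).
have Le mu : L (e mu).
  have LF := LP.1; rewrite /e /monval /moneval; apply: (big_ind L).
  - exact: (subfield1 LF).
  - exact: (subfieldM LF).
  - move=> v _; apply: (subfieldX LF); apply: (@jet_L (dord v.2)); right.
    by exists v => /=.
pose g (th : {th : dop m | (t - h < dord th)%N}) : dop m := val th.
have e_indep : alg_indep (fld (K `|` jet_le (coordinate b1) t))
    (fun th => dapp (g th) (e j0)).
  apply/(alg_indepP _ MF).
  apply: (@findep_sub _ _ _ _ (K `|` jet_le (coordinate b1) t)); first exact: fld_cl.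
  have ginj : injective (fun th => dop_add (g th) tau).
    move=> th et /ffunP eq; apply: val_inj; apply/ffunP => i.
    by have := eq i; rewrite !ffunE => /addIn.
  have := leaderless_findep (@ord_inj n) nl ginj (Y := K `|` jet_le (coordinate b1) t).
  move=> H; have {H} : findep (K `|` jet_le (coordinate b1) t)
      (fun l => dapp (dop_add (g l) tau) (coordinate b1 i0)).
    apply: H => z [Kz|[v hv <-]]; [by left|right; exists v; split=> // th].
    by apply: rank_lt_dord; apply: leq_ltn_trans hv _; apply: tauP; apply: (svalP th).
  congr (findep _ _); apply: funext => th.
  by rewrite /e /= monval_ucm dapp_add.
have := generic_combination_indep (A := pc) (D := D) (e := e) (j0 := j0) (g := g)
  MF LP (@fld_jet_L t) indep_b1 Le uD j0D e_indep.
congr (alg_indep _ _); apply: funext => -[v|th] //; rewrite /g; congr (dapp _ _).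
move: fb1; rewrite (deval_generic KP f_generic) => /eqP; rewrite addr_eq0 => /eqP ->.
by congr (- _); rewrite -DE big_map.
Qed.

(** The low derivatives of the constant coefficient are completed to a basis over K<a'> by a sublist
    [u] of a basis [s] of the jets. Steinitz compares the two bases, and [u] remains a basis over
    K<a>. *)
Lemma section_trdeg t k : (h <= t)%N ->
  is_trdeg K (adjoin K (jet t b1)) k ->
  exists2 k', is_trdeg (diff_adjoin K (range (@hcoef m n h r U f)))
      (adjoin (diff_adjoin K (range (@hcoef m n h r U f))) (jet t b1)) k' &
    (k' + 'C(m + (t - h), m))%N = k.
Proof.
move=> ht /(trdeg_basis KF) [s [sK sS Ss sk]].
set Ka := diff_adjoin K _; have KaF : is_subfield Ka := (diff_adjoinP _ _).1.
have jetE : jet t b1 = jet_le (coordinate b1) t by [].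
set X := jet t b1 in sS Ss *.
have [ops [ops_u ops_s opsP]] := dops_le m (t - h).
pose low := [seq dapp th f@_mone | th <- ops].
have sL : [set` s] `<=` L by move=> z /sS; rewrite /X jetE; apply: fld_jet_L.
have pcL : findep (K `|` L) (jets pc).
  apply: findep_sub ((alg_indepP _ LP.1).1 indep_b1) => z hz; apply: sub_cl.
  by case: hz => // Kz; apply: sub_diff_adjoin; left.
(* The jets of [a'] are independent over K<b1>, which contains [s]; by symmetry [s] stays
   independent once they join the base. *)
have sG : indep G s := findep_indep_swap pcL sL sK.
have sGX : [set` s] `<=` cl (G `|` X).
  by move=> z /sS zX; apply: fld_cl; apply: fld_mono zX => w [Kw|]; [left; left|right].
have XGs : X `<=` cl (G `|` [set` s]).
  by move=> z /Ss; apply: cl_mono => w [Kw|]; [left; left|right].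
have lowG : indep G low by apply: (findepP _ _).1 const_coef_findep _ ops_u.
have lowX : [set` low] `<=` cl (G `|` X).
  move=> z /= /mapP[th]; rewrite opsP => hth ->; apply: fld_cl.
  have := const_coef_jet (th := th) fb1; apply: fld_mono => w [|[v hv <-]]; first by left.
  right; exists v => //=; apply: leq_trans hv _.
  by rewrite -(subnKC ht) leq_add2l.
(* Taking [u] inside [s] keeps it in the field generated by the jets of order at most [t], as the
   next symmetry argument requires. *)
have [u [us uF su _]] := ordered_basis id (G `|` [set` low]) s.
rewrite !map_id in uF su.
have usub z : z \in u -> z \in s by apply: (mem_subseq us).
have ul : indep G (u ++ low) by apply: indep_cat.
have size_eq : (size u + size low)%N = k.
  rewrite -size_cat -sk; apply/eqP; rewrite eqn_leq; apply/andP; split.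
    apply: steinitz ul _ => z /=; rewrite mem_cat => /orP[/usub zs|/lowX].
      by apply: sub_cl; right.
    by apply: cl_sub => w [Gw|/XGs //]; apply: sub_cl; left.
  apply: steinitz sG _ => z /su; apply: cl_mono => w [[Gw|wl]|wu].
  - by left.
  - by right; rewrite /= mem_cat wl orbT.
  - by right; rewrite /= mem_cat wu.
exists (size u); last by rewrite -size_eq size_map ops_s.
have hiX := high_findep ht; rewrite -jetE -/X in hiX.
have uX : [set` u] `<=` fld (K `|` X) by move=> z /usub /sS.
(* The high derivatives of the constant coefficient are independent over the jets, so by symmetry
   adding them to the base leaves [u] independent. *)
have uh : indep ((G `|` [set` low]) `|`
    range (fun th : {th : dop m | (t - h < dord th)%N} => dapp (val th) f@_mone)) u.
  apply: findep_indep_swap uX uF.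
  apply: findep_sub hiX => z.
  have sub : G `|` X `<=` cl (fld (K `|` X) `|` range (jets pc)).
    move=> w hw; apply: sub_cl; case: hw => [[Kw|pw]|Xw]; [left|by right|left].
      by apply: sub_fld; left.
    by apply: sub_fld; right.
  case=> [[Gz|zl]|zX]; last by apply: sub_cl; left.
    by apply: sub; left.
  exact: cl_sub sub _ (lowX _ zl).
have hcov := hcoeffs_cover opsP; rewrite -/Ka -/low in hcov.
have KKa : K `<=` Ka by move=> z Kz; apply: sub_diff_adjoin; left.
have hcKa mu th : dmonom_le h r mu -> Ka (dapp th f@_mu).
  move=> hmu; apply: (diff_subfield_dapp _ (diff_adjoinP _ _)).
  by apply: sub_diff_adjoin; right; exists (exist _ mu hmu).
have GKa : G `<=` Ka.
  move=> z [/KKa //|[v _ <-]]; apply: hcKa.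
  by rewrite -(msupp_generic KP f_generic); case/andP: (svalP v.1).
have lowKa : [set` low] `<=` Ka.
  move=> z /= /mapP[th _ ->]; apply: hcKa.
  by rewrite -(msupp_generic KP f_generic) (mone_msupp KP f_generic).
apply/(trdeg_basis KaF); exists u; split=> //.
- by apply: indep_sub uh => z /hcov; apply: fld_cl.
- by move=> z /uX; apply: fld_mono => w [/KKa|]; [left|right].
- move=> z /XGs; apply: cl_sub => w [/GKa Gw|/su]; first by apply: sub_cl; left.
  by apply: cl_mono => v [[/GKa|/lowKa]|]; [left|left|right].
Qed.

End HypersurfaceSection.

(** * Leaderless coordinates, irreducibility and the final assembly *)

Section LeaderlessCoordinate.
Variables (m n d : nat) (U : diffField m) (K : set U) (b : 'rV[U]_n).
Hypothesis KP : is_diff_subfield K.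

Lemma diff_adjoin_jet z : diff_adjoin K (coords b) z ->
  exists s, fld (K `|` jet_le (coordinate b) s) z.
Proof.
have up s t : (s <= t)%N -> fld (K `|` jet_le (coordinate b) s) `<=`
    fld (K `|` jet_le (coordinate b) t).
  move=> st; apply: fld_mono => w [|[v hv <-]]; first by left.
  by right; exists v => //=; apply: leq_trans hv st.
move: z; apply: diff_adjoin_min; last first.
  move=> z [Kz|[i _ <-]]; exists 0%N; apply: sub_fld; first by left.
  right; exists (i, dop0 m); last by rewrite /jets /= dappE dapply0.
  by rewrite /= /dord big1 // => j _; rewrite ffunE.
split; last first.
  move=> i z [s hz]; exists (s + dord (dop_unit i : dop m))%N.
  have := fld_jet_dapp KP.2 (th := dop_unit i) hz.
  by rewrite dappE dapply_unit.
apply/subfieldP; split.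
- by exists 0%N; apply: (subfield1 (fldP _)).
- move=> x y [s hx] [t hy]; exists (maxn s t).
  by apply: (subfieldB (fldP _)); [apply: up hx|apply: up hy]; rewrite ?leq_maxl ?leq_maxr.
- move=> x y [s hx] [t hy]; exists (maxn s t).
  by apply: (subfield_div (fldP _)); [apply: up hx|apply: up hy]; rewrite ?leq_maxl ?leq_maxr.
Qed.

Lemma leaderless_coordinate : (0 < d)%N ->
  is_diff_trdeg K (diff_adjoin K (coords b)) d ->
  exists i0, forall th, ~ leader (@nat_of_ord n) K (coordinate b) (i0, th).
Proof.
move=> d0 [c [cE ci _]]; apply: contrapT => /forallNP nl.
have lead i : exists th, leader (@nat_of_ord n) K (coordinate b) (i, th).
  by apply: contrapT => /forallNP h; apply: (nl i).
pose c0 := c (Ordinal d0); have [s hs] := diff_adjoin_jet (cE (Ordinal d0)).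
apply: (leaders_diff_algebraic (c := c0) (s := s) KP lead).
  by move=> th; apply: fld_cl; apply: (fld_jet_dapp KP.2).
have ginj : injective (fun th : dop m => (Ordinal d0, th)) by move=> th et [].
exact: findep_reindex ginj ((alg_indepP _ KP.1).1 ci).
Qed.

End LeaderlessCoordinate.

(** One of the two closed pieces contains [b], and a closed subset containing a generic point is
    everything. *)
Lemma generic_irreducible (m n : nat) (U : diffField m) (F : set U)
    (W : set 'rV[U]_n) b :
  kolchin_closed F W -> generic_point F W b -> kolchin_irreducible F W.
Proof.
move=> WC [Wb gen]; split=> // W1 W2 [S1 F1 e1] [S2 F2 e2] WE.
have sub S (W' : set 'rV[U]_n) : (forall p, S p -> ipoly_over F p) ->
    W' = [set y | forall p, S p -> deval p y = 0] -> W' `<=` W -> W' b -> W = W'.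
  move=> FS -> W'W bW'; apply/seteqP; split=> // y Wy p Sp.
  by apply: gen Wy => //; [apply: FS|apply: bW'].
have : (W1 `|` W2) b by rewrite -WE.
case=> hb; [left; apply: (sub S1)|right; apply: (sub S2)] => //.
  by rewrite WE; apply: subsetUl.
by rewrite WE; apply: subsetUr.
Qed.

Theorem theorem3p7 (m n h r d : nat) (U : diffField m) (K : set U)
    (V : set 'rV[U]_n) (f : dpoly U n)
    (K_diff_subfield : is_diff_subfield K)
    (U_universal : universal_over K)
    (V_irreducible : kolchin_irreducible K V)
    (V_diff_trdeg : variety_diff_trdeg K V d)
    (r_gt0 : (0 < r)%N)
    (f_generic : generic_dpoly K h r f) :
  let Ka := diff_adjoin K (hcoeffs h r f) in
  let W := V `&` hypersurface f in
  [/\ kolchin_irreducible Ka W,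
      d = 0%N -> W = set0
    & (0 < d)%N -> forall w : {poly rat}, kolchin_poly K V w ->
        kolchin_poly Ka W (w - binom_poly m (m%:R - h%:R))].
Proof.
move=> Ka W; have KP := K_diff_subfield; have KF := KP.1.
have [[S SK VE] _] := V_irreducible.
have KaE : Ka = diff_adjoin K (range (@hcoef m n h r U f)) by rewrite /Ka hcoeffs_range.
have KaF : is_subfield Ka := (diff_adjoinP _ _).1.
have KKa : K `<=` Ka by move=> z Kz; apply: sub_diff_adjoin; left.
have WC : kolchin_closed Ka W.
  exists (S `|` [set f]).
    move=> p [/SK Kp mu|-> mu]; first exact: KKa.
    have [hmu|/f_generic.1 ->] := boolP (dmonom_le h r mu); last exact: (subfield0 KaF).
    by apply: sub_diff_adjoin; right; exists mu.
  rewrite /W VE /hypersurface; apply/seteqP; split=> y /=.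
    by move=> [hS fy] p [/hS|->].
  by move=> hy; split=> [p Sp|]; apply: hy; [left|right].
have [b [Vb bgen] btr] := V_diff_trdeg.
have Vspec p y : ipoly_over K p -> deval p b = 0 -> V y -> deval p y = 0.
  by move=> Kp e; apply: bgen.
have empty : d = 0%N -> W = set0.
  move=> d0; rewrite d0 in btr; have [c [_ _ calg]] := btr.
  apply/seteqP; split=> // y [Vy fy].
  apply: (diff_algebraic_section_empty KP f_generic (y := y)) fy => i fi.
  have [|p [p0 Kp pb]] := calg (b 0 i).
    by apply: sub_diff_adjoin; right; exists i.
  (* A transcendence basis of length 0 adjoins nothing, so the coefficients lie in [K]. *)
  have {}Kp : ipoly_over K p.
    by move=> mu; apply: diff_adjoin_min (Kp mu) => // z [//|[[]]].
  case/eqP: p0; apply: ((alg_indepP _ KF).2 fi) => //.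
  rewrite ievalE; pose rho (th : dop m) : dvar m n := (i, th).
  (* The differential equation of a coordinate of [b] holds on all of V, in particular at [y]. *)
  have := Vspec (relabel rho p) y (relabel_over KF rho Kp).
  rewrite !deval_relabel; apply=> //; move: pb.
  by rewrite ievalE.
(* Stated for any generic point, because the Kolchin polynomial comes with a generic point of its
   own. *)
have VP c : V c -> generic_point K V c -> forall i0,
    (forall th, ~ leader (@nat_of_ord n) K (coordinate c) (i0, th)) ->
    exists c1, [/\ forall p, ipoly_over K p -> (deval p c1 = 0 <-> deval p c = 0),
      generic_point Ka W c1, deval f c1 = 0 &
      alg_indep (diff_adjoin K (coords c1)) (jets (@pcoef m n U f))].
  move=> Vc [_ cgen] i0 nl.
  have [c1 [c1E fc1 c1i]] := generic_intersection_point KP r_gt0 f_generic U_universal nl.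
  exists c1; split=> //; split.
    split=> //; rewrite VE => p Sp; apply/(c1E _ (SK _ Sp)).
    by move: Vc; rewrite VE; apply.
  move=> p Kp pc1 y [Vy fy]; rewrite KaE in Kp.
  apply: (specialize_over KP f_generic (b1 := c1)) Kp pc1 => // q Kq /(c1E _ Kq).1 qc.
  exact: cgen.
have bgP : generic_point K V b by split.
have [d0|d_gt0] := posnP d.
  (* The section is empty here, and the empty set counts as irreducible. *)
  split=> //; split=> // W1 W2 _ _; rewrite empty // => /esym e0; left.
  by apply/esym; have := @subsetUl _ W1 W2; rewrite e0 subset0.
have [i0 nl] := leaderless_coordinate KP d_gt0 btr.
split=> //.
  have [c1 [_ c1g _ _]] := VP b Vb bgP i0 nl.
  exact: generic_irreducible c1g.
move=> _ w [c [Vc cgen] [N0 hN]].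
have bc p : ipoly_over K p -> (deval p b = 0 <-> deval p c = 0).
  by move=> Kp; split=> e; [apply: bgen|apply: cgen].
have cb p : ipoly_over K p -> (deval p c = 0 <-> deval p b = 0).
  by move=> /bc [? ?]; split.
(* Having no leader is a statement about closures of jets, so it passes from [b] to [c] and then to
   [c1]. *)
have nlc th : ~ leader (@nat_of_ord n) K (coordinate c) (i0, th).
  by move=> hl; apply: (nl th); apply: (cl_transfer KF cb hl).
have [c1 [c1E c1g fc1 c1i]] := VP c Vc (conj Vc cgen) i0 nlc.
have cc1 p : ipoly_over K p -> (deval p c = 0 <-> deval p c1 = 0).
  by move=> /c1E [? ?]; split.
have nl1 th : ~ leader (@nat_of_ord n) K (coordinate c1) (i0, th).
  by move=> hl; apply: (nlc th); apply: (cl_transfer KF c1E hl).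
(* The threshold must also exceed [h], since the count of derivatives of the constant coefficient
   needs [h <= t]. *)
exists c1 => //; exists (maxn N0 h) => t; rewrite geq_max => /andP[tN ht].
have [k kt wk] := hN t tN.
have kt1 := trdeg_transfer KF cc1 kt.
have [k' k't kE] := section_trdeg KP r_gt0 f_generic fc1 c1i nl1 ht kt1.
exists k'; first by rewrite KaE.
by rewrite hornerD hornerN wk binom_poly_eval // -kE natrD addrK.
Qed.
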